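(* Let $n\ge 3$. Let $R>0$ and let $\mu\in C^\infty([0,\infty))$ be real-valued with $\mu\le 1$ on $[0,\infty)$, $\mu=1$ on $[0,R]$, $\mu>0$ on $(0,2R)$, $\mu<0$ on $(2R,\infty)$, and $\mu'(2R)<0$. Let \[ \Omega:=\left\{(x_1,x_2,x'')\in\mathbb{R}\times\mathbb{R}\times\mathbb{R}^{n-2}\,:\; x_1^2+x_2^2<\mu(|x''|^2)\right\}. \] Let $0\le\alpha<1$. Define $a_k:=0$ if $k\neq 2^j$ for all $j\in\mathbb{N}\setminus\{0\}$ and, if $k=2^j$ for some $j\in\mathbb{N}\setminus\{0\}$, define $a_k:=j^{-2}$ when $\alpha=0$ and $a_k:=2^{-j\alpha}$ when $0<\alpha<1$. Let \[ u(x):=\sum_{k=0}^\infty a_k\,\mathrm{Re}\bigl((x_1+ix_2)^k\bigr)\quad\text{for all }x=(x_1,x_2,\dots,x_n)\in\overline{\Omega}. \] Then $u$ is harmonic in $\Omega$, belongs to $C^{0,\alpha}(\overline{\Omega})$, does not belong to $C^{0,\alpha+\epsilon}(\overline{\Omega})$ for any $\epsilon>0$, and does not belong to $H^{\sigma+1/2}(\Omega)$ for any $\sigma>0$ if $\alpha=0$, and for any $\sigma\ge\alpha$ if $0<\alpha<1$.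
   Context: $\mathbb{N}$ includes $0$. $C^{0,\alpha}$ denotes the space of H\''older continuous functions with exponent $\alpha$, with the convention that $C^{0,0}$ is the space of continuous functions. $H^s$ denotes the usual $L^2$-based Sobolev space of (possibly fractional) order $s$. The set $\Omega$ is open, bounded and of class $C^\infty$. *)

(* Defs.v *)
From HB Require Import structures.
From mathcomp Require Import all_boot all_order all_algebra.
From mathcomp Require Import complex.
From mathcomp Require Import all_classical all_reals all_analysis.

Set Implicit Arguments.
Unset Strict Implicit.
Unset Printing Implicit Defensive.

Import Order.TTheory GRing.Theory Num.Theory.
Import numFieldNormedType.Exports.

Local Open Scope classical_set_scope.
Local Open Scope ring_scope.

(* The Borel sigma-algebra of R^n, presented as the product sigma-algebra
   (the one generated by the coordinates), as the library does for tuples. *)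
Section measurable_rV.
Context {R : realType} (n : nat).

Let coors : 'I_n -> 'rV[R]_n -> measurableTypeR R := fun i x => x 0 i.

Let rV_set0 : g_sigma_preimage coors set0.
Proof. exact: sigma_algebra0. Qed.

Let rV_setC A : g_sigma_preimage coors A -> g_sigma_preimage coors (~` A).
Proof. exact: sigma_algebraC. Qed.

Let rV_bigcup (F : _^nat) : (forall i, g_sigma_preimage coors (F i)) ->
  g_sigma_preimage coors (\bigcup_i (F i)).
Proof. exact: sigma_algebra_bigcup. Qed.

HB.instance Definition _ := @isMeasurable.Build default_measure_display
  'rV[R]_n (g_sigma_preimage coors) rV_set0 rV_setC rV_bigcup.

End measurable_rV.


Section lebesgue_rV.
Context {R : realType}.

Lemma measurable_coord n (i : 'I_n) :
  measurable_fun setT (fun x : 'rV[R]_n => x 0 i : measurableTypeR R).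
Proof.
move=> _ Y mY; rewrite setTI; apply: sub_sigma_algebra => /=.
rewrite -bigcup_seq/=; exists i => /=; first by rewrite mem_index_enum.
by exists Y => //; rewrite setTI.
Qed.

Lemma measurable_fun_coordP d (T : measurableType d) n (f : T -> 'rV[R]_n) :
  (forall i, measurable_fun setT (fun t => f t 0 i : measurableTypeR R)) ->
  measurable_fun setT f.
Proof.
move=> mf.
apply: measurability; first by [].
move=> _ [A + <-]; rewrite -bigcup_seq => -[i _ [B mB <-]].
by rewrite setTI; have := mf i measurableT B mB; rewrite setTI.
Qed.

(* The identification of R x R^n with R^(n+1), and its inverse. *)
Definition rV_cons n (p : measurableTypeR R * 'rV[R]_n) : 'rV[R]_(1 + n) :=
  row_mx (p.1 : R)%:M p.2.

Definition rV_uncons n (x : 'rV[R]_(1 + n)) : measurableTypeR R * 'rV[R]_n :=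
  (lsubmx x 0 0, rsubmx x).

Lemma rV_consK n : cancel (@rV_cons n) (@rV_uncons n).
Proof.
move=> [a v]; rewrite /rV_uncons /rV_cons /= row_mxKl row_mxKr.
by rewrite mxE eqxx mulr1n.
Qed.

Lemma measurable_rV_cons n : measurable_fun setT (@rV_cons n).
Proof.
apply: measurable_fun_coordP => i.
rewrite /rV_cons; case: (split_ordP i) => j ->.
- rewrite (_ : (fun t => _) = fst); first exact: measurable_fst.
  by apply/funext => -[a v]; rewrite /= row_mxEl !ord1 mxE eqxx mulr1n.
- rewrite (_ : (fun t => _) =
    (fun x : 'rV[R]_n => x 0 j : measurableTypeR R) \o snd).
    by apply: measurableT_comp; [exact: measurable_coord|exact: measurable_snd].
  by apply/funext => -[a v]; rewrite /= row_mxEr.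
Qed.

Lemma measurable_rV_uncons n : measurable_fun setT (@rV_uncons n).
Proof.
apply/measurable_fun_pairP; split.
- rewrite (_ : _ \o _ =
    (fun x : 'rV[R]_(1 + n) => x 0 (lshift n 0) : measurableTypeR R)).
    exact: measurable_coord.
  by apply/funext => x; rewrite /= mxE.
- apply: measurable_fun_coordP => i.
  rewrite (_ : (fun t => _) =
    (fun x : 'rV[R]_(1 + n) => x 0 (rshift 1 i) : measurableTypeR R)).
    exact: measurable_coord.
  by apply/funext => x; rewrite /= mxE.
Qed.

Section lebesgue_rV_step.
Local Open Scope ereal_scope.
Variables (n : nat) (mu : {sigma_finite_measure set 'rV[R]_n -> \bar R}).

Definition lebesgue_rV_step : set 'rV[R]_(1 + n) -> \bar R :=
  pushforward (lebesgue_measure \x mu) (@rV_cons n).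

Let mcons := @measurable_rV_cons n.

Let step0 : lebesgue_rV_step set0 = 0.
Proof. exact: measure0. Qed.

Let step_ge0 A : 0 <= lebesgue_rV_step A.
Proof. exact: measure_ge0. Qed.

Let step_sigma_additive : semi_sigma_additive lebesgue_rV_step.
Proof. exact: measure_semi_sigma_additive. Qed.

HB.instance Definition _ := isMeasure.Build _ _ _ lebesgue_rV_step
  step0 step_ge0 step_sigma_additive.

Let step_sigma_finite : sigma_finite setT lebesgue_rV_step.
Proof.
have /sigma_finiteP[F [TF ndF Foo]] := sigma_finiteT (@lebesgue_measure R).
have /sigma_finiteP[G [TG ndG Goo]] := sigma_finiteT mu.
exists (fun k => @rV_uncons n @^-1` (F k `*` G k)).
  rewrite -preimage_bigcup [X in _ @^-1` X](_ : _ = setT) ?preimage_setT//.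
  apply/seteqP; split => // -[x y] _.
  have [i _ Fix] : (\bigcup_i F i) x by rewrite -TF.
  have [j _ Gjy] : (\bigcup_i G i) y by rewrite -TG.
  exists (maxn i j) => //; split.
  - by move: x Fix; exact/subsetPset/ndF/leq_maxl.
  - by move: y Gjy; exact/subsetPset/ndG/leq_maxr.
move=> k; have [mF Fk] := Foo k; have [mG Gk] := Goo k; split.
  rewrite -[X in measurable X]setTI; apply: measurable_rV_uncons => //.
  exact: measurableX.
rewrite /lebesgue_rV_step /pushforward [X in (_ \x _) X](_ : _ = F k `*` G k).
  by rewrite product_measure1E// lte_mul_pinfty// ge0_fin_numE.
by rewrite -comp_preimage (_ : _ \o _ = id)//; apply/funext; exact: rV_consK.
Qed.

HB.instance Definition _ := Measure_isSigmaFinite.Build _ _ _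
  lebesgue_rV_step step_sigma_finite.

End lebesgue_rV_step.

Fixpoint lebesgue_rV n : {sigma_finite_measure set 'rV[R]_n -> \bar R} :=
  if n is k.+1 then lebesgue_rV_step (lebesgue_rV k) else \d_(0 : 'rV[R]_0).

End lebesgue_rV.

Lemma lebesgue_rV_box (R : realType) n (A : 'I_n -> set (measurableTypeR R)) :
  (forall i, measurable (A i)) ->
  lebesgue_rV n [set x | forall i, A i (x 0 i)] =
  (\prod_(i < n) lebesgue_measure (A i))%E.
Proof.
elim: n A => [|n IH] A mA.
  by rewrite big_ord0 /= diracE mem_set// => -[].
rewrite big_ord_recl /= /lebesgue_rV_step /pushforward.
set B := [set y : 'rV[R]_n | forall i, A (lift ord0 i) (y 0 i)].
have -> : @rV_cons R n @^-1` [set x | forall i, A i (x 0 i)] = A ord0 `*` B.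
  have l0 : lshift n (0 : 'I_1) = ord0 by exact/val_inj.
  have lS i : rshift 1 i = lift ord0 i :> 'I_(1 + n) by exact/val_inj.
  apply/seteqP; split => -[x y]; rewrite /rV_cons /B /=.
    move=> h; split => [|i].
      by have := h (lshift n (0 : 'I_1)); rewrite row_mxEl mxE eqxx mulr1n l0.
    by have := h (rshift 1 i); rewrite row_mxEr lS.
  move=> [Ax By] i; case: (split_ordP (i : 'I_(1 + n))) => j ->.
    by rewrite ord1 row_mxEl mxE eqxx mulr1n l0.
  by rewrite row_mxEr lS.
have mB : measurable B.
  rewrite (_ : B = \bigcap_(i in [set: 'I_n])
      ((fun x : 'rV[R]_n => x 0 i : measurableTypeR R) @^-1` A (lift ord0 i))).
    apply: fin_bigcap_measurable => // i _.
    by rewrite -[X in measurable X]setTI; exact: measurable_coord.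
  by apply/seteqP; split => y h i; [move=> _; exact: h|exact: h].
by rewrite product_measure1E//; congr (_ * _)%E; exact: IH.
Qed.

Section function_spaces.
Context {R : realType} {n : nat}.
Local Notation E := 'rV[R]_n.
Implicit Types (u v f phi : E -> R) (D U : set E) (k : nat) (w : seq 'I_n).

(* The norm `|x| of the library on 'rV[R]_n is the sup norm. *)
Definition enorm (x : E) : R := Num.sqrt (\sum_(i < n) x 0 i ^+ 2).

(* Multi-indices are written as words: [:: i1; ...; ik] stands for
   d_{i1} ... d_{ik}; words that are permutations of each other stand for the
   same multi-index. *)
Definition partial w f : E -> R :=
  foldr (fun i g => 'D_('e_i : E) g) f w.

Definition is_Ck k U f : Prop := forall w, (size w <= k)%N ->
  (forall x, U x -> {for x, continuous (partial w f)}) /\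
  ((size w < k)%N -> forall (i : 'I_n) x, U x ->
    derivable (partial w f) x ('e_i : E)).

Definition laplacian f (x : E) : R := \sum_(i < n) partial [:: i; i] f x.

Definition harmonic_on U f : Prop :=
  is_Ck 2 U f /\ forall x, U x -> laplacian f x = 0.

(* C^{0,beta}(D), used for compact D only, where boundedness is automatic. *)
Definition holder_space (beta : R) D f : Prop :=
  if beta == 0 then {within D, continuous f}
  else exists C : R, forall x y, D x -> D y ->
    `|f x - f y| <= C * enorm (x - y) `^ beta.

Definition test_function U phi : Prop :=
  [/\ forall k, is_Ck k setT phi,
      compact (closure [set x | phi x != 0]) &
      closure [set x | phi x != 0] `<=` U].

(* Measurability is Borel; every class in L^2(U) has a Borel representative. *)
Definition square_integrable U f : Prop :=
  measurable_fun U f /\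
  (lebesgue_rV n).-integrable U (fun x => (f x ^+ 2)%:E).

Definition weak_partial w U u v : Prop := forall phi, test_function U phi ->
  \int[lebesgue_rV n]_(x in U) (u x * partial w phi x) =
  (-1) ^+ size w * \int[lebesgue_rV n]_(x in U) (v x * phi x).

Definition gagliardo (theta : R) U v : \bar R :=
  (\int[lebesgue_rV n]_(x in U) \int[lebesgue_rV n]_(y in U)
    ((v x - v y) ^+ 2 / enorm (x - y) `^ (n%:R + 2 * theta))%:E)%E.

(* The Sobolev-Slobodeckij space H^s(U) = W^{s,2}(U), for s >= 0: the weak
   derivatives of order at most floor s are in L^2(U), and those of order floor s
   have a finite Gagliardo seminorm when s is not an integer. *)
Definition sobolev_space (s : R) U u : Prop :=
  let m := Num.truncn s in
  let theta := s - m%:R in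
  square_integrable U u /\
  forall w, (size w <= m)%N -> exists v,
    [/\ square_integrable U v, weak_partial w U u v &
        size w = m -> 0 < theta -> (gagliardo theta U v < +oo)%E].

End function_spaces.

Section example.
Context {R : realType}.

(* f is only looked at on [0, +oo[; g k is its k-th derivative there,
   one-sided at 0. *)
Definition smooth_on_ray (f : R -> R) : Prop :=
  exists g : nat -> R -> R,
    (forall x, 0 <= x -> g 0%N x = f x) /\
    forall k x, 0 <= x ->
      h^-1 * (g k (x + h) - g k x)
        @[h --> within [set h | 0 <= x + h] 0^'] --> g k.+1 x.

(* A point of R^(2 + m) is (x1, x2, x'') with (x1, x2) = lsubmx x
   and x'' = rsubmx x. *)
Definition omega {m : nat} (mu : R -> R) : set 'rV[R]_(2 + m) :=
  [set x | lsubmx x 0 0 ^+ 2 + lsubmx x 0 1 ^+ 2 < mu (enorm (rsubmx x) ^+ 2)].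

(* k = 2 ^ j with j >= 1 forces j = logn 2 k. *)
Definition lacunary_coef (alpha : R) (k : nat) : R :=
  let j := logn 2 k in
  if (0 < j)%N && (k == 2 ^ j)%N then
    if alpha == 0 then j%:R ^- 2 else 2 `^ (- (j%:R * alpha))
  else 0.

Definition lacunary_term {m : nat} (alpha : R) (x : 'rV[R]_(2 + m))
    (k : nat) : R :=
  lacunary_coef alpha k *
  complex.Re (Complex (lsubmx x 0 0) (lsubmx x 0 1) ^+ k).

Definition lacunary_sum {m : nat} (alpha : R) (x : 'rV[R]_(2 + m)) : R :=
  limn (series (lacunary_term alpha x)).

End example.

(* Main.v *)
Require Import Defs.
From mathcomp Require Import all_boot all_order all_algebra.
From mathcomp Require Import complex ring lra zify.
From mathcomp Require Import all_classical all_reals all_analysis measurable_realfun.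
Set Implicit Arguments.
Unset Strict Implicit.
Unset Printing Implicit Defensive.
Import Order.TTheory GRing.Theory Num.Theory.
Import numFieldNormedType.Exports.
Import Normc.
Local Open Scope classical_set_scope.
Local Open Scope ring_scope.

(** Put z = x_1 + i x_2. Then u is the real part of a one-variable power series in z and is constant
    in x''. Since mu <= 1, Omega lies in the cylinder |z| < 1. Since mu = 1 on [0, rho], Omega
    contains a polydisc |z| < 1, |x''_i| < delta. All statements therefore reduce to the behaviour
    of the series near the circle |z| = 1.

    Harmonicity: inside the disc the series has a second-order expansion ([psr_quadratic]), so a
    derivative along v multiplies the terms by [cz v] and derives the coefficients
    ([plane_series_derive]). The first two directions give the factors 1 and i^2 = -1, the others 0
    ([plane_series_harmonic]).

    Hoelder regularity: |Re (w^k - z^k)| <= min(2, k |w - z|). For alpha > 0 the sum over k = 2^j is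
    split at 2^j ~ 1/|w - z| ([lacunary_holder]); for alpha = 0 summability of the coefficients
    gives a modulus of continuity ([lacunary_modulus]). The exponent is sharp because on the
    positive x_1-axis all terms increase: between 1 - 2^-j and 1 - 2^-j/4 the single term of index
    2^j already grows by a_(2^j)/4 ([lacunary_sum_not_holder]).

    Sobolev regularity: if u were in H^s, a weak derivative of order q in x_1 would agree almost
    everywhere on the polydisc with the series differentiated q times ([negligible_weak_partial]).
    This is tested on products of smooth bumps that tend to indicators of boxes. The energy of that
    series is then bounded below on the annuli 1 - 2^-j < |z|^2 < 1 - 2^-j/2. Summing over the
    rotations by the powers of a root of unity of order 2^(j+2), a discrete Fourier coefficient
    isolates the frequency 2^j - q ([fourier_psr]), and Cauchy-Schwarz bounds the sum of squares
    from below. Rotations preserve Lebesgue measure and the annulus, whose volume is at least a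
    constant times 2^-j, so its L^2 energy is at least of order (2^(jq) a_(2^j))^2 2^-j
    ([sqr_annulus]). For the Gagliardo seminorm the same is done with differences of neighbouring
    rotates, which [slob_two_points] turns into double integrals; this adds a factor 2^(2 j theta)
    ([slob_annulus]).

    When s = q + theta is at least alpha + 1/2 (more than 1/2 if alpha = 0), these energies stay
    above a positive constant ([energy_ge]). The annuli are disjoint, so the total is infinite
    ([integral_annuli_pinfty]), a contradiction. For s >= 2 the pair q = 2, theta = 0 suffices. *)

(** * Real parts of power series: convergence and termwise estimates *)

Section power_series.
Context {R : realType}.
Implicit Types (c : nat -> R) (g z h : R[i]) (r : R) (k : nat).

Lemma lerX2 (x y : R) k : 0 <= x -> x <= y -> x ^+ k <= y ^+ k.
Proof. by move=> x0 xy; apply: lerXn2r => //; rewrite nnegrE// (le_trans x0). Qed.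

(** Radius of convergence at least 1, in the form of Abel's lemma: bounded terms at every r < 1 give
    geometric domination at every smaller radius. *)
Definition radius_ge1 c := forall r, 0 <= r < 1 ->
  exists M, forall k, `|c k| * r ^+ k <= M.

(** 1 - r^(k+1) is 1 - r times a sum of k+1 powers of r, each at least r^k; so (1 - r)^-1 is a
    bound. *)
Lemma natrX_bounded r : 0 <= r < 1 -> exists M, forall k, k.+1%:R * r ^+ k <= M.
Proof.
move=> /andP[r0 r1]; have d0 : 0 < 1 - r by rewrite subr_gt0.
exists (1 - r)^-1 => k.
rewrite -[_^-1]mul1r ler_pdivlMr//.
suff : k.+1%:R * r ^+ k * (1 - r) <= 1 - r ^+ k.+1.
  by move/le_trans; apply; rewrite gerBl exprn_ge0.
elim: k => [|k IH]; first by rewrite expr1 expr0; lra.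
have rk : r ^+ k.+1 <= 1 by apply: exprn_ile1 => //; exact: ltW.
have := ler_wpM2r r0 IH.
rewrite -(@natr1 _ k.+1) [r ^+ k.+2]exprS; set t := r ^+ k.+1 in rk *.
have -> : k.+1%:R * r ^+ k * (1 - r) * r = k.+1%:R * t * (1 - r).
  by rewrite /t exprS; ring.
nra.
Qed.

Lemma radius_ge1_natr c : radius_ge1 c -> radius_ge1 (fun k => k.+1%:R * c k).
Proof.
move=> rc r /andP[r0 r1].
have [q /andP[rq q1]] : exists q, r < q < 1 by exists ((r + 1) / 2); lra.
have q0 : 0 < q by lra.
have [M1 h1] : exists M, forall k, k.+1%:R * (r / q) ^+ k <= M.
  by apply: natrX_bounded; rewrite divr_ge0//= ?ltr_pdivrMr ?mul1r// ltW.
have [M2 h2] : exists M, forall k, `|c k| * q ^+ k <= M by apply: rc; lra.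
exists (M1 * M2) => k.
rewrite normrM ger0_norm// -[r](divfK (lt0r_neq0 q0)) exprMn.
rewrite mulrACA; apply: ler_pM => //.
- by rewrite mulr_ge0// exprn_ge0// divr_ge0// ltW.
- by rewrite mulr_ge0// exprn_ge0// ltW.
Qed.

(** Coefficients of the derivative of sum_k c_k z^k. *)
Definition shiftc c : nat -> R := fun k => k.+1%:R * c k.+1.

Lemma radius_ge1_shift c : radius_ge1 c -> radius_ge1 (shiftc c).
Proof.
move=> /radius_ge1_natr rc r /andP[r0 r1].
have [q /andP[rq q1]] : exists q, r < q < 1 by exists ((r + 1) / 2); lra.
have q0 : 0 < q by lra.
have [M h] : exists M, forall k, `|k.+1%:R * c k| * q ^+ k <= M by apply: rc; lra.
exists (M / q) => k; rewrite ler_pdivlMr//; apply: le_trans (h k.+1).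
rewrite exprSr mulrA; apply: ler_wpM2r; first exact: ltW.
apply: ler_pM => //; first by rewrite exprn_ge0.
  by rewrite /shiftc !normrM ler_wpM2r// !ger0_norm// ler_nat.
by apply: lerX2 => //; exact: ltW.
Qed.

Lemma radius_ge1_summable c r : radius_ge1 c -> 0 <= r < 1 ->
  cvgn (series (fun k => `|c k| * r ^+ k)).
Proof.
move=> rc /andP[r0 r1].
have [q /andP[rq q1]] : exists q, r < q < 1 by exists ((r + 1) / 2); lra.
have q0 : 0 < q by lra.
have [M h] : exists M, forall k, `|c k| * q ^+ k <= M by apply: rc; lra.
apply: (@series_le_cvg _ _ (geometric M (r / q))).
- by move=> k; rewrite mulr_ge0// exprn_ge0.
- move=> k; rewrite mulr_ge0 ?exprn_ge0 ?divr_ge0//; last by rewrite ltW.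
  by apply: le_trans (h 0); rewrite expr0 mulr1.
- move=> k /=; rewrite -{1}[r](divfK (lt0r_neq0 q0)) exprMn.
  rewrite [_ ^+ k * q ^+ k]mulrC mulrA ler_wpM2r// exprn_ge0// divr_ge0// ltW//.
- apply: is_cvg_geometric_series; rewrite ger0_norm ?divr_ge0//; last exact: ltW.
  by rewrite ltr_pdivrMr// mul1r.
Qed.

Lemma normc_ge0 z : 0 <= normc z.
Proof. by case: z => a b; exact: sqrtr_ge0. Qed.

Lemma normcX z k : normc (z ^+ k) = normc z ^+ k.
Proof. by elim: k => [|k IH]; rewrite ?normc1// !exprS normcM IH. Qed.

Lemma ler_normc_Re z : `|complex.Re z| <= normc z.
Proof.
by case: z => a b /=; rewrite -sqrtr_sqr ler_wsqrtr// lerDl sqr_ge0.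
Qed.

(** The factor g records the directions of differentiation: deriving along h replaces g by g h, so
    the family is closed under derivatives. *)
Definition term g c z k : R := c k * complex.Re (g * z ^+ k).

Definition psr g c z : R := limn (series (term g c z)).

Lemma term_le g c z k r : normc z <= r -> `|term g c z k| <= normc g * (`|c k| * r ^+ k).
Proof.
move=> zr; rewrite /term normrM mulrCA ler_wpM2l//.
apply: le_trans (ler_normc_Re _) _; rewrite normcM normcX ler_wpM2l ?normc_ge0//.
exact: lerX2 (normc_ge0 z) zr.
Qed.

Lemma dominated_series (u v : R^nat) : (forall k, `|u k| <= v k) -> cvgn (series v) ->
  cvgn (series u) /\ `|limn (series u)| <= limn (series v).
Proof.
move=> uv cv.
have cn : cvgn [normed series u].
  apply: (@series_le_cvg _ _ v) => // k /=; first exact: normr_ge0.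
  exact: le_trans (normr_ge0 _) (uv k).
split; first exact: normed_cvg.
by apply: le_trans (lim_series_norm cn) _; exact: lim_series_le.
Qed.

Lemma psr_cvg g c z r : cvgn (series (fun k => `|c k| * r ^+ k)) -> normc z <= r ->
  cvgn (series (term g c z)).
Proof.
move=> cs zr; apply: (proj1 (@dominated_series _ (normc g *: (fun k => `|c k| * r ^+ k)) _ _)).
- by move=> k; exact: term_le.
- exact: is_cvg_seriesZ.
Qed.

(** The remainders satisfy E_(k+1) = (z + h) E_k + (k+1) h^2 z^k, which gives the bound by
    induction. The factor r on the left replaces the exponent k - 1 on the right. *)
Lemma expc_quadratic z h r k : 0 <= r -> normc z <= r -> normc (z + h) <= r ->
  normc ((z + h) ^+ k.+1 - z ^+ k.+1 - k.+1%:R * h * z ^+ k) * r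
   <= k.+1%:R * k%:R * normc h ^+ 2 * r ^+ k.
Proof.
move=> r0 zr zhr.
elim: k => [|k IH].
  have -> : (z + h) ^+ 1 - z ^+ 1 - 1%:R * h * z ^+ 0 = 0 by ring.
  by rewrite normc0 mul0r mulr0 !mul0r.
set E := (X in normc X) in IH.
have -> : (z + h) ^+ k.+2 - z ^+ k.+2 - k.+2%:R * h * z ^+ k.+1 =
    (z + h) * E + k.+1%:R * h ^+ 2 * z ^+ k.
  by rewrite /E !exprS -(@natr1 _ k.+1); ring.
have h0 := normc_ge0 h.
apply: le_trans (_ : (r * normc E + k.+1%:R * normc h ^+ 2 * r ^+ k) * r <= _).
  apply: ler_wpM2r => //; apply: le_trans (le_normcD _ _) _; apply: lerD.
    by rewrite normcM ler_wpM2r ?normc_ge0.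
  rewrite !normcM !normcX.
  have -> : normc (k.+1%:R : R[i]) = k.+1%:R by rewrite normcMn normc1.
  apply: ler_wpM2l; first by rewrite mulr_ge0// sqr_ge0.
  exact: lerX2 (normc_ge0 z) zr.
move: IH; rewrite -(@natr1 _ k.+1) -(natr1 k) (exprS r k).
set K := k%:R; set H := normc h ^+ 2; set T := r ^+ k; set N := normc E => IH.
have H0 : 0 <= H by exact: sqr_ge0.
have T0 : 0 <= T by exact: exprn_ge0.
have K0 : 0 <= K + 1 by rewrite /K natr1.
have := ler_wpM2l r0 IH.
have := mulr_ge0 (mulr_ge0 K0 (mulr_ge0 H0 T0)) r0.
lra.
Qed.

End power_series.

(** * Expansion to second order and bounds inside the disc *)

Section psr_theory.
Context {R : realType}.
Implicit Types (c : nat -> R) (g z h : R[i]) (r : R) (k : nat).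

(** Sum [expc_quadratic] over k: the constants are dominated by (k+1)^2 |c_k| r^k, which is summable
    for r < 1. *)
Lemma psr_quadratic c g r : radius_ge1 c -> 0 < r < 1 ->
  exists2 M, 0 <= M & forall z h, normc z <= r -> normc (z + h) <= r ->
    `|psr g c (z + h) - psr g c z - psr (g * h) (shiftc c) z| <= M * normc h ^+ 2.
Proof.
move=> rc /andP[r0 r1].
have r01 : 0 <= r < 1 by rewrite ltW.
have rc2 := radius_ge1_natr (radius_ge1_natr rc).
have sW := radius_ge1_summable rc2 r01.
set W := (fun k => `|k.+1%:R * (k.+1%:R * c k)| * r ^+ k) in sW.
have W0 k : 0 <= W k by rewrite mulr_ge0// exprn_ge0// ltW.
exists (normc g / r ^+ 2 * limn (series W)).
  rewrite mulr_ge0 ?divr_ge0 ?normc_ge0 ?exprn_ge0//; first exact: ltW.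
  apply: limr_ge => //; apply: nearW => n; exact: sumr_ge0.
move=> z h zr zhr.
(* The derived series shifted by one index, so that it can be subtracted term by term; its term of
   index 0 vanishes. *)
pose v k : R := k%:R * c k * complex.Re (g * h * z ^+ k.-1).
have vS : series v \o S = series (term (g * h) (shiftc c) z).
  apply/funext => n /=; rewrite /series/= big_nat_recl//= {1}/v !mul0r add0r.
  by apply: eq_bigr => i _.
have cS : cvgn (series (term (g * h) (shiftc c) z)).
  by apply: psr_cvg zr; apply: radius_ge1_summable r01; exact: radius_ge1_shift.
have cv : series v @ \oo --> psr (g * h) (shiftc c) z.
  by rewrite -cvg_shiftS -[X in X @ _ --> _]/(series v \o S) vS.
have c1 := @psr_cvg _ g _ _ _ (radius_ge1_summable rc r01) zhr.
have c2 := @psr_cvg _ g _ _ _ (radius_ge1_summable rc r01) zr.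
pose K := normc g / r ^+ 2 * normc h ^+ 2.
pose U := term g c (z + h) - term g c z - v.
have cU : series U @ \oo --> psr g c (z + h) - psr g c z - psr (g * h) (shiftc c) z.
  have -> : series U = series (term g c (z + h)) - series (term g c z) - series v.
    by apply/funext => n; rewrite /series /U /= !sumrB.
  exact: (cvgB (cvgB c1 c2) cv).
have UW k : `|U k| <= (K *: W) k.
  have -> : U k = c k * complex.Re (g * ((z + h) ^+ k - z ^+ k - k%:R * h * z ^+ k.-1)).
    have -> : U k = term g c (z + h) k - term g c z k - v k by [].
    have -> : v k = c k * (k%:R * complex.Re (g * h * z ^+ k.-1)) by rewrite /v; ring.
    rewrite /term -!mulrBr; congr (_ * _).
    rewrite !mulrBr !raddfB /=; congr (_ - _).
    have -> : g * (k%:R * h * z ^+ k.-1) = (g * h * z ^+ k.-1) *+ k.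
      by rewrite -mulr_natr; ring.
    by rewrite raddfMn /= mulr_natl.
  rewrite normrM.
  have -> : (K *: W) k = K * W k by [].
  apply: le_trans (_ : `|c k| * (normc g *
    normc ((z + h) ^+ k - z ^+ k - k%:R * h * z ^+ k.-1)) <= _).
    by rewrite ler_wpM2l//; apply: le_trans (ler_normc_Re _) _; rewrite normcM.
  case: k => [|k].
    by rewrite !expr0 subrr !mul0r subr0 normc0 !mulr0 mulr_ge0// /K
      mulr_ge0 ?divr_ge0 ?normc_ge0 ?exprn_ge0 ?normc_ge0// ltW.
  set E := normc (_ - _ - _).
  have hE : E * r ^+ 2 <= k.+2%:R ^+ 2 * normc h ^+ 2 * r ^+ k.+1.
    have h1 := ler_wpM2r (ltW r0) (expc_quadratic k (ltW r0) zr zhr).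
    rewrite expr2 [X in X <= _]mulrA; apply: le_trans h1 _.
    rewrite [r ^+ k.+1]exprSr [X in _ <= X]mulrA; apply: ler_wpM2r; first exact: ltW.
    apply: ler_wpM2r; first by rewrite exprn_ge0// ltW.
    apply: ler_wpM2r; first exact: sqr_ge0.
    by rewrite expr2; apply: ler_pM => //; rewrite ler_nat// leqW// leqW.
  have -> : K * W k.+1
    = `|c k.+1| * (normc g * ((k.+2%:R ^+ 2 * normc h ^+ 2 * r ^+ k.+1) / r ^+ 2)).
    by rewrite /K /W !normrM !normr_nat; ring.
  rewrite ler_wpM2l// ler_wpM2l ?normc_ge0//.
  by rewrite ler_pdivlMr ?exprn_gt0.
have [cU' leU] := dominated_series UW (is_cvg_seriesZ (k := K) sW).
have := leU; rewrite (cvg_lim _ cU)// lim_seriesZ// => /le_trans; apply.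
rewrite [leLHS]/(K * limn (series W)) /K.
by rewrite [leLHS]mulrAC.
Qed.

Lemma psr_bound c r : radius_ge1 c -> 0 <= r < 1 ->
  exists2 M, 0 <= M & forall g z, normc z <= r -> `|psr g c z| <= normc g * M.
Proof.
move=> rc r01; have sW := radius_ge1_summable rc r01.
exists (limn (series (fun k => `|c k| * r ^+ k))).
  apply: limr_ge => //; apply: nearW => n; apply: sumr_ge0 => i _.
  by rewrite mulr_ge0// exprn_ge0//; case/andP: r01.
move=> g z zr.
have [_] := dominated_series (fun k => @term_le _ g c z k r zr) (is_cvg_seriesZ (k := normc g) sW).
by rewrite lim_seriesZ.
Qed.

Lemma psr_lipschitz c g r : radius_ge1 c -> 0 < r < 1 ->
  exists2 M, 0 <= M & forall z w, normc z <= r -> normc w <= r ->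
    `|psr g c w - psr g c z| <= M * normc (w - z).
Proof.
move=> rc r01; have [M M0 hM] := psr_quadratic g rc r01.
have r01' : 0 <= r < 1 by case/andP: r01 => /ltW -> ->.
have [N N0 hN] := psr_bound (radius_ge1_shift rc) r01'.
exists (M * 2 + normc g * N); first by rewrite addr_ge0// mulr_ge0// normc_ge0.
move=> z w zr wr; have := hM z (w - z) zr; rewrite subrKC => /(_ wr) h1.
have h2 := hN (g * (w - z)) z zr; rewrite normcM in h2.
have d2 : normc (w - z) <= 2.
  by apply: le_trans (le_normcD _ _) _; rewrite normcN; lra.
have d0 := normc_ge0 (w - z).
rewrite mulrDl -(subrK (psr (g * (w - z)) (shiftc c) z) (_ - _)).
apply: le_trans (ler_normD _ _) _; apply: lerD.
  apply: le_trans h1 _; rewrite -mulrA ler_wpM2l// expr2.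
  by rewrite ler_wpM2r.
by rewrite mulrAC.
Qed.

Lemma psrZ c g z r (t : R) : radius_ge1 c -> 0 <= r < 1 -> normc z <= r ->
  psr (t%:C%C * g) c z = t * psr g c z.
Proof.
move=> rc r01 zr; rewrite /psr.
have -> : term (t%:C%C * g) c z = t *: term g c z.
  apply/funext => k; rewrite [RHS]/(t * (c k * _)) [RHS]mulrCA; congr (_ * _).
  by case: g => a b; case: (z ^+ k) => p q; rewrite /= !mul0r !subr0 addr0; ring.
rewrite lim_seriesZ//; exact: psr_cvg (radius_ge1_summable rc r01) zr.
Qed.

Lemma normc_le1 z : normc z <= `|complex.Re z| + `|complex.Im z|.
Proof.
case: z => a b /=.
rewrite -[leRHS]ger0_norm ?addr_ge0// -sqrtr_sqr ler_wsqrtr//.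
by rewrite sqrrD !real_normK ?num_real// lerD2r lerDl mulrn_wge0.
Qed.

End psr_theory.

(** * Directional derivatives and harmonicity on the cylinder |z| < 1 *)

Section planar_series.
Context {R : realType}.

Lemma is_derive_quadratic (V : normedModType R) (f : V -> R) (x v : V) (L M : R) :
  (\forall t \near (0 : R), `|f (t *: v + x) - f x - t * L| <= M * t ^+ 2) ->
  is_derive x v f L.
Proof.
move=> H.
have cL : h^-1 *: ((f \o shift x) (h *: v) - f x) @[h --> 0^'] --> L.
  apply/cvgrPdist_le => e e0.
  have M0 : 0 < `|M| + 1 by rewrite ltr_wpDl.
  near=> t.
  have t0 : t != 0 by near: t; exact: nbhs_dnbhs_neq.
  have tL : `|t| <= e / (`|M| + 1).
    near: t; apply: dnbhs0_le; exact: divr_gt0.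
  have hM : `|f (t *: v + x) - f x - t * L| <= M * t ^+ 2.
    by near: t; exact: cvg_within H.
  rewrite /= /shift /= distrC.
  have -> : t^-1 *: (f (t *: v + x) - f x) - L = t^-1 * (f (t *: v + x) - f x - t * L).
    by rewrite [_ *: _]/(_ * _) mulrBr mulKf.
  rewrite normrM normfV ler_pdivrMl ?normr_gt0//; apply: le_trans hM _.
  apply: le_trans (_ : (`|M| + 1) * (`|t| * `|t|) <= _).
    rewrite -normrM -expr2 ger0_norm ?sqr_ge0// ler_wpM2r ?sqr_ge0//.
    by rewrite ler_wpDr// ler_norm.
  by rewrite mulrCA ler_wpM2l// -ler_pdivlMl// mulrC.
apply: DeriveDef; first by apply/cvg_ex; exists L.
exact: cvg_lim cL.
Unshelve. all: by end_near. Qed.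

Lemma continuous_lipschitz_at (V : normedModType R) (f : V -> R) (x : V) (M : R) :
  (\forall y \near x, `|f y - f x| <= M * `|y - x|) -> {for x, continuous f}.
Proof.
move=> H; apply/cvgrPdist_le => e e0; near=> y.
have M0 : 0 < `|M| + 1 by rewrite ltr_wpDl.
have hM : `|f y - f x| <= M * `|y - x| by near: y.
rewrite distrC; apply: le_trans hM _.
apply: le_trans (_ : (`|M| + 1) * `|y - x| <= _).
  by rewrite ler_wpM2r// ler_wpDr// ler_norm.
rewrite mulrC -ler_pdivlMr// distrC.
by near: y; apply: cvgr_dist_le => //; exact: divr_gt0.
Unshelve. all: by end_near. Qed.

Variable m : nat.
Implicit Types (x v : 'rV[R]_(2 + m)) (c : nat -> R) (g : R[i]).

Definition cz x : R[i] := Complex (lsubmx x 0 0) (lsubmx x 0 1).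

Lemma czD x v : cz (x + v) = cz x + cz v.
Proof. by rewrite /cz !mxE. Qed.

Lemma czZ t v : cz (t *: v) = t%:C%C * cz v.
Proof. by rewrite /cz /= !mxE /GRing.mul /= !mul0r subr0 addr0. Qed.

Lemma czN x : cz (- x) = - cz x.
Proof. by rewrite /cz !mxE. Qed.

Lemma coord_le_norm n (x : 'rV[R]_n) i : `|x 0 i| <= `|x|.
Proof.
by rewrite -[`|x|]/(mx_norm x) mx_normrE; apply: (le_bigmax _ (fun ij => `|x ij.1 ij.2|) (0, i)).
Qed.

Lemma normc_cz_le x : normc (cz x) <= 2 * `|x|.
Proof.
apply: le_trans (normc_le1 _) _; rewrite /= !mxE mulrDl !mul1r.
by apply: lerD; exact: coord_le_norm.
Qed.

Definition cyl : set 'rV[R]_(2 + m) := [set x | normc (cz x) < 1].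

Lemma normc_cz_continuous : continuous (fun x => normc (cz x)).
Proof.
move=> x; apply: (@continuous_lipschitz_at _ _ _ 2); near=> y.
apply: le_trans (_ : normc (cz (y - x)) <= _); last exact: normc_cz_le.
rewrite czD czN ler_norml; apply/andP; split.
  rewrite lerNl opprB lerBlDr.
  have -> : normc (cz y - cz x) = normc (cz x - cz y) by rewrite -normcN opprB.
  by apply: le_trans (le_normcD _ _); rewrite subrK.
by rewrite lerBlDr; apply: le_trans (le_normcD _ _); rewrite subrK.
Unshelve. all: by end_near. Qed.

Lemma open_cyl : open cyl.
Proof.
rewrite (_ : cyl = (fun x => normc (cz x)) @^-1` [set t | t < 1]) //.
by apply: open_comp => //; move=> x _; exact: normc_cz_continuous.
Qed.

Definition plane_series g c x : R := psr g c (cz x).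

Lemma cyl_near x : cyl x -> exists2 r, 0 < r < 1 &
  normc (cz x) <= r /\ \forall y \near x, normc (cz y) <= r.
Proof.
move=> cx; have n0 := normc_ge0 (cz x); have n1 : normc (cz x) < 1 := cx.
exists ((normc (cz x) + 1) / 2); first by lra.
split; first by lra.
near=> y; apply/ltW; near: y.
by apply: (cvgr_lt _ (@normc_cz_continuous x)); lra.
Unshelve. all: by end_near. Qed.

(** Moving x by t v moves z by t [cz v], so [psr_quadratic] gives a remainder of order t^2. *)
Lemma plane_series_derive g c x v : radius_ge1 c -> cyl x ->
  is_derive x v (plane_series g c) (plane_series (g * cz v) (shiftc c) x).
Proof.
move=> rc /cyl_near[r r01 [xr nr]].
have [M M0 hM] := psr_quadratic g rc r01.
have r01' : 0 <= r < 1 by case/andP: r01 => /ltW -> ->.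
apply: (@is_derive_quadratic _ _ _ _ _ (M * normc (cz v) ^+ 2)).
near=> t.
have tr : normc (cz (t *: v + x)) <= r.
  near: t.
  have H : t *: v + x @[t --> (0 : R)] --> x.
    rewrite -[X in _ --> X]add0r -(scale0r v).
    by apply: cvgD; [by apply: cvgZr_tmp; exact: cvg_id|exact: cvg_cst].
  exact: (H _ nr).
rewrite czD addrC in tr.
have := hM (cz x) (cz (t *: v)) xr tr.
rewrite /plane_series czD [cz (_ *: _) + _]addrC czZ.
rewrite mulrCA (psrZ _ _ (radius_ge1_shift rc) r01' xr) => /le_trans; apply.
rewrite normcM exprMn.
have -> : normc t%:C%C ^+ 2 = t ^+ 2.
  by rewrite /= expr0n addr0 sqrtr_sqr real_normK ?num_real.
by rewrite mulrCA mulrC.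
Unshelve. all: by end_near. Qed.

Lemma plane_series_continuous g c x : radius_ge1 c -> cyl x ->
  {for x, continuous (plane_series g c)}.
Proof.
move=> rc /cyl_near[r r01 [xr nr]].
have [M M0 hM] := psr_lipschitz g rc r01.
apply: (@continuous_lipschitz_at _ _ _ (M * 2)); near=> y.
apply: le_trans (hM _ _ xr _) _; first by near: y.
rewrite -mulrA ler_wpM2l//; apply: le_trans (normc_cz_le _).
by rewrite czD czN.
Unshelve. all: by end_near. Qed.

Definition dirc (w : seq 'I_(2 + m)) : R[i] := \prod_(i <- w) cz 'e_i.

(** The formula for a shorter word holds on a whole neighbourhood of x, the cylinder being open, and
    can therefore be differentiated again. *)
Lemma partial_plane_series g c (w : seq 'I_(2 + m)) x : radius_ge1 c -> cyl x ->
  partial w (plane_series g c) x =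
  plane_series (g * dirc w) (iter (size w) shiftc c) x.
Proof.
move=> rc; elim: w x => [|i w IH] x cx /=; first by rewrite /dirc big_nil mulr1.
have nx : \forall y \near x, plane_series (g * dirc w) (iter (size w) shiftc c) y =
    partial w (plane_series g c) y.
  near=> y; rewrite IH//; near: y; exact: open_cyl.
have rcw : radius_ge1 (iter (size w) shiftc c).
  by elim: (w) => //= ? l; exact: radius_ge1_shift.
have := near_eq_is_derive nx (plane_series_derive (g * dirc w) 'e_i rcw cx).
by move=> [_ ->]; rewrite /dirc big_cons -mulrA [cz _ * _]mulrC.
Unshelve. all: by end_near. Qed.

Lemma plane_series_Ck k g c : radius_ge1 c -> is_Ck k cyl (plane_series g c).
Proof.
move=> rc w _.
have rcw : radius_ge1 (iter (size w) shiftc c).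
  by elim: (w) => //= ? l; exact: radius_ge1_shift.
have nx x : cyl x -> \forall y \near x,
    plane_series (g * dirc w) (iter (size w) shiftc c) y = partial w (plane_series g c) y.
  by move=> cx; near=> y; rewrite partial_plane_series//; near: y; exact: open_cyl.
split => [x cx|_ i x cx].
  apply: cvg_trans (near_eq_cvg (nx x cx)) _.
  rewrite partial_plane_series//; exact: plane_series_continuous.
have [d _] := plane_series_derive (g * dirc w) 'e_i rcw cx.
exact: near_eq_derivable (nx x cx) d.
Unshelve. all: by end_near. Qed.

(** [cz] kills all basis vectors but the first two, on which it is 1 and i; their squares cancel. *)
Lemma plane_series_harmonic g c : radius_ge1 c -> harmonic_on cyl (plane_series g c).
Proof.
move=> rc; split; first exact: plane_series_Ck.
move=> x cx; rewrite /laplacian.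
under eq_bigr => i _ do rewrite partial_plane_series//.
have [r /andP[r0 r1] [xr _]] := cyl_near cx.
have cz0 (i : 'I_m) : cz 'e_(rshift 2 i) = 0.
  by rewrite /cz !mxE.
have psr0 d : psr 0 d (cz x) = 0.
  rewrite /psr (_ : series _ = fun=> 0) ?lim_cst//.
  by apply/funext => n; rewrite /series/= big1// => k _; rewrite /term mul0r mulr0.
rewrite big_split_ord/= [X in _ + X]big1 ?addr0; last first.
  by move=> i _; rewrite /dirc !big_cons cz0 mul0r mulr0 /plane_series psr0.
rewrite big_ord_recl big_ord1 /=.
have e0 : cz 'e_(lshift m ord0) = 1 by rewrite /cz !mxE.
have e1 : cz 'e_(lshift m (lift ord0 ord0)) = 'i%C by rewrite /cz !mxE.
rewrite /dirc !big_cons !big_nil e0 e1 !mulr1.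
have -> : g * ('i%C * 'i%C) = (-1)%:C%C * g.
  by rewrite -expr2 sqr_i mulrC rmorphN rmorph1.
rewrite /plane_series (@psrZ _ _ _ _ r)//; last 2 first.
- by do 2 apply: radius_ge1_shift.
- by rewrite ltW.
by rewrite mulN1r subrr.
Qed.

End planar_series.

(** * Size of the lacunary coefficients *)

Section lacunary_coefficients.
Context {R : realType}.
Implicit Types (alpha tau : R) (j k n : nat).

Definition lacunary_amp alpha j : R :=
  if alpha == 0 then j%:R ^- 2 else 2 `^ (- (j%:R * alpha)).

Lemma lacunary_coef_pow alpha j : (0 < j)%N ->
  lacunary_coef alpha (2 ^ j) = lacunary_amp alpha j.
Proof. by move=> j0; rewrite /lacunary_coef pfactorK// j0 eqxx. Qed.

Lemma lacunary_coef_eq0 alpha k : (forall j, (0 < j)%N -> k != (2 ^ j)%N) ->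
  lacunary_coef alpha k = 0.
Proof.
move=> h; rewrite /lacunary_coef; case: ifP => // /andP[j0 kj].
by have := h _ j0; rewrite kj.
Qed.

Lemma lacunary_amp_ge0 alpha j : 0 <= lacunary_amp alpha j.
Proof.
by rewrite /lacunary_amp; case: ifP => _; rewrite ?powR_ge0// invr_ge0 exprn_ge0.
Qed.

Lemma lacunary_coef_ge0 alpha k : 0 <= lacunary_coef alpha k.
Proof. by rewrite /lacunary_coef; case: ifP => // _; exact: lacunary_amp_ge0. Qed.

(** A dyadic block from 2^(n+1) to 2^(n+2) - 1 contains one power of 2, its first element. *)
Lemma sum_lacunary (V : zmodType) (f : nat -> V) n :
  (forall k, (forall j, (0 < j)%N -> k != (2 ^ j)%N) -> f k = 0) ->
  \sum_(0 <= k < 2 ^ n.+1) f k = \sum_(1 <= j < n.+1) f (2 ^ j)%N.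
Proof.
move=> f0; elim: n => [|n IH].
  rewrite [RHS]big_geq// expn1 big_nat_recl// big_nat1 !f0 ?addr0//.
    by case=> // j _; rewrite -(expn0 2) eqn_exp2l.
  by move=> j _; rewrite neq_ltn expn_gt0.
rewrite (@big_cat_nat _ _ _ (2 ^ n.+1)%N)//=; last by rewrite leq_exp2l.
rewrite IH [RHS]big_nat_recr//=; congr (_ + _).
rewrite big_ltn ?ltn_exp2l// big_nat big1 ?addr0// => k /andP[k1 k2].
apply: f0 => j _; apply/eqP => kE; move: k1 k2; rewrite kE.
by rewrite !ltn_exp2l// ltnS => /leq_trans h /h; rewrite ltnn.
Qed.

Lemma powR2_natr j : 2 `^ j%:R = 2 ^+ j :> R.
Proof. by rewrite powR_mulrn. Qed.

(** With y = j tau ln 2 / 2, one has 2^(j tau) = exp(y)^2 >= (1 + y)^2 >= y^2. *)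
Lemma natr_sqr_le_powR tau : 0 < tau -> exists2 c, 0 < c &
  forall j, c * j%:R ^+ 2 <= 2 `^ (j%:R * tau).
Proof.
move=> t0; have l2 : 0 < ln 2 :> R by rewrite ln_gt0// ltr1n.
exists ((tau * ln 2 / 2) ^+ 2); first by rewrite exprn_gt0// divr_gt0// mulr_gt0.
move=> j; rewrite /powR pnatr_eq0/=.
set y := tau * ln 2 / 2.
have -> : j%:R * tau * ln 2 = j%:R * y + j%:R * y by rewrite /y; field.
have y0 : 0 <= j%:R * y by rewrite mulr_ge0// divr_ge0// mulr_ge0// ltW.
rewrite expRD -expr2 -exprMn mulrC; apply: lerX2 => //.
by apply: le_trans (expR_ge1Dx _); rewrite lerDr.
Qed.

Lemma powR_unbounded tau (B : R) : 0 < tau -> exists j : nat, B < 2 `^ (j%:R * tau).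
Proof.
move=> /natr_sqr_le_powR[c c0 hc].
exists (Num.bound `|B / c|).+1.
apply: lt_le_trans (hc _).
rewrite mulrC -ltr_pdivrMr//; apply: lt_le_trans (_ : (Num.bound `|B / c|).+1%:R <= _).
  apply: le_lt_trans (ler_norm _) _; apply: lt_trans (archi_boundP (normr_ge0 _)) _.
  by rewrite ltr_nat.
by rewrite -natrX ler_nat expnS expn1 leq_pmulr.
Qed.

(** Puts alpha = 0 and alpha > 0 on the same footing: the decay j^-2 costs less than any factor
    2^(-j tau). *)
Lemma lacunary_amp_lower alpha tau : 0 <= alpha -> 0 < tau ->
  exists2 c, 0 < c &
    forall j, (0 < j)%N -> c * 2 `^ (- (j%:R * (alpha + tau))) <= lacunary_amp alpha j.
Proof.
move=> a0 t0; rewrite /lacunary_amp; have [->|an] := eqVneq alpha 0.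
  have [c c0 hc] := natr_sqr_le_powR t0; exists c => // j j0.
  rewrite add0r powRN ler_pdivrMr ?powR_gt0// mulrC ler_pdivlMr ?exprn_gt0 ?ltr0n//.
exists 1 => // j j0; rewrite mul1r ler_powR ?ler1n// lerN2 ler_wpM2l// lerDl.
exact: ltW.
Qed.

(** For alpha = 0 by telescoping, 1/(j+1)^2 <= 1/j - 1/(j+1); for alpha > 0 as a geometric sum of
    ratio 2^-alpha. *)
Lemma lacunary_amp_summable alpha : 0 <= alpha ->
  exists S, forall n, \sum_(1 <= j < n.+1) lacunary_amp alpha j <= S.
Proof.
move=> a0; rewrite /lacunary_amp; have [an|an] := eqVneq alpha 0.
  exists 2 => -[|n]; first by rewrite big_geq.
  suff : \sum_(1 <= j < n.+2) (j%:R ^- 2 : R) <= 2 - n.+1%:R^-1.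
    by move/le_trans; apply; rewrite gerBl.
  elim: n => [|n IH]; first by rewrite big_nat1 expr1n invr1; lra.
  rewrite big_nat_recr//=; apply: le_trans (lerD IH (lexx _)) _.
  have n0 : 0 < n.+1%:R :> R by [].
  rewrite -(@natr1 _ n.+1); move: (n.+1%:R) n0 => x n0.
  have x1 : x + 1 != 0 by rewrite lt0r_neq0// ltr_wpDl// ltW.
  rewrite -subr_ge0 (_ : _ - _ = (x * (x + 1) ^+ 2)^-1).
    by rewrite invr_ge0 mulr_ge0 ?exprn_ge0 ?addr_ge0 ?ltW.
  by field; rewrite x1 lt0r_neq0.
pose p : R := 2 `^ (- alpha).
have p0 : 0 <= p by exact: powR_ge0.
have p1 : p < 1.
  rewrite /p /powR pnatr_eq0/= expR_lt1 mulNr oppr_lt0 mulr_gt0 ?ln_gt0 ?ltr1n//.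
  by rewrite lt_def an.
exists (1 - p)^-1 => n.
have d0 : 0 < 1 - p by lra.
rewrite -[leRHS]mul1r ler_pdivlMr//.
suff : (\sum_(1 <= j < n.+1) 2 `^ (- (j%:R * alpha))) * (1 - p) <= 1 - p ^+ n.+1.
  by move/le_trans; apply; rewrite gerBl exprn_ge0.
elim: n => [|n IH]; first by rewrite big_geq// mul0r expr1; lra.
rewrite big_nat_recr//= mulrDl; apply: le_trans (lerD IH (lexx _)) _.
have -> : 2 `^ (- (n.+1%:R * alpha)) = p ^+ n.+1.
  by rewrite /p -powR_mulrn ?powR_ge0// -powRrM mulNr mulrC.
by rewrite [p ^+ n.+2]exprS; lra.
Qed.

End lacunary_coefficients.

(** * Moduli of continuity of the series on the closed disc *)

Section lacunary_series.
Context {R : realType}.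
Implicit Types (alpha : R) (z w : R[i]) (j k n : nat).

Lemma series_nneg_le (f : nat -> R) (k n : nat) : (forall i, 0 <= f i) -> (k <= n)%N ->
  series f k <= series f n.
Proof.
move=> f0 kn; apply/(nondecreasing_seqP (series f)).1 => //.
by apply/nondecreasing_seqP; apply: nondecreasing_series => i _ _; exact: f0.
Qed.

Lemma lacunary_series_le alpha (h : nat -> R) n : (forall k, 0 <= h k) ->
  series (fun k => lacunary_coef alpha k * h k) n <=
  \sum_(1 <= j < n.+1) lacunary_amp alpha j * h (2 ^ j)%N.
Proof.
move=> h0; apply: le_trans (_ : series (fun k => lacunary_coef alpha k * h k) (2 ^ n.+1)%N <= _).
  apply: series_nneg_le; first by move=> i; rewrite mulr_ge0// lacunary_coef_ge0.
  by apply: ltnW; apply: ltnW; exact: ltn_expl.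
rewrite /series/= sum_lacunary; last by move=> k hk; rewrite lacunary_coef_eq0// mul0r.
rewrite le_eqVlt; apply/orP; left; apply/eqP; rewrite !big_nat; apply: eq_bigr => j /andP[j0 _].
by rewrite lacunary_coef_pow.
Qed.

Lemma cvg_lacunary_coef alpha : 0 <= alpha -> cvgn (series (@lacunary_coef R alpha)).
Proof.
move=> a0; have [S hS] := lacunary_amp_summable a0.
apply: nondecreasing_is_cvgn.
  by apply/nondecreasing_seqP; move=> n; apply: series_nneg_le => // i; exact: lacunary_coef_ge0.
exists S => _ [n _ <-]; apply: le_trans (hS n).
have := @lacunary_series_le alpha (fun=> 1) n (fun=> ler01).
by under [X in series X]eq_fun do rewrite mulr1; under eq_bigr do rewrite mulr1.
Qed.

Lemma radius_ge1_lacunary alpha : 0 <= alpha -> radius_ge1 (@lacunary_coef R alpha).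
Proof.
move=> a0 r /andP[r0 r1]; have [S hS] := lacunary_amp_summable a0.
exists S => k; rewrite ger0_norm ?lacunary_coef_ge0//.
apply: le_trans (_ : lacunary_coef alpha k * 1 <= _).
  by rewrite ler_wpM2l ?lacunary_coef_ge0// exprn_ile1// ltW.
rewrite mulr1; apply: le_trans (hS k.+1).
have := @lacunary_series_le alpha (fun=> 1) k.+1 (fun=> ler01).
under [X in series X]eq_fun do rewrite mulr1; under eq_bigr do rewrite mulr1.
apply: le_trans; rewrite seriesSr lerDr.
by apply: sumr_ge0 => i _; exact: lacunary_coef_ge0.
Qed.

Lemma lacunary_cvg alpha g z : 0 <= alpha -> normc z <= 1 ->
  cvgn (series (term g (@lacunary_coef R alpha) z)).
Proof.
move=> a0 z1; apply: psr_cvg z1.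
rewrite (_ : (fun k => _) = lacunary_coef alpha); first exact: cvg_lacunary_coef.
by apply/funext => k; rewrite expr1n mulr1 ger0_norm// lacunary_coef_ge0.
Qed.

Lemma normc_subX z w k : normc z <= 1 -> normc w <= 1 ->
  normc (w ^+ k - z ^+ k) <= k%:R * normc (w - z).
Proof.
move=> z1 w1; elim: k => [|k IH]; first by rewrite !expr0 subrr normc0 mul0r.
have -> : w ^+ k.+1 - z ^+ k.+1 = w * (w ^+ k - z ^+ k) + (w - z) * z ^+ k.
  by rewrite !exprS; ring.
apply: le_trans (le_normcD _ _) _; rewrite !normcM normcX -natr1 mulrDl mul1r.
apply: lerD.
  by rewrite -[leRHS]mul1r ler_pM ?normc_ge0.
by rewrite -[leRHS]mulr1 ler_wpM2l ?normc_ge0// exprn_ile1 ?normc_ge0.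
Qed.

(** |Re (w^k - z^k)| is at most 2 by the triangle inequality and at most k |w - z| by [normc_subX];
    a bound on the partial sums passes to the limit. *)
Lemma lacunary_diff_le alpha z w (B : R) : 0 <= alpha -> normc z <= 1 -> normc w <= 1 ->
  (forall n, series (fun k => lacunary_coef alpha k * Num.min 2 (k%:R * normc (w - z))) n <= B) ->
  `|psr 1 (lacunary_coef alpha) w - psr 1 (lacunary_coef alpha) z| <= B.
Proof.
move=> a0 z1 w1 hB.
have cw := @lacunary_cvg _ 1 _ a0 w1; have cz := @lacunary_cvg _ 1 _ a0 z1.
pose D := term 1 (lacunary_coef alpha) w - term 1 (lacunary_coef alpha) z.
have cD : series D @ \oo --> psr 1 (lacunary_coef alpha) w - psr 1 (lacunary_coef alpha) z.
  have -> : series D = series (term 1 (lacunary_coef alpha) w) - series (term 1 (lacunary_coef alpha) z).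
    by apply/funext => n; rewrite /series /D /= sumrB.
  exact: (cvgB cw cz).
rewrite -(cvg_lim (@norm_hausdorff _ _) (cvg_norm cD)).
apply: limr_le; first exact: (is_cvg_norm (cvgP _ cD)).
apply: nearW => n; apply: le_trans (hB n).
apply: le_trans (ler_norm_sum _ _ _) _; apply: ler_sum => k _.
have -> : D k =
    lacunary_coef alpha k * complex.Re (w ^+ k - z ^+ k).
  rewrite -[D k]/(_ * _ - _ * _) !mul1r -mulrBr; congr (_ * _).
  by rewrite raddfB.
rewrite normrM [`|lacunary_coef _ _|]ger0_norm ?lacunary_coef_ge0//.
rewrite ler_wpM2l ?lacunary_coef_ge0//.
apply: le_trans (ler_normc_Re _) _; rewrite le_min normc_subX// andbT.
apply: le_trans (le_normcD _ _) _; rewrite normcN !normcX.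
by apply: lerD; rewrite exprn_ile1 ?normc_ge0.
Qed.

(** From a rank [n0] on the coefficients sum to at most e/4 and each term is estimated by 2; the
    finitely many terms before it have the common Lipschitz constant [A]. *)
Lemma lacunary_modulus alpha (e : R) : 0 <= alpha -> 0 < e ->
  exists2 d, 0 < d & forall z w, normc z <= 1 -> normc w <= 1 -> normc (w - z) < d ->
  `|psr 1 (lacunary_coef alpha) w - psr 1 (lacunary_coef alpha) z| <= e.
Proof.
move=> a0 e0; have cc := cvg_lacunary_coef a0.
have c0 k := @lacunary_coef_ge0 R alpha k.
have e4 : 0 < e / 4 by rewrite divr_gt0.
have [n0 hn0] : exists n0, limn (series (lacunary_coef alpha)) - e / 4 <=
    series (lacunary_coef alpha) n0.
  have := cc => /cvgrPdist_le /(_ _ e4) [n0 _ /(_ n0 (leqnn n0))] /= h.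
  by exists n0; rewrite lerBlDr addrC -lerBlDr; exact: le_trans (ler_norm _) h.
pose A := \sum_(0 <= k < n0) lacunary_coef alpha k * k%:R.
have A0 : 0 <= A by apply: sumr_ge0 => k _; rewrite mulr_ge0.
exists (e / 2 / (A + 1)); first by rewrite !divr_gt0// ltr_wpDl.
move=> z w z1 w1; set d := normc (w - z) => dd.
have d0 : 0 <= d by exact: normc_ge0.
apply: lacunary_diff_le => // n.
rewrite -/d.
have D0 k : 0 <= lacunary_coef alpha k * Num.min 2 (k%:R * d).
  by rewrite mulr_ge0// le_min ler0n mulr_ge0.
apply: le_trans (series_nneg_le D0 (leq_maxl n n0)) _.
rewrite /series /= (@big_cat_nat _ _ _ n0)//= ?leq_maxr//.
have -> : e = e / 2 + 2 * (e / 4) by lra.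
apply: lerD.
  apply: le_trans (_ : A * d <= _).
    rewrite /A mulr_suml; apply: ler_sum => k _.
    by rewrite -mulrA ler_wpM2l// ge_min lexx orbT.
  apply: le_trans (_ : (A + 1) * d <= _); first by rewrite ler_wpM2r// lerDl.
  by rewrite mulrC -ler_pdivlMr ?ltr_wpDl// ltW.
apply: le_trans (_ : 2 * \sum_(n0 <= k < maxn n n0) lacunary_coef alpha k <= _).
  by rewrite mulr_sumr; apply: ler_sum => k _; rewrite mulrC ler_wpM2r// ge_min lexx.
rewrite ler_wpM2l//.
have h : series (lacunary_coef alpha) (maxn n n0) <= limn (series (lacunary_coef alpha)) :=
  nondecreasing_cvgn_le (nondecreasing_series (fun k _ _ => c0 k)) cc (maxn n n0).
have hs : series (lacunary_coef alpha) (maxn n n0) = series (lacunary_coef alpha) n0 +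
    \sum_(n0 <= k < maxn n n0) lacunary_coef alpha k.
  by rewrite /series /= (@big_cat_nat _ _ _ n0)//= ?leq_maxr.
by rewrite hs in h; lra.
Qed.

Lemma geometric_partial_le (p : R) J n : 0 <= p < 1 ->
  \sum_(J <= j < J + n) p ^+ j <= p ^+ J / (1 - p).
Proof.
move=> /andP[p0 p1]; have d0 : 0 < 1 - p by lra.
rewrite ler_pdivlMr//.
suff -> : (\sum_(J <= j < J + n) p ^+ j) * (1 - p) = p ^+ J - p ^+ (J + n).
  by rewrite gerBl exprn_ge0.
elim: n => [|n IH]; first by rewrite addn0 big_geq// mul0r subrr.
by rewrite addnS big_nat_recr ?leq_addr//= mulrDl IH [p ^+ (_ + n).+1]exprSr; ring.
Qed.

Lemma geometric_partial_ge (q : R) J : 1 < q ->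
  \sum_(0 <= j < J) q ^+ j <= q ^+ J / (q - 1).
Proof.
move=> q1; have d0 : 0 < q - 1 by lra.
rewrite ler_pdivlMr//.
suff -> : (\sum_(0 <= j < J) q ^+ j) * (q - 1) = q ^+ J - 1.
  by rewrite gerBl.
elim: J => [|n IH]; first by rewrite big_geq// mul0r expr0 subrr.
by rewrite big_nat_recr//= mulrDl IH [q ^+ n.+1]exprSr; ring.
Qed.

(* Split at 2^J ~ 1/|w - z|: the terms below J are estimated by their
   derivatives, the ones above by their size. *)
Lemma lacunary_holder alpha : 0 < alpha < 1 -> exists2 C, 0 <= C &
  forall z w, normc z <= 1 -> normc w <= 1 ->
  `|psr 1 (lacunary_coef alpha) w - psr 1 (lacunary_coef alpha) z| <= C * normc (w - z) `^ alpha.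
Proof.
move=> /andP[a0 a1]; have a0' := ltW a0.
pose p : R := 2 `^ (- alpha).
have p0 : 0 < p by exact: powR_gt0.
have p1 : p < 1.
  by rewrite /p /powR pnatr_eq0/= expR_lt1 mulNr oppr_lt0 mulr_gt0 ?ln_gt0 ?ltr1n.
pose q := 2 * p.
have q1 : 1 < q.
  rewrite /q -[X in X * _](powRr1 (ler0n _ 2)) -powRD ?pnatr_eq0 ?implybT//.
  by rewrite /powR pnatr_eq0/= expR_gt1 mulr_gt0 ?ln_gt0 ?ltr1n//; lra.
have ampE j : lacunary_amp alpha j = p ^+ j.
  rewrite /lacunary_amp gt_eqF// /p -powR_mulrn ?powR_ge0// -powRrM mulNr.
  by rewrite mulrC.
pose C := 2 / (q - 1) + 2 / (1 - p).
have C1 : 0 <= 2 / (q - 1) by rewrite divr_ge0; lra.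
have C2 : 0 <= 2 / (1 - p) by rewrite divr_ge0; lra.
exists C; first exact: addr_ge0.
move=> z w z1 w1; set d := normc (w - z).
have d0 : 0 <= d by exact: normc_ge0.
have d2 : d <= 2 by apply: le_trans (le_normcD _ _) _; rewrite normcN; lra.
apply: lacunary_diff_le => // n; rewrite -/d.
apply: le_trans (@lacunary_series_le alpha (fun k => Num.min 2 (k%:R * d)) n _) _.
  by move=> k; rewrite le_min ler0n mulr_ge0.
have [->|dn] := eqVneq d 0.
  rewrite big1 ?mulr_ge0 ?powR_ge0 ?addr_ge0// => j _.
  by rewrite mulr0 min_r// mulr0.
have dp : 0 < d by rewrite lt_def dn.
have [J [J1 J2]] : exists J, 1 < d * 2 ^+ J /\ d * 2 ^+ J <= 2.
  have : exists J, 1 < d * 2 ^+ J.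
    exists (Num.bound d^-1); rewrite mulrC -ltr_pdivrMr// mul1r.
    exact: upper_nthrootP.
  (* Minimality of J gives d 2^J <= 2; for J = 0 this is the bound d <= 2 on the diameter. *)
  move=> exJ; exists (ex_minn exJ); case: ex_minnP => -[|J] h1 hm; split=> //.
    by rewrite expr0 mulr1.
  rewrite exprS mulrCA -[leRHS]mulr1 ler_wpM2l// leNgt; apply/negP => /hm.
  by rewrite ltnn.
apply: le_trans (_ : \sum_(0 <= j < J + n.+1) lacunary_amp alpha j * Num.min 2 ((2 ^ j)%:R * d) <= _).
  have t0 j : 0 <= lacunary_amp alpha j * Num.min 2 ((2 ^ j)%:R * d).
    by rewrite mulr_ge0 ?lacunary_amp_ge0// le_min ler0n mulr_ge0.
  apply: le_trans (_ : \sum_(0 <= j < n.+1) lacunary_amp alpha j * Num.min 2 ((2 ^ j)%:R * d) <= _).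
    by rewrite [leRHS]big_ltn//= lerDr.
  rewrite [leRHS](@big_cat_nat _ _ _ n.+1)//= ?leq_addl// lerDl.
  exact: sumr_ge0.
have pJ : p ^+ J <= d `^ alpha.
  have -> : p ^+ J = (2 ^+ J)^-1 `^ alpha.
    by rewrite -powR_invn// -powRrM /p -powR_mulrn ?powR_ge0// -powRrM !mulNr mulrC.
  apply: ge0_ler_powR; rewrite ?nnegrE ?invr_ge0 ?exprn_ge0//.
  by rewrite -[leLHS]mul1r ler_pdivrMr ?exprn_gt0// ltW.
rewrite (@big_cat_nat _ _ _ J)//= ?leq_addr// /C mulrDl; apply: lerD.
  apply: le_trans (_ : (\sum_(0 <= j < J) q ^+ j) * d <= _).
    rewrite mulr_suml; apply: ler_sum => j _.
    rewrite ampE /q exprMn [2 ^+ _ * _]mulrC -!mulrA.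
    apply: ler_wpM2l; first by rewrite exprn_ge0// ltW.
    by rewrite ge_min natrX lexx orbT.
  apply: le_trans (ler_wpM2r d0 (geometric_partial_ge J q1)) _.
  have -> : q ^+ J / (q - 1) * d = (d * 2 ^+ J) * p ^+ J / (q - 1) by rewrite /q exprMn; ring.
  rewrite [leRHS]mulrAC; apply: ler_wpM2r; first by rewrite invr_ge0; lra.
  by apply: ler_pM => //; rewrite ?mulr_ge0 ?exprn_ge0// ltW.
apply: le_trans (_ : 2 * (\sum_(J <= j < J + n.+1) p ^+ j) <= _).
  rewrite mulr_sumr; apply: ler_sum => j _.
  rewrite ampE mulrC; apply: ler_wpM2r; first by rewrite exprn_ge0// ltW.
  by rewrite ge_min lexx.
have p01 : 0 <= p < 1 by rewrite ltW.
rewrite -mulrA ler_wpM2l// mulrC.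
apply: le_trans (geometric_partial_le J n.+1 p01) _.
by rewrite ler_wpM2r// invr_ge0; lra.
Qed.

End lacunary_series.

(** * Hoelder regularity on the closure of Omega and its sharpness *)

Section lacunary_sum_on_omega.
Context {R : realType} {m : nat}.
Implicit Types (x y v : 'rV[R]_(2 + m)) (alpha : R) (mu : R -> R).

Lemma lacunary_termE alpha x :
  lacunary_term alpha x = term 1 (lacunary_coef alpha) (cz x).
Proof. by apply/funext => k; rewrite /lacunary_term /term mul1r. Qed.

Lemma lacunary_sumE alpha :
  lacunary_sum alpha = plane_series 1 (lacunary_coef alpha) :> ('rV[R]_(2 + m) -> R).
Proof. by apply/funext => x; rewrite /lacunary_sum lacunary_termE. Qed.

Lemma normc_cz_enorm v : normc (cz v) <= enorm v.
Proof.
rewrite /enorm /cz /= big_split_ord /= big_ord_recl big_ord1 /= ler_wsqrtr//.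
rewrite !mxE (_ : lift ord0 ord0 = 1); last exact/val_inj.
by rewrite lerDl sumr_ge0// => i _; exact: sqr_ge0.
Qed.

Lemma omega_cyl mu : (forall t, 0 <= t -> mu t <= 1) -> omega mu `<=` @cyl R m.
Proof.
move=> mu1 x xO; rewrite /cyl /= -[ltRHS]sqrtr1 ltr_sqrt//.
by apply: lt_le_trans xO (mu1 _ _); exact: sqr_ge0.
Qed.

Lemma closure_omega mu : (forall t, 0 <= t -> mu t <= 1) ->
  closure (omega mu) `<=` [set x : 'rV[R]_(2 + m) | normc (cz x) <= 1].
Proof.
move=> mu1; have cD : closed [set x : 'rV[R]_(2 + m) | normc (cz x) <= 1].
  rewrite (_ : mkset _ = (fun x => normc (cz x)) @^-1` [set t | t <= 1])//.
  by apply: closed_comp => // x _; exact: normc_cz_continuous.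
rewrite [X in _ `<=` X]((closure_id _).1 cD); apply: closure_subset => x.
by move=> /(omega_cyl mu1)/ltW.
Qed.

Lemma harmonic_on_subset n (U V : set 'rV[R]_n) f : U `<=` V ->
  harmonic_on V f -> harmonic_on U f.
Proof.
move=> UV [ck lap]; split => [w wk|x /UV]; last exact: lap.
by have [h1 h2] := ck w wk; split => [x /UV|wk' i x /UV]; [exact: h1|exact: h2].
Qed.

Lemma enormN n (x : 'rV[R]_n) : enorm (- x) = enorm x.
Proof. by rewrite /enorm; under eq_bigr do rewrite mxE sqrrN. Qed.

Lemma lacunary_sum_holder alpha mu : (forall t, 0 <= t -> mu t <= 1) -> 0 <= alpha < 1 ->
  holder_space alpha (closure (omega mu)) (lacunary_sum alpha : 'rV[R]_(2 + m) -> R).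
Proof.
move=> mu1 /andP[a0 a1]; have cO := closure_omega mu1; rewrite lacunary_sumE /holder_space.
case: eqVneq => an.
  apply/subspace_continuousP => x cx; apply/cvgrPdist_le => e e0.
  have [d d0 hd] := lacunary_modulus a0 e0.
  (* Half of d, because |[cz v]| is at most twice the sup norm of v. *)
  have dxy : \forall y \near x, `|x - y| < d / 2.
    have := @nbhsx_ballx _ _ x (d / 2); rewrite -ball_normE; apply; exact: divr_gt0.
  rewrite near_withinE; apply: filterS dxy => y xy cy; rewrite distrC.
  apply: hd; [exact: (cO _ cx)|exact: (cO _ cy)|].
  rewrite -czN -czD -normcN -czN opprD opprK addrC.
  apply: le_lt_trans (normc_cz_le _) _; rewrite mulrC -ltr_pdivlMr//.
have ap : 0 < alpha < 1 by rewrite a1 andbT lt_neqAle eq_sym an.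
have [C C0 hC] := lacunary_holder ap; exists C => x y cx cy.
rewrite -[enorm _]enormN opprB distrC.
apply: le_trans (hC _ _ (cO _ cx) (cO _ cy)) _.
rewrite -czN -czD ler_wpM2l//; apply: ge0_ler_powR => //; rewrite ?nnegrE ?normc_ge0//.
  exact: sqrtr_ge0.
exact: normc_cz_enorm.
Qed.

(* Bernoulli: (1 - 1/N)^N <= 1/2 and (1 - 1/(4N))^N >= 3/4. *)
Lemma bernoulli_ge (t : R) N : 0 <= t <= 1 -> 1 - N%:R * t <= (1 - t) ^+ N.
Proof.
move=> /andP[t0 t1]; elim: N => [|N IH]; first by rewrite mul0r subr0.
have s0 : 0 <= 1 - t by lra.
rewrite exprS; apply: le_trans (ler_wpM2l s0 IH); rewrite -natr1.
have := mulr_ge0 (mulr_ge0 (ler0n R N) t0) t0; nra.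
Qed.

Lemma bernoulli_le_half N : (0 < N)%N -> (1 - N%:R^-1 : R) ^+ N <= 2^-1.
Proof.
move=> N0; have Np : 0 < N%:R :> R by rewrite ltr0n.
set t := N%:R^-1; have t0 : 0 < t by rewrite invr_gt0.
have t1 : t <= 1 by rewrite invf_le1// ler1n.
(* Multiplied by (1 - t)^N this gives (1 - t^2)^N <= 1, whence the factor 1/2. *)
have h : 2 <= (1 + t) ^+ N.
  have : forall M, 1 + M%:R * t <= (1 + t) ^+ M.
    elim=> [|M IH]; first by rewrite mul0r addr0.
    have s0 : 0 <= 1 + t by lra.
    rewrite exprS; apply: le_trans (ler_wpM2l s0 IH); rewrite -natr1.
    have := mulr_ge0 (mulr_ge0 (ler0n R M) (ltW t0)) (ltW t0); nra.
  by move=> /(_ N); rewrite mulfV ?lt0r_neq0.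
have p1 : (1 - t) ^+ N * (1 + t) ^+ N <= 1.
  rewrite -exprMn exprn_ile1//; nra.
have q0 : 0 <= (1 - t) ^+ N by rewrite exprn_ge0//; lra.
rewrite -[leRHS]mul1r ler_pdivlMr//; apply: le_trans p1; exact: ler_wpM2l.
Qed.

Definition axis_point (r : R) : 'rV[R]_(2 + m) := r *: 'e_(lshift m 0).

Lemma axis_pointB r s : axis_point r - axis_point s = axis_point (r - s).
Proof. by rewrite /axis_point scalerBl. Qed.

Lemma cz_axis_point r : cz (axis_point r) = r%:C%C.
Proof. by rewrite /cz /axis_point !mxE /= !mulr0 mulr1. Qed.

Lemma enorm_axis_point r : enorm (axis_point r) = `|r|.
Proof.
rewrite /enorm /axis_point big_split_ord /= [X in _ + X]big1 ?addr0; last first.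
  by move=> i _; rewrite !mxE /= mulr0 expr0n.
by rewrite big_ord_recl big_ord1 !mxE /= mulr0 mulr1 expr0n addr0 sqrtr_sqr.
Qed.

Lemma axis_point_omega mu r : mu 0 = 1 -> 0 <= r < 1 -> omega mu (axis_point r).
Proof.
move=> mu0 /andP[r0 r1]; rewrite /omega /axis_point /= !mxE /= mulr0 mulr1 expr0n addr0.
rewrite /enorm big1 ?sqrtr0 ?expr0n ?mu0 ?expr_lt1//.
by move=> i _; rewrite !mxE /= mulr0 expr0n.
Qed.

(** On the positive axis all terms a_k r^k are nondecreasing in r, so the increment of the sum
    dominates that of any one term. *)
Lemma lacunary_axis_increment alpha (r1 r2 : R) j : 0 <= alpha -> 0 <= r1 -> r1 <= r2 -> r2 < 1 ->
  (0 < j)%N -> lacunary_amp alpha j * (r2 ^+ (2 ^ j) - r1 ^+ (2 ^ j)) <=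
  lacunary_sum alpha (axis_point r2) - lacunary_sum alpha (axis_point r1).
Proof.
move=> a0 r10 r12 r21 j0; rewrite lacunary_sumE /plane_series !cz_axis_point.
have nr (r : R) : 0 <= r -> r < 1 -> normc r%:C%C <= 1.
  by move=> h0 h1; rewrite /= expr0n addr0 sqrtr_sqr ger0_norm// ltW.
have c2 := @lacunary_cvg _ _ 1 _ a0 (nr r2 (le_trans r10 r12) r21).
have c1 := @lacunary_cvg _ _ 1 _ a0 (nr r1 r10 (le_lt_trans r12 r21)).
pose D k := lacunary_coef alpha k * (r2 ^+ k - r1 ^+ k).
have cD : series D @ \oo --> psr 1 (lacunary_coef alpha) r2%:C%C - psr 1 (lacunary_coef alpha) r1%:C%C.
  have -> : series D = series (term 1 (lacunary_coef alpha) r2%:C%C) - series (term 1 (lacunary_coef alpha) r1%:C%C).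
    apply/funext => n.
    rewrite -[RHS]/(series _ n - series _ n) /series /= -sumrB; apply: eq_bigr => k _.
    by rewrite /D /term !mul1r -mulrBr -!rmorphXn.
  exact: (cvgB c2 c1).
have D0 k : 0 <= D k by rewrite mulr_ge0 ?lacunary_coef_ge0// subr_ge0 lerX2.
rewrite -lacunary_coef_pow// -/(D (2 ^ j)%N) -(cvg_lim (@Rhausdorff R) cD).
apply: limr_ge; first exact: cvgP cD.
near=> n.
have nj : (2 ^ j < n)%N by near: n; exact: nbhs_infty_gt.
apply: le_trans (series_nneg_le D0 nj); rewrite seriesSr lerDr.
exact: sumr_ge0.
Unshelve. all: by end_near. Qed.

(** At the points 1 - 2^-i and 1 - 2^-i/4 the increment is at least a_(2^i)/4, hence at least a
    constant times 2^(-i(alpha + eps/2)), while a Hoelder bound would make it at most C 2^(-i(alpha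
    + eps)). So 2^(i eps/2) would be bounded in i. *)
Lemma lacunary_sum_not_holder alpha mu eps : mu 0 = 1 -> 0 <= alpha -> 0 < eps ->
  ~ holder_space (alpha + eps) (closure (omega mu)) (lacunary_sum alpha : 'rV[R]_(2 + m) -> R).
Proof.
move=> mu0 a0 e0; rewrite /holder_space gt_eqF ?ltr_wpDl// => -[C hC].
have e2 : 0 < eps / 2 by rewrite divr_gt0.
have [c c0 hc] := lacunary_amp_lower a0 e2.
have [j hj] := powR_unbounded (4 * C / c) e2.
have bnd i : (0 < i)%N -> c * 2 `^ (i%:R * (eps / 2)) <= 4 * C.
  move=> i0; set N := (2 ^ i)%N.
  have Np : 0 < N%:R :> R by rewrite ltr0n expn_gt0.
  have N1 : 1 <= N%:R :> R by rewrite ler1n expn_gt0.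
  have t0 : 0 < N%:R^-1 :> R by rewrite invr_gt0.
  have t1 : N%:R^-1 <= 1 :> R by rewrite invf_le1.
  set r1 : R := 1 - N%:R^-1; set r2 : R := 1 - N%:R^-1 / 4.
  have h1 : r1 ^+ N <= 2^-1 by apply: bernoulli_le_half; rewrite expn_gt0.
  have h2 : 3 / 4 <= r2 ^+ N.
    have t4 : 0 <= (N%:R^-1 / 4 : R) <= 1 by lra.
    apply: le_trans (bernoulli_ge N t4).
    by rewrite mulrA mulfV ?lt0r_neq0//; lra.
  have r10 : 0 <= r1 by rewrite /r1; lra.
  have r12 : r1 <= r2 by rewrite /r1 /r2; lra.
  have r21 : r2 < 1 by rewrite /r2; lra.
  have h10 : 0 <= r1 < 1 by rewrite r10 (le_lt_trans r12).
  have h20 : 0 <= r2 < 1 by rewrite r21 (le_trans r10).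
  have r12' : r2 - r1 != 0 by rewrite subr_eq0 gt_eqF// /r1 /r2; lra.
  have r12N : r2 - r1 <= N%:R^-1 by rewrite /r1 /r2; lra.
  have h12 : 0 <= r2 ^+ N - r1 ^+ N by lra.
  have h124 : 4^-1 <= r2 ^+ N - r1 ^+ N by lra.
  have cl1 : closure (omega mu) (axis_point r1).
    exact: subset_closure (axis_point_omega mu0 h10).
  have cl2 : closure (omega mu) (axis_point r2).
    exact: subset_closure (axis_point_omega mu0 h20).
  have inc := lacunary_axis_increment a0 r10 r12 r21 i0.
  rewrite -/N in inc.
  have := hC _ _ cl2 cl1.
  rewrite axis_pointB enorm_axis_point => hol.
  have {}hol := le_trans inc (le_trans (ler_norm _) hol).
  have A0 : 0 < 2 `^ (- (i%:R * (alpha + eps))) :> R by exact: powR_gt0.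
  have am := hc i i0.
  (* [holder_space] puts no sign on its constant; it follows from the nonnegative increment. *)
  have C0 : 0 <= C.
    have : 0 <= C * `|r2 - r1| `^ (alpha + eps).
      by apply: le_trans hol; rewrite mulr_ge0 ?lacunary_amp_ge0.
    by rewrite pmulr_lge0// powR_gt0// normr_gt0.
  have P : `|r2 - r1| `^ (alpha + eps) <= 2 `^ (- (i%:R * (alpha + eps))).
    rewrite -mulNr powRrM; apply: ge0_ler_powR; rewrite ?nnegrE ?powR_ge0//.
      by rewrite addr_ge0// ltW.
    rewrite powR_invn// -natrX ger0_norm; last by rewrite subr_ge0.
    exact: r12N.
  have Q : 2 `^ (- (i%:R * (alpha + eps / 2))) =
      2 `^ (- (i%:R * (alpha + eps))) * 2 `^ (i%:R * (eps / 2)) :> R.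
    by rewrite -powRD ?pnatr_eq0 ?implybT//; congr (_ `^ _); field.
  have := ler_wpM2l C0 P => {}P.
  rewrite Q in am.
  set A := 2 `^ (- (i%:R * (alpha + eps))) in A0 P am.
  rewrite -(ler_pM2l A0).
  have : lacunary_amp alpha i / 4 <= lacunary_amp alpha i * (r2 ^+ N - r1 ^+ N).
    by rewrite ler_wpM2l ?lacunary_amp_ge0.
  move=> h; clear - h am hol P; lra.
have hj1 : 2 `^ (j%:R * (eps / 2)) <= 2 `^ (j.+1%:R * (eps / 2)) :> R.
  by rewrite ler_powR ?ler1n// ler_wpM2r ?ler_nat// ltW.
have := bnd j.+1 isT; rewrite mulrC -ler_pdivlMr// => /(le_trans hj1)/(lt_le_trans hj).
by rewrite ltxx.
Qed.

End lacunary_sum_on_omega.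

(** * Invariance of Lebesgue integrals under rotations of the first two coordinates *)

Section lebesgue_transformations.
Context {R : realType}.
Local Notation leb := (@lebesgue_measure R).
Local Notation RR := (measurableTypeR R).
Local Open Scope ereal_scope.

(** The image measure gives each interval ]a, b] its length, and Lebesgue measure is the only such
    measure. *)
Lemma lebesgue_measure_translate (s : R) (A : set RR) : measurable A ->
  leb ((fun x : RR => (x + s)%R : RR) @^-1` A) = leb A.
Proof.
have mT : measurable_fun setT (fun x : RR => (x + s)%R : RR).
  by apply: measurable_funD => //; exact: measurable_cst.
move=> mA; pose mu := pushforward leb (fun x : RR => (x + s)%R : RR).
have := @lebesgue_measure_unique R mu _ A mA; rewrite /mu /pushforward => -> //.
move=> _ [[a b] _ <-] /=.
rewrite [X in _ = leb X](_ : _ = `](a - s)%R, (b - s)%R]%classic); last first.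
  by apply/seteqP; split => x /=; rewrite !in_itv/= ltrBlDr lerBrDr.
rewrite !lebesgue_measure_itv/= !lte_fin ltrD2r; case: ifP => // _.
by rewrite -!EFinB; congr EFin; lra.
Qed.

Lemma ge0_integral_translate (s : R) (h : RR -> \bar R) :
  measurable_fun setT h -> (forall x, 0 <= h x) ->
  \int[leb]_x h (x + s)%R = \int[leb]_x h x.
Proof.
move=> mh h0.
have mT : measurable_fun setT (fun x : RR => (x + s)%R : RR).
  by apply: measurable_funD => //; exact: measurable_cst.
have := @ge0_integral_pushforward _ _ RR RR R _ mT leb setT h measurableT mh (fun y _ => h0 y).
rewrite preimage_setT => <-.
by apply: eq_measure_integral => A mA _; exact: lebesgue_measure_translate.
Qed.

Definition plane_integral (k : RR * RR -> \bar R) :=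
  \int[leb]_x \int[leb]_y k (x, y).

(** For a fixed first coordinate the shear is a translation of the second. *)
Lemma plane_integral_shear2 (t : R) k : measurable_fun setT k -> (forall p, 0 <= k p) ->
  plane_integral (fun p => k (p.1, (p.2 + t * p.1)%R)) = plane_integral k.
Proof.
move=> mk k0; apply: eq_integral => x _ /=.
rewrite (@ge0_integral_translate (t * x) (fun y => k (x, y)))//.
exact: (measurableT_comp mk (pair1_measurable x)).
Qed.

Lemma plane_integral_swap k : measurable_fun setT k -> (forall p, 0 <= k p) ->
  plane_integral k = \int[leb]_y \int[leb]_x k (x, y).
Proof. by move=> mk k0; exact: fubini_tonelli. Qed.

Lemma plane_integral_shear1 (t : R) k : measurable_fun setT k -> (forall p, 0 <= k p) ->
  plane_integral (fun p => k ((p.1 + t * p.2)%R, p.2)) = plane_integral k.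
Proof.
move=> mk k0; rewrite !plane_integral_swap//=; last first.
  apply: (measurableT_comp mk); apply/measurable_fun_pairP; split => /=.
    apply: measurable_funD; first exact: measurable_fst.
    apply: measurable_funM; [exact: measurable_cst|exact: measurable_snd].
  exact: measurable_snd.
apply: eq_integral => y _ /=.
rewrite (@ge0_integral_translate (t * y) (fun x => k (x, y)))//.
exact: (measurableT_comp mk (pair2_measurable y)).
Qed.

(* A rotation by an angle other than pi is a product of three shears. *)
Lemma plane_integral_rotate (c s : R) k : (c ^+ 2 + s ^+ 2 = 1)%R -> c != (-1)%R ->
  measurable_fun setT k -> (forall p, 0 <= k p) ->
  plane_integral (fun p => k ((c * p.1 - s * p.2)%R, (s * p.1 + c * p.2)%R)) =
  plane_integral k.
Proof.
(* For c = cos a and s = sin a this is -tan(a/2), the parameter of the two outer shears; the middle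
   one has parameter s. *)
move=> cs cN1 mk k0; pose t := (- s / (1 + c))%R.
have c0 : (1 + c != 0)%R by apply: contra cN1; rewrite addrC addr_eq0.
have e : (t * s = c - 1)%R.
  have s2 : (s ^+ 2 = (1 - c) * (1 + c))%R by lra.
  by rewrite /t mulrAC mulNr -expr2 s2; field.
have mS1 : measurable_fun setT (fun p : RR * RR => ((p.1 + t * p.2)%R : RR, p.2 : RR)).
  apply/measurable_fun_pairP; split => /=; last exact: measurable_snd.
  apply: measurable_funD; first exact: measurable_fst.
  apply: measurable_funM; [exact: measurable_cst|exact: measurable_snd].
have mS2 : measurable_fun setT (fun p : RR * RR => (p.1 : RR, (p.2 + s * p.1)%R : RR)).
  apply/measurable_fun_pairP; split => /=; first exact: measurable_fst.
  apply: measurable_funD; first exact: measurable_snd.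
  apply: measurable_funM; [exact: measurable_cst|exact: measurable_fst].
have m1 := measurableT_comp mk mS1.
have m2 := measurableT_comp m1 mS2.
rewrite -[RHS](plane_integral_shear1 t mk k0).
rewrite -[RHS](plane_integral_shear2 s m1 (fun p => k0 _)).
rewrite -[RHS](plane_integral_shear1 t m2 (fun p => k0 _)).
congr plane_integral; apply/funext => -[a b] /=; congr (k (_, _)).
  have -> : (c * a - s * b = c * a + t * (1 + c) * b)%R by rewrite /t; field.
  transitivity (a + t * b + (t * b + t * s * a + t * s * t * b))%R; last by ring.
  by rewrite e; ring.
transitivity (b + s * a + t * s * b)%R; last by ring.
by rewrite e; ring.
Qed.

Variable m : nat.

Definition rV_cons2 (p : RR * RR) (y : 'rV[R]_m) : 'rV[R]_(2 + m) :=
  @rV_cons R (1 + m) (p.1, @rV_cons R m (p.2, y)).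

Lemma measurable_rV_cons2 : measurable_fun setT (fun q : (RR * RR) * 'rV[R]_m => rV_cons2 q.1 q.2).
Proof.
apply: (measurableT_comp (@measurable_rV_cons R (1 + m))).
apply/measurable_fun_pairP; split => /=.
  exact: (measurableT_comp measurable_fst measurable_fst).
apply: (measurableT_comp (@measurable_rV_cons R m)).
apply/measurable_fun_pairP; split => /=; last exact: measurable_snd.
exact: (measurableT_comp measurable_snd measurable_fst).
Qed.

Lemma ge0_integral_rV_cons n (h : 'rV[R]_(1 + n) -> \bar R) :
  measurable_fun setT h -> (forall x, 0 <= h x) ->
  \int[lebesgue_rV (1 + n)]_x h x =
  \int[leb]_a \int[lebesgue_rV n]_y h (rV_cons (a, y)).
Proof.
move=> mh h0.
rewrite (@ge0_integral_pushforward _ _ _ _ _ _ (@measurable_rV_cons R n)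
  (leb \x lebesgue_rV n) setT h measurableT mh (fun y _ => h0 y)).
rewrite preimage_setT fubini_tonelli1//; first last.
  by move=> x; exact: h0.
exact: (measurableT_comp mh (@measurable_rV_cons R n)).
Qed.

Definition plane_marginal (h : 'rV[R]_(2 + m) -> \bar R) (p : RR * RR) :=
  \int[lebesgue_rV m]_y h (rV_cons2 p y).

Lemma measurable_plane_marginal h : measurable_fun setT h -> (forall x, 0 <= h x) ->
  measurable_fun setT (plane_marginal h).
Proof.
move=> mh h0.
apply: (@measurable_fun_fubini_tonelli_F _ _ _ _ _ (lebesgue_rV m)
  (fun q : (RR * RR) * 'rV[R]_m => h (rV_cons2 q.1 q.2))) => //.
exact: (measurableT_comp mh measurable_rV_cons2).
Qed.

Lemma ge0_integral_rV_cons2 (h : 'rV[R]_(2 + m) -> \bar R) :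
  measurable_fun setT h -> (forall x, 0 <= h x) ->
  \int[lebesgue_rV (2 + m)]_x h x = plane_integral (plane_marginal h).
Proof.
move=> mh h0; rewrite (@ge0_integral_rV_cons (1 + m))//.
apply: eq_integral => a _; rewrite (@ge0_integral_rV_cons m)//.
apply: (measurableT_comp mh).
apply: (measurableT_comp (@measurable_rV_cons R (1 + m))).
exact: (pair1_measurable (a : RR)).
Qed.

Definition rotate (c s : R) (x : 'rV[R]_(2 + m)) : 'rV[R]_(2 + m) :=
  let p := @rV_uncons R (1 + m) x in let q := @rV_uncons R m p.2 in
  rV_cons2 ((c * p.1 - s * q.1)%R, (s * p.1 + c * q.1)%R) q.2.

Lemma rotate_cons2 c s p y :
  rotate c s (rV_cons2 p y) =
  rV_cons2 ((c * p.1 - s * p.2)%R, (s * p.1 + c * p.2)%R) y.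
Proof. by rewrite /rotate /rV_cons2 !rV_consK. Qed.

Lemma measurable_rotate c s : measurable_fun setT (rotate c s).
Proof.
have mp := @measurable_rV_uncons R (1 + m).
have mp1 := measurableT_comp measurable_fst mp.
have mq := measurableT_comp (@measurable_rV_uncons R m) (measurableT_comp measurable_snd mp).
have mq1 := measurableT_comp measurable_fst mq.
have mq2 := measurableT_comp measurable_snd mq.
apply: (measurableT_comp measurable_rV_cons2 (_ : measurable_fun setT
  (fun x => let p := @rV_uncons R (1 + m) x in let q := @rV_uncons R m p.2 in
    (((c * p.1 - s * q.1)%R : RR, (s * p.1 + c * q.1)%R : RR), q.2)))).
apply/measurable_fun_pairP; split => //=.
apply/measurable_fun_pairP; split => /=.
  apply: measurable_funB; apply: measurable_funM => //; exact: measurable_cst.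
apply: measurable_funD; apply: measurable_funM => //; exact: measurable_cst.
Qed.

(** By Tonelli the other coordinates are integrated out first, and the plane rotation acts on the
    resulting marginal. *)
Lemma ge0_integral_rotate c s (h : 'rV[R]_(2 + m) -> \bar R) :
  (c ^+ 2 + s ^+ 2 = 1)%R -> c != (-1)%R ->
  measurable_fun setT h -> (forall x, 0 <= h x) ->
  \int[lebesgue_rV (2 + m)]_x h (rotate c s x) = \int[lebesgue_rV (2 + m)]_x h x.
Proof.
move=> cs c1 mh h0; have mhr := measurableT_comp mh (measurable_rotate c s).
rewrite (ge0_integral_rV_cons2 mh h0) (ge0_integral_rV_cons2 mhr (fun x => h0 _)).
rewrite -(plane_integral_rotate cs c1 (measurable_plane_marginal mh h0)); last first.
  by move=> p; exact: integral_ge0.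
congr plane_integral; apply/funext => p.
by apply: eq_integral => y _; rewrite -[LHS]/(h (rotate _ _ _)) rotate_cons2.
Qed.

End lebesgue_transformations.

Arguments cz : simpl never.
Arguments normc : simpl never.
Arguments rotate : simpl never.

(** * Rotation invariant annuli and their volume *)

Section annuli.
Context {R : realType} {m : nat}.
Local Notation leb := (@lebesgue_measure R).
Local Notation RR := (measurableTypeR R).
Implicit Types (x : 'rV[R]_(2 + m)) (p : RR * RR) (y : 'rV[R]_m).

Lemma rV_cons_head n (a : RR) (v : 'rV[R]_n) (i : 'I_(1 + n)) : val i = 0%N ->
  rV_cons (a, v) 0 i = a.
Proof.
move=> i0; rewrite (_ : i = lshift n 0); last exact/val_inj.
by rewrite /rV_cons row_mxEl mxE eqxx mulr1n.
Qed.

Lemma rV_cons_tail n (a : RR) (v : 'rV[R]_n) (i : 'I_(1 + n)) (j : 'I_n) :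
  val i = (val j).+1 -> rV_cons (a, v) 0 i = v 0 j.
Proof.
move=> ij; rewrite (_ : i = rshift 1 j); last exact/val_inj.
by rewrite /rV_cons row_mxEr.
Qed.

Lemma cz_cons2 p y : cz (rV_cons2 p y) = Complex (p.1 : R) p.2.
Proof.
rewrite /cz /rV_cons2; congr Complex; rewrite mxE.
  by rewrite (@rV_cons_head (1 + m)).
by rewrite (@rV_cons_tail (1 + m) _ _ _ (0 : 'I_(1 + m)))// (@rV_cons_head m).
Qed.

Lemma rsubmx_cons2 p y : rsubmx (rV_cons2 p y) = y.
Proof.
apply/rowP => i; rewrite mxE /rV_cons2.
rewrite (@rV_cons_tail (1 + m) _ _ _ (rshift 1 i : 'I_(1 + m)))//.
by rewrite (@rV_cons_tail m _ _ _ i).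
Qed.

Lemma rV_cons2P x : exists p y, x = rV_cons2 p y.
Proof.
exists ((lsubmx x 0 0 : R) : RR, (lsubmx x 0 1 : R) : RR), (rsubmx x).
apply/rowP => k; case: (@split_ordP 2 m k) => j ->.
  case: j => -[|[|//]] hj.
    by rewrite /rV_cons2 (@rV_cons_head (1 + m))//= mxE; congr (x 0 _); exact/val_inj.
  rewrite /rV_cons2 (@rV_cons_tail (1 + m) _ _ _ (0 : 'I_(1 + m)))// (@rV_cons_head m)//=.
  by rewrite mxE; congr (x 0 _); exact/val_inj.
rewrite /rV_cons2 (@rV_cons_tail (1 + m) _ _ _ (rshift 1 j : 'I_(1 + m)))//.
by rewrite (@rV_cons_tail m _ _ _ j)// mxE.
Qed.

Lemma cz_rotate c s x : cz (rotate c s x) = Complex c s * cz x.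
Proof.
have [p [y ->]] := rV_cons2P x.
by rewrite rotate_cons2 !cz_cons2 /=; rewrite [in RHS]/GRing.mul /= [(s * _ + _)%R]addrC.
Qed.

Lemma rsubmx_rotate c s x : rsubmx (rotate c s x) = rsubmx x.
Proof. by have [p [y ->]] := rV_cons2P x; rewrite rotate_cons2 !rsubmx_cons2. Qed.

(** A shell at distance of order e from |z| = 1. The inner bound 1 - e and the outer bound 1 - e/2
    make the shells for e = 2^-j disjoint. *)
Definition annulus (e d : R) : set 'rV[R]_(2 + m) :=
  [set x | 1 - e < normc (cz x) ^+ 2 < 1 - e / 2 /\ forall i, `|rsubmx x 0 i| < d].

Lemma normc_sqr (z : R[i]) : normc z ^+ 2 = complex.Re z ^+ 2 + complex.Im z ^+ 2.
Proof. by case: z => a b; rewrite /normc /=; rewrite sqr_sqrtr// addr_ge0// sqr_ge0. Qed.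

Lemma measurable_normc_cz : measurable_fun setT (fun x => normc (cz x) ^+ 2 : RR).
Proof.
rewrite (_ : (fun x => _) = (fun x => x 0 (lshift m 0) ^+ 2 + x 0 (lshift m 1) ^+ 2)).
  by apply: measurable_funD; apply: measurable_funX; exact: measurable_coord.
by apply/funext => x; rewrite normc_sqr /cz /= !mxE.
Qed.

Lemma measurable_annulus e d : measurable (annulus e d).
Proof.
rewrite (_ : annulus e d =
  (fun x => normc (cz x) ^+ 2 : RR) @^-1` `]1 - e, 1 - e / 2[%classic `&`
  \bigcap_(i in [set: 'I_m]) (fun x => x 0 (rshift 2 i) : RR) @^-1` `]- d, d[%classic).
  apply: measurableI.
    by rewrite -[X in measurable X]setTI; apply: measurable_normc_cz.
  apply: fin_bigcap_measurable => // i _.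
  by rewrite -[X in measurable X]setTI; apply: measurable_coord.
apply/seteqP; split => x /=; rewrite /annulus/= in_itv/= => -[-> h]; split=> // i.
  by move=> _ /=; rewrite in_itv/= -ltr_norml; have := h i; rewrite mxE.
by have := h i I; rewrite /= in_itv/= -ltr_norml mxE.
Qed.

Lemma annulus_rotate c s e d x : c ^+ 2 + s ^+ 2 = 1 ->
  annulus e d (rotate c s x) <-> annulus e d x.
Proof.
move=> cs; rewrite /annulus /= cz_rotate normcM exprMn rsubmx_rotate.
by rewrite [normc (Complex _ _) ^+ 2]normc_sqr /= cs mul1r.
Qed.

Definition cube n (d : R) : set 'rV[R]_n := [set y | forall i, `|y 0 i| < d].

Lemma cubeE n d : cube d = [set y : 'rV[R]_n | forall i : 'I_n, `]- d, d[%classic (y 0 i)].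
Proof. by apply/seteqP; split => y /= h i; have := h i; rewrite /= in_itv/= -ltr_norml. Qed.

Lemma measurable_cube n d : measurable (@cube n d).
Proof.
rewrite (_ : cube d = \bigcap_(i in [set: 'I_n])
  (fun x : 'rV[R]_n => x 0 i : RR) @^-1` `]- d, d[%classic).
  apply: fin_bigcap_measurable => // i _.
  by rewrite -[X in measurable X]setTI; apply: measurable_coord.
by rewrite cubeE; apply/seteqP; split => x /= h i; [move=> _; exact: h|exact: h].
Qed.

Lemma lebesgue_rV_cube n (d : R) : 0 < d ->
  lebesgue_rV n (cube d) = ((2 * d) ^+ n)%:E.
Proof.
move=> d0; rewrite cubeE.
rewrite (@lebesgue_rV_box R n (fun=> `]- d, d[%classic)); last first.
  by move=> i; exact: measurable_itv.
rewrite (eq_bigr (fun=> (2 * d)%:E)); last first.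
  move=> i _; have dd : - d < d by lra.
  by rewrite lebesgue_measure_itv/= lte_fin dd -EFinB; congr EFin; lra.
by rewrite prodEFin prodr_const card_ord.
Qed.

(** For x_1 = a in ]0, 1/2[, the values of x_2 between [g1 a] and [g2 a] belong to the shell. Since
    g2^2 - g1^2 = e/2 and g1 + g2 <= 2, this interval has length at least e/4; the range of a
    contributes the factor 1/2. *)
Lemma annulus_volume e d : 0 < e <= 1 / 2 -> 0 < d ->
  ((e / 8 * (2 * d) ^+ m)%:E <= lebesgue_rV (2 + m) (annulus e d))%E.
Proof.
move=> /andP[e0 e1] d0; have mA := measurable_annulus e d.
pose h := fun x => (\1_(annulus e d) x)%:E : \bar R.
have mh : measurable_fun setT h by apply/measurable_EFinP; exact: measurable_indic.
have h0 x : (0 <= h x)%E by rewrite lee_fin.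
rewrite -(setIT (annulus e d)) -integral_indic// -/h.
rewrite (ge0_integral_rV_cons2 mh h0) /plane_integral.
set V := (2 * d) ^+ m; have V0 : 0 <= V by rewrite exprn_ge0//; lra.
have mp := measurable_plane_marginal mh h0.
have p0 p : (0 <= plane_marginal h p)%E by exact: integral_ge0.
pose g1 a : R := Num.sqrt (1 - e - a ^+ 2).
pose g2 a : R := Num.sqrt (1 - e / 2 - a ^+ 2).
have marg a b : a \in `]0, 1 / 2[ -> b \in `]g1 a, g2 a[ -> plane_marginal h (a, b) = V%:E.
  rewrite !in_itv/= => /andP[a0 a1] /andP[b1 b2].
  have g10 : 0 <= g1 a by exact: sqrtr_ge0.
  have b0 : 0 <= b by rewrite (le_trans g10)// ltW.
  have q1 : 0 <= 1 - e - a ^+ 2 by nra.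
  have q2 : 0 <= 1 - e / 2 - a ^+ 2 by nra.
  have B1 : 1 - e - a ^+ 2 < b ^+ 2.
    by rewrite -(sqr_sqrtr q1) ltr_pXn2r ?nnegrE.
  have B2 : b ^+ 2 < 1 - e / 2 - a ^+ 2.
    by rewrite -(sqr_sqrtr q2) ltr_pXn2r ?nnegrE// sqrtr_ge0.
  rewrite /plane_marginal -(lebesgue_rV_cube m d0).
  rewrite -[in RHS](setIT (cube d)) -integral_indic//; last exact: measurable_cube.
  apply: eq_integral => y _; rewrite /h /indic; congr ((_ : bool)%:R%:E).
  apply/idP/idP; rewrite !inE /annulus /= rsubmx_cons2 cz_cons2 normc_sqr /=.
    by case.
  by move=> H; split => //; apply/andP; split; lra.
have inner a : a \in `]0, 1 / 2[ -> ((e / 4 * V)%:E <= \int[leb]_b plane_marginal h (a, b))%E.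
  move=> a01; have := a01; rewrite in_itv/= => /andP[a0 a1].
  have mpa : measurable_fun setT (fun b : RR => plane_marginal h (a, b)).
    exact: (measurableT_comp mp (pair1_measurable (a : RR))).
  apply: le_trans (_ : \int[leb]_(b in `]g1 a, g2 a[) plane_marginal h (a, b) <= _)%E; last first.
    by apply: ge0_subset_integral.
  rewrite (eq_integral (fun=> V%:E)); last by move=> b; rewrite inE /= => hb; exact: marg.
  rewrite integral_cst//= lebesgue_measure_itv/= lte_fin.
  have q1 : 0 <= 1 - e - a ^+ 2 by nra.
  have q2 : 0 <= 1 - e / 2 - a ^+ 2 by nra.
  have G1 : g1 a ^+ 2 = 1 - e - a ^+ 2 by rewrite sqr_sqrtr.
  have G2 : g2 a ^+ 2 = 1 - e / 2 - a ^+ 2 by rewrite sqr_sqrtr.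
  have g10 : 0 <= g1 a by exact: sqrtr_ge0.
  have g20 : 0 <= g2 a by exact: sqrtr_ge0.
  have g21 : g2 a <= 1 by nra.
  have g12 : g1 a < g2 a by nra.
  rewrite g12 -EFinB -EFinM lee_fin mulrC ler_wpM2l//.
  nra.
apply: le_trans (_ : \int[leb]_(a in `]0%R, (1 / 2)%R[) (e / 4 * V)%:E <= _)%E.
  rewrite integral_cst//= lebesgue_measure_itv/= lte_fin.
  have half : 0 < 1 / 2 :> R by lra.
  by rewrite half -EFinB -EFinM lee_fin; lra.
apply: le_trans (_ : \int[leb]_(a in `]0%R, (1 / 2)%R[) \int[leb]_b plane_marginal h (a, b) <= _)%E.
  apply: ge0_le_integral => //.
  - by move=> a _; rewrite lee_fin mulr_ge0//; lra.
  - apply: measurable_funTS; exact: (measurable_fun_fubini_tonelli_F _ mp).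
apply: ge0_subset_integral => //.
- exact: (measurable_fun_fubini_tonelli_F _ mp).
- by move=> a _; exact: integral_ge0.
Qed.

End annuli.

(** * Smooth functions of the type exp(-1/s) *)

Section bump_functions.
Context {R : realType}.
Implicit Types (r s : {poly R}) (N : nat) (t : R).

(* Derivatives of exp(-1/s) stay in the family r s^-N exp(-1/s), extended by 0
   to the points where s <= 0. *)
Definition bump r s N t : R :=
  if 0 < s.[t] then r.[t] * (s.[t])^-1 ^+ N * expR (- (s.[t])^-1) else 0.

Definition bump_next r s N : {poly R} :=
  r^`() * s ^+ 2 - N%:R *: (r * s^`() * s) + r * s^`().

(** Raise x/K <= exp(x/K) to the power K. With x = 1/s this lets the exponential beat the poles of
    [bump]. *)
Lemma exprn_le_expR (x : R) K : 0 <= x -> x ^+ K <= K%:R ^+ K * expR x.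
Proof.
case: K => [|K] x0; first by rewrite !expr0 mul1r -expR0 ler_expR.
have K0 : 0 < K.+1%:R :> R by [].
have -> : expR x = expR (x / K.+1%:R) ^+ K.+1.
  by rewrite -expRM_natl mulrC divfK ?lt0r_neq0.
rewrite -exprMn; apply: lerX2 => //.
rewrite -ler_pdivrMl// mulrC; apply: le_trans (expR_ge1Dx _).
by rewrite lerDr.
Qed.

(** Where s is not 0 this is calculus. At a zero t of s, s(t + h) is O(h), and s^-N exp(-1/s) <= K^K
    s^2 with K = N + 2; so the function is O(h^2) and its derivative is 0. *)
Lemma is_derive_bump r s N t :
  is_derive t (1 : R) (bump r s N) (bump (bump_next r s N) s N.+2 t).
Proof.
have cs := @continuous_horner R s t.
have [s0|s0|s0] := ltgtP s.[t] 0.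
- rewrite {2}/bump ltNge (ltW s0) /=.
  have H : \near t, cst 0 t = bump r s N t.
    near=> y; rewrite /bump ltNge (_ : s.[y] <= 0)//.
    by apply/ltW; near: y; exact: cvgr_lt s0.
  exact: (@near_eq_is_derive R R^o R^o _ _ t 1 0 H (is_derive_cst 0 t 1)).
- rewrite {2}/bump s0.
  pose f := (horner r * (fun y => (s.[y])^-1 ^+ N)) * (fun y => expR (- (s.[y])^-1)).
  have H : \near t, f t = bump r s N t.
    near=> y; rewrite /bump (_ : 0 < s.[y])//.
    by near: y; exact: cvgr_gt s0.
  apply: (@near_eq_is_derive R R^o R^o _ _ t 1 _ H).
  have dr := is_derive_poly r t.
  have ds := is_derive_poly s t.
  have sn0 : s.[t] != 0 by rewrite lt0r_neq0.
  have dv := @is_deriveV R (horner s) t s^`().[t] 1 sn0 ds.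
  have dN : is_derive t (1 : R) (fun y => (s.[y])^-1 ^+ N)
      (N%:R * (s.[t])^-1 ^+ N.-1 * (- s.[t] ^- 2 * s^`().[t])).
    have := @is_deriveX R _ (fun y => (s.[y])^-1) N t 1 _ dv.
    by rewrite exprfctE.
  have dm := @is_deriveN _ _ _ _ _ _ _ dv.
  have de := @is_derive1_comp R expR (fun y => - (s.[y])^-1) t _ _ (is_derive_expR _) dm.
  have drN := @is_deriveM _ _ _ _ _ _ _ _ dr dN.
  apply: (is_derive_eq (@is_deriveM _ _ _ _ _ _ _ _ drN de)).
  change (r.[t] * (s.[t])^-1 ^+ N * (expR (- (s.[t])^-1) * - (- s.[t] ^- 2 * s^`().[t])) +
    expR (- (s.[t])^-1) * (r.[t] * (N%:R * (s.[t])^-1 ^+ N.-1 * (- s.[t] ^- 2 * s^`().[t])) +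
      (s.[t])^-1 ^+ N * r^`().[t]) =
    (bump_next r s N).[t] * (s.[t])^-1 ^+ N.+2 * expR (- (s.[t])^-1)).
  rewrite /bump_next !(hornerD, hornerN, hornerM, hornerZ, horner_exp).
  clear f H drN dN de dm dv dr ds s0 cs; move: sn0; move: (s.[t]) (s^`().[t]) (r.[t]) (r^`().[t]) => S S' X X' Sn0.
  move: (expR _) => e.
  case: N => [|M]; first by field.
  rewrite -[M.+1.-1]/M [S^-1 ^+ M.+3]exprS [S^-1 ^+ M.+2]exprS [S^-1 ^+ M.+1]exprS.
  by move: (S^-1 ^+ M) => P; move: (M.+1%:R) => K; field.
- rewrite {2}/bump s0 ltxx.
  have /factor_theorem[q sq] : root s t by apply/eqP.
  pose K := N.+2.
  apply: (@is_derive_quadratic _ _ _ _ _ _ ((`|r.[t]| + 1) * K%:R ^+ K * (`|q.[t]| + 1) ^+ 2)).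
  have near_le (p : {poly R}) : \forall h \near (0 : R), `|p.[h + t]| <= `|p.[t]| + 1.
    have cp : (fun h : R => `|p.[h + t]|) @ (0 : R) --> `|p.[t]|.
      apply: cvg_norm; rewrite -{2}[t]add0r; apply: (@continuous_comp _ _ _ (fun h => h + t) (horner p)).
        by apply: cvgD; [exact: cvg_id|exact: cvg_cst].
      exact: continuous_horner.
    by apply: (cvgr_le _ cp); rewrite ltrDl.
  near=> h.
  have hr : `|r.[h + t]| <= `|r.[t]| + 1 by near: h; exact: near_le.
  have hq : `|q.[h + t]| <= `|q.[t]| + 1 by near: h; exact: near_le.
  rewrite [h *: _]mulr1 mulr0 subr0 {2}/bump s0 ltxx subr0 /bump.
  have A0 : 0 <= `|r.[t]| + 1 by exact: addr_ge0.
  have B0 : 0 <= K%:R ^+ K :> R by exact: exprn_ge0.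
  have M0 : 0 <= (`|r.[t]| + 1) * K%:R ^+ K * (`|q.[t]| + 1) ^+ 2.
    exact: mulr_ge0 (mulr_ge0 A0 B0) (sqr_ge0 _).
  case: ifPn => [sp|_]; last by rewrite normr0 mulr_ge0// sqr_ge0.
  set S := s.[h + t] in sp *.
  have Sh : S = h * q.[h + t] by rewrite /S sq !hornerE mulrC addrK.
  have Si : 0 <= S^-1 by rewrite invr_ge0 ltW.
  have key : S^-1 ^+ N * expR (- S^-1) <= K%:R ^+ K * S ^+ 2.
    have le1 : S^-1 ^+ K * expR (- S^-1) <= K%:R ^+ K.
      by rewrite expRN ler_pdivrMr ?expR_gt0//; exact: exprn_le_expR.
    have -> : S^-1 ^+ N = S^-1 ^+ K * S ^+ 2.
      by rewrite /K !exprS; field; rewrite lt0r_neq0.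
    by rewrite [leLHS]mulrAC; apply: ler_wpM2r => //; exact: sqr_ge0.
  rewrite -mulrA normrM [`|_ * expR _|]ger0_norm ?mulr_ge0 ?exprn_ge0 ?expR_ge0//.
  apply: le_trans (_ : (`|r.[t]| + 1) * (K%:R ^+ K * S ^+ 2) <= _).
    apply: ler_pM; [exact: normr_ge0| |exact: hr|exact: key].
    exact: mulr_ge0 (exprn_ge0 _ Si) (expR_ge0 _).
  have final : S ^+ 2 <= (`|q.[t]| + 1) ^+ 2 * h ^+ 2.
    rewrite Sh exprMn mulrC; apply: ler_wpM2r; first exact: sqr_ge0.
    by rewrite -[leLHS]real_normK ?num_real//; exact: lerX2.
  apply: le_trans (ler_wpM2l A0 (ler_wpM2l B0 final)) _.
  by rewrite !mulrA.
Unshelve. all: by end_near. Qed.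

End bump_functions.

(** * Test functions that approximate indicators of boxes *)

Section bump_products.
Context {R : realType}.
Implicit Types (r s : {poly R}).

(** Numerator and exponent of s in the d-th derivative of exp(-1/s). *)
Fixpoint bump_iter s d : {poly R} * nat :=
  if d is e.+1 then (bump_next (bump_iter s e).1 s (bump_iter s e).2, (bump_iter s e).2.+2)
  else (1, 0%N).

Definition bump_der s d : R -> R := bump (bump_iter s d).1 s (bump_iter s d).2.

Lemma is_derive_bump_der s d t : is_derive t (1 : R) (bump_der s d) (bump_der s d.+1 t).
Proof. exact: is_derive_bump. Qed.

Lemma continuous_bump_der s d : continuous (bump_der s d).
Proof.
move=> t; apply/differentiable_continuous/derivable1_diffP.
by have [] := is_derive_bump_der s d t.
Qed.

Lemma bump_der_out s d t : s.[t] <= 0 -> bump_der s d t = 0.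
Proof. by rewrite /bump_der /bump ltNge => ->. Qed.

Lemma bump_der0E s t : bump_der s 0 t = if 0 < s.[t] then expR (- (s.[t])^-1) else 0.
Proof. by rewrite /bump_der /bump /= hornerC expr0 !mul1r. Qed.

Lemma bump_der0_itv s t : 0 <= bump_der s 0 t <= 1.
Proof.
rewrite bump_der0E; case: ifPn => [s0|_]; last by rewrite lexx ler01.
by rewrite expR_ge0 -expR0 ler_expR oppr_le0 invr_ge0 ltW.
Qed.

(** Positive exactly on ]a, b[ when a < b; the factor k + 1 makes exp(-1/[quad]) tend to 1 there as
    k grows, with the support unchanged. *)
Definition quad (a b : R) (k : nat) : {poly R} := k.+1%:R *: (('X - a%:P) * (b%:P - 'X)).

Lemma horner_quad a b k t : (quad a b k).[t] = k.+1%:R * ((t - a) * (b - t)).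
Proof. by rewrite !hornerE. Qed.

Lemma quad_gt0 a b k t : a < b -> (0 < (quad a b k).[t]) = (a < t < b).
Proof.
move=> ab; rewrite horner_quad pmulr_rgt0//.
case: (ltP a t) => at_; case: (ltP t b) => tb /=.
- by rewrite mulr_gt0// subr_gt0.
- by apply/negbTE; rewrite -leNgt mulr_ge0_le0// ?subr_ge0 ?subr_le0// ltW.
- by apply/negbTE; rewrite -leNgt mulr_le0_ge0// ?subr_ge0 ?subr_le0// ltW.
- by apply/negbTE; lra.
Qed.

Lemma cvg_bump_quad a b t : a < t < b -> bump_der (quad a b k) 0 t @[k --> \oo] --> (1 : R).
Proof.
move=> tab; have ab : a < b by case/andP: tab; exact: lt_trans.
have E k : bump_der (quad a b k) 0 t = expR (- (((t - a) * (b - t))^-1 * k.+1%:R^-1)).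
  by rewrite bump_der0E quad_gt0// tab horner_quad invfM mulrC.
under eq_fun do rewrite E.
suff : expR (- (((t - a) * (b - t))^-1 * k.+1%:R^-1)) @[k --> \oo] --> expR (0 : R) by rewrite expR0.
apply: continuous_cvg; first exact: continuous_expR.
have H := @cvgMl_tmp _ _ _ _ _ ((t - a) * (b - t))^-1 _ (@cvg_harmonic R).
rewrite mulr0 in H; rewrite -[X in _ --> X]oppr0.
exact: (cvgN (H _)).
Qed.

Variable n : nat.
Implicit Types (S : 'I_n -> {poly R}) (d : 'I_n -> nat) (x : 'rV[R]_n) (w : seq 'I_n).

Definition bump_prod S d x : R := \prod_(i < n) bump_der (S i) (d i) (x 0 i).

Lemma bump_prod_derive S d x i :
  is_derive x ('e_i : 'rV[R]_n) (bump_prod S d) (bump_prod S (fun j => d j + (j == i))%N x).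
Proof.
pose C := \prod_(j < n | j != i) bump_der (S j) (d j) (x 0 j).
pose g := bump_der (S i) (d i).
have line h : bump_prod S d (h *: 'e_i + x) = C * g (h *: 1 + x 0 i).
  rewrite /bump_prod (bigD1 i)//= mulrC; congr (_ * _).
    by apply: eq_bigr => j ji; rewrite !mxE /= (negbTE ji) mulr0 add0r.
  by rewrite !mxE !eqxx.
have [dg eg] := is_derive_bump_der (S i) (d i) (x 0 i).
have cg := @cvgMl_tmp _ _ _ _ _ C _ dg _.
have cL : h^-1 *: ((bump_prod S d \o shift x) (h *: 'e_i) - bump_prod S d x)
    @[h --> 0^'] --> C * 'D_1 g (x 0 i).
  rewrite (_ : (fun h => _) = (fun h => C * (h^-1 *: ((g \o shift (x 0 i)) (h *: 1) - g (x 0 i)))));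
    first exact: cg.
  apply/funext => h; have l0 := line 0; rewrite scale0r add0r scale0r add0r in l0.
  by rewrite /= /shift /= line l0 -mulrBr /GRing.scale /= mulrCA.
apply: DeriveDef; first by apply/cvg_ex; eexists; exact: cL.
transitivity (C * 'D_1 g (x 0 i)); first exact: cvg_lim cL.
rewrite eg /C /bump_prod [RHS](bigD1 i)//= eqxx addn1 mulrC; congr (_ * _).
by apply: eq_bigr => j ji; rewrite (negbTE ji) addn0.
Qed.

Lemma bump_prodE S d d' : d =1 d' -> bump_prod S d = bump_prod S d'.
Proof. by move=> dd; apply/funext => x; apply: eq_bigr => i _; rewrite dd. Qed.

Lemma partial_bump_prod S d w :
  partial w (bump_prod S d) = bump_prod S (fun j => d j + count_mem j w)%N.
Proof.
elim: w => [|i w IH] /=; first by apply: bump_prodE => j; rewrite addn0.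
rewrite -[LHS]/('D_('e_i) (partial w (bump_prod S d))) IH; apply/funext => x.
have [_ ->] := bump_prod_derive S (fun j => d j + count_mem j w)%N x i.
by rewrite (@bump_prodE _ _ (fun j => d j + ((i == j) + count_mem j w))%N)// => j;
  rewrite addnAC -addnA eq_sym.
Qed.

Lemma continuous_bump_prod S d : continuous (bump_prod S d).
Proof.
rewrite /bump_prod; elim: (index_enum _) => [|i s IH].
  under eq_fun do rewrite big_nil.
  exact: cst_continuous.
under eq_fun do rewrite big_cons.
move=> x; have H : (fun y : 'rV[R]_n => bump_der (S i) (d i) (y 0 i)) @ x -->
    bump_der (S i) (d i) (x 0 i).
  have c1 : (fun y : 'rV[R]_n => y 0 i) @ x --> x 0 i by exact: coord_continuous.
  exact: (cvg_comp _ _ c1 (@continuous_bump_der (S i) (d i) (x 0 i))).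
exact: (cvgM H (IH x)).
Qed.

Lemma measurable_bump_prod S d : measurable_fun setT (bump_prod S d).
Proof.
rewrite /bump_prod; elim: (index_enum _) => [|i s IH].
  under eq_fun do rewrite big_nil.
  exact: measurable_cst.
under eq_fun do rewrite big_cons.
apply: measurable_funM; last exact: IH.
apply: (@measurableT_comp _ _ _ _ _ _ (bump_der (S i) (d i))).
  by apply: continuous_measurable_fun; exact: continuous_bump_der.
exact: measurable_coord.
Qed.

Lemma bump_prod_Ck S d k : is_Ck k setT (bump_prod S d).
Proof.
move=> w _; rewrite partial_bump_prod; split => [x _|_ i x _].
  exact: continuous_bump_prod.
by have [] := bump_prod_derive S (fun j => d j + count_mem j w)%N x i.
Qed.

Definition obox (a b : 'I_n -> R) : set 'rV[R]_n := [set x | forall i, a i < x 0 i < b i].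
Definition cbox (a b : 'I_n -> R) : set 'rV[R]_n := [set x | forall i, a i <= x 0 i <= b i].

Definition bump_box (a b : 'I_n -> R) (k : nat) := bump_prod (fun i => quad (a i) (b i) k).

Variables (a b : 'I_n -> R).
Hypothesis ab : forall i, a i < b i.

Lemma bump_box_out k d x : ~ obox a b x -> bump_box a b k d x = 0.
Proof.
move=> nx; have /existsNP[i xi] : ~ forall i, a i < x 0 i < b i by [].
rewrite /bump_box /bump_prod (bigD1 i)//= bump_der_out ?mul0r// leNgt quad_gt0//.
exact/negP.
Qed.

Lemma compact_cbox : compact (cbox a b).
Proof.
rewrite (_ : cbox a b = [set v : 'rV[R]_n | forall i, `[a i, b i]%classic (v ord0 i)]).
  apply: (@rV_compact R n (fun i => `[a i, b i]%classic)) => i; exact: segment_compact.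
by apply/seteqP; split => x h i; have := h i; rewrite /= in_itv.
Qed.

Lemma closure_support_bump_box k d :
  closure [set x | bump_box a b k d x != 0] `<=` cbox a b.
Proof.
have cb : closed (cbox a b) := (compact_closed (@norm_hausdorff _ _) compact_cbox).
rewrite [X in _ `<=` X]((closure_id _).1 cb); apply: closure_subset => x /= x0 i.
apply: contrapT => xi; move/eqP: x0; apply; apply: bump_box_out => /(_ i) /andP[h1 h2].
by apply: xi; rewrite !ltW.
Qed.

Lemma test_function_bump_box (U : set 'rV[R]_n) k d : cbox a b `<=` U ->
  test_function U (bump_box a b k d).
Proof.
move=> abU; split; first by move=> j; exact: bump_prod_Ck.
- apply: (subclosed_compact _ compact_cbox); first exact: closed_closure.
  exact: closure_support_bump_box.
- exact: subset_trans (@closure_support_bump_box k d) abU.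
Qed.

Lemma bump_box0_itv k x : 0 <= bump_box a b k (fun=> 0%N) x <= 1.
Proof.
apply/andP; split.
  by apply: prodr_ge0 => i _; case/andP: (bump_der0_itv (quad (a i) (b i) k) (x 0 i)).
by apply: prodr_ile1 => i _; exact: bump_der0_itv.
Qed.

Lemma cvg_bump_box x : bump_box a b k (fun=> 0%N) x @[k --> \oo] --> (\1_(obox a b) x : R).
Proof.
have [xab|nxab] := pselect (obox a b x).
  rewrite indicE mem_set// /bump_box /bump_prod.
  elim: (index_enum _) => [|i s IH].
    under eq_fun do rewrite big_nil.
    exact: cvg_cst.
  under eq_fun do rewrite big_cons.
  have H := @cvgM _ _ _ _ _ _ _ _ (cvg_bump_quad (xab i)) IH.
  rewrite mulr1 in H; exact: H.
rewrite indicE memNset//; under eq_fun do rewrite bump_box_out//.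
exact: cvg_cst.
Qed.

Lemma oboxE : obox a b = [set x | forall i, `]a i, b i[%classic (x 0 i)].
Proof. by apply/seteqP; split => x h i; have := h i; rewrite /= in_itv. Qed.

Lemma measurable_obox : measurable (obox a b).
Proof.
rewrite (_ : obox a b = \bigcap_(i in [set: 'I_n])
  (fun x : 'rV[R]_n => x 0 i : measurableTypeR R) @^-1` `]a i, b i[%classic).
  apply: fin_bigcap_measurable => // i _.
  by rewrite -[X in measurable X]setTI; apply: measurable_coord.
by rewrite oboxE; apply/seteqP; split => x /= h i; [move=> _; exact: h|exact: h].
Qed.

Lemma lebesgue_obox_fin : (lebesgue_rV n (obox a b) < +oo)%E.
Proof.
rewrite oboxE (@lebesgue_rV_box R n (fun i => `]a i, b i[%classic)); last first.
  by move=> i; exact: measurable_itv.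
suff : (0 <= \prod_(i < n) lebesgue_measure (`]a i, b i[%classic : set (measurableTypeR R)) < +oo)%E.
  by case/andP.
elim/big_ind : _ => //.
- by rewrite lee01 ltry.
- move=> y z /andP[y0 y1] /andP[z0 z1]; rewrite mule_ge0//= lte_mul_pinfty//.
  by rewrite ge0_fin_numE.
- move=> i _; rewrite measure_ge0/= lebesgue_measure_itv/= lte_fin ab.
  by rewrite -EFinB ltry.
Qed.

End bump_products.

(** * Integration by parts in the first coordinate *)

Section integration_by_parts.
Context {R : realType} {m : nat}.
Local Notation RR := (measurableTypeR R).
Local Notation leb := (@lebesgue_measure R).
Local Notation V := 'rV[R]_(2 + m).
Implicit Types (c : nat -> R) (g : R[i]) (x : V) (d : 'I_(2 + m) -> nat).

Lemma measurable_coordRe (k : nat) g : measurable_fun setT (fun x : V => complex.Re (g * cz x ^+ k) : RR).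
Proof.
have mI i : measurable_fun setT (fun x : V => x 0 i : RR) by exact: measurable_coord.
elim: k g => [|k IH] g.
  under eq_fun do rewrite expr0.
  exact: measurable_cst.
have E x : complex.Re (g * cz x ^+ k.+1) =
    x 0 (lshift m 0) * complex.Re (g * cz x ^+ k) + x 0 (lshift m 1) * complex.Re ((g * 'i%C) * cz x ^+ k).
  rewrite exprSr mulrA mulrAC; move: (cz x ^+ k) => w.
  by rewrite /cz !mxE; case: g => a b; case: w => p q /=; ring.
under eq_fun do rewrite E.
by apply: measurable_funD; apply: measurable_funM; first [exact: mI|exact: IH].
Qed.

Lemma measurable_cyl : measurable (@cyl R m).
Proof.
rewrite (_ : @cyl R m = (fun x : V => normc (cz x) ^+ 2 : RR) @^-1` `]-oo, 1[%classic).
  by rewrite -[X in measurable X]setTI; apply: measurable_normc_cz.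
by apply/seteqP; split => x; rewrite /cyl /= in_itv/= expr_lt1 ?normc_ge0.
Qed.

Lemma measurable_plane_series g c : radius_ge1 c -> measurable_fun (@cyl R m) (plane_series g c).
Proof.
move=> rc; apply: (@measurable_fun_cvg _ _ _ _ (fun n x => series (term g c (cz x)) n)).
  move=> n; apply: measurable_funTS; rewrite /series /=.
  under eq_fun do rewrite big_mkord.
  apply: measurable_sum => k; apply: measurable_funM; first exact: measurable_cst.
  exact: measurable_coordRe.
move=> x cx; have [r /andP[r0 r1] [xr _]] := cyl_near cx.
have r01 : 0 <= r < 1 by rewrite ltW.
exact: (@psr_cvg _ g _ _ _ (radius_ge1_summable rc r01) xr).
Qed.

Variables (a b : 'I_(2 + m) -> R) (r : R).
Hypothesis ab : forall i, a i < b i.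
Hypothesis r01 : 0 <= r < 1.
Hypothesis br : forall x, cbox a b x -> normc (cz x) <= r.

Lemma obox_cyl : obox a b `<=` @cyl R m.
Proof.
move=> x xab; rewrite /cyl /=; case/andP: r01 => _; apply: le_lt_trans.
by apply: br => i; have /andP[/ltW -> /ltW ->] := xab i.
Qed.

(** Outside the cylinder [psr] may be the [limn] of a divergent series; the bump vanishes off the
    box, which lies in the cylinder, so the product is controlled everywhere. *)
Lemma measurable_series_bump g c k d : radius_ge1 c ->
  measurable_fun setT (fun x => plane_series g c x * bump_box a b k d x).
Proof.
move=> rc; rewrite (_ : (fun x => _) =
    (fun x => plane_series g c x * bump_box a b k d x) \_ (obox a b)); last first.
  apply/funext => x; rewrite patchE; case: ifPn => // /negP xab.
  by rewrite bump_box_out ?mulr0// => h; apply: xab; rewrite inE.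
apply: (@measurable_restrictT _ _ _ _ _ _ (measurable_obox a b)).1.
apply: measurable_funM.
  apply: measurable_funS (measurable_plane_series g rc).
    exact: measurable_cyl.
  exact: obox_cyl.
by apply: measurable_funTS; exact: measurable_bump_prod.
Qed.

Lemma integrable_series_bump g c k d : radius_ge1 c ->
  (lebesgue_rV (2 + m)).-integrable setT
    (EFin \o (fun x => plane_series g c x * bump_box a b k d x)).
Proof.
move=> rc; set f := fun x => _.
have mf : measurable_fun setT f by exact: measurable_series_bump.
have mo := measurable_obox a b.
have fo : f = f \_ (obox a b).
  apply/funext => x; rewrite patchE; case: ifPn => // /negP xab.
  by rewrite /f bump_box_out ?mulr0// => h; apply: xab; rewrite inE.
rewrite fo -restrict_EFin; apply/(integrable_mkcond _ mo).
apply: measurable_bounded_integrable => //; first exact: lebesgue_obox_fin.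
  exact: measurable_funTS.
have [M M0 hM] := psr_bound rc r01.
have : bounded_set (bump_box a b k d @` cbox a b).
  apply: compact_bounded; apply: continuous_compact; last exact: compact_cbox.
  by apply: continuous_subspaceT; exact: continuous_bump_prod.
move=> [B [_ hB]]; exists (normc g * M * (`|B| + 1)); split; first exact: num_real.
move=> t tB x xab; apply: le_trans (ltW tB); rewrite /f normrM.
have xc : cbox a b x by move=> i; have /andP[/ltW -> /ltW ->] := xab i.
apply: ler_pM => //; first by apply: hM; exact: br.
by apply: hB; [rewrite (le_lt_trans (ler_norm _))// ltrDl|exists x].
Qed.


Local Notation N := (1 + m)%N.
Local Notation e0 := ('e_(lshift m 0) : V).
Definition rV_line (y : 'rV[R]_N) (t : R) : V := @rV_cons R N ((t : RR), y).

Lemma rV_lineD y (h t : R) : rV_line y (h *: 1 + t) = h *: e0 + rV_line y t.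
Proof.
apply/rowP => i; rewrite /rV_line.
case: (@split_ordP 1 N i) => j ->.
  have -> : lshift N j = lshift m 0 :> 'I_(2 + m) by apply/val_inj; rewrite /= ord1.
  by rewrite [LHS]rV_cons_head// [RHS]mxE [X in _ = _ + X]rV_cons_head// !mxE !eqxx.
rewrite (@rV_cons_tail _ N _ _ _ j)// [RHS]mxE (@rV_cons_tail _ N _ _ _ j)// !mxE.
have jn : (rshift 1 j == lshift m 0 :> 'I_(2 + m)) = false by [].
by rewrite jn andbF mulr0 add0r.
Qed.

Lemma is_derive_line (f : V -> R) y t df :
  is_derive (rV_line y t) e0 f df -> is_derive t (1 : R) (fun t => f (rV_line y t)) df.
Proof.
move=> [dx ex].
have E : (fun h : R => h^-1 *: (((fun t => f (rV_line y t)) \o shift t) (h *: 1) - f (rV_line y t))) =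
   (fun h => h^-1 *: ((f \o shift (rV_line y t)) (h *: e0) - f (rV_line y t))).
  by apply/funext => h; rewrite /= /shift /= rV_lineD.
apply: DeriveDef; first by rewrite /derivable E.
by rewrite /derive E.
Qed.

Lemma cz_e0 : cz e0 = 1.
Proof. by rewrite /cz !mxE. Qed.

Definition incr0 d : 'I_(2 + m) -> nat := fun j => (d j + (j == lshift m 0%R))%N.

(** On the box, the derivative along [e0] of [plane_series g c] times [bump_box a b k d]; here
    [cz e0 = 1], so g does not change. *)
Definition series_bump_div g c k d x :=
  plane_series g c x * bump_box a b k (incr0 d) x +
  plane_series g (shiftc c) x * bump_box a b k d x.

(** On a line parallel to the first axis that meets the box, the integrand is the derivative of a
    function vanishing at both ends of the side, and it is 0 off the side. On the other lines it is
    0. *)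
Lemma integral_line_series_bump_div g c k d y : radius_ge1 c ->
  (\int[leb]_t (series_bump_div g c k d (rV_line y t))%:E = 0)%E.
Proof.
move=> rc; have rc' := radius_ge1_shift rc.
have [/asboolP yab|/asboolPn nyab] := boolP `[< forall j : 'I_N, a (rshift 1 j) < y 0 j < b (rshift 1 j) >]; last first.
  rewrite (_ : (fun t => _) = cst 0%E) ?integral0//; apply/funext => t /=.
  have nx : ~ obox a b (rV_line y t).
    move=> h; apply: nyab => j; have := h (rshift 1 j).
    by rewrite /rV_line (@rV_cons_tail _ N _ _ _ j).
  by rewrite /series_bump_div !bump_box_out// !mulr0 addr0.
pose a0 := a (lshift m 0); pose b0 := b (lshift m 0).
have ab0 : a0 < b0 := ab _.
have hc t : rV_line y t 0 (lshift m 0) = t by rewrite /rV_line rV_cons_head.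
have inc t : a0 <= t <= b0 -> cbox a b (rV_line y t).
  move=> tab i; case: (@split_ordP 1 N i) => j ->.
    have -> : lshift N j = lshift m 0 :> 'I_(2 + m) by apply/val_inj; rewrite /= ord1.
    by rewrite hc.
  by rewrite /rV_line (@rV_cons_tail _ N _ _ _ j)//; have /andP[/ltW -> /ltW ->] := yab j.
have incyl t : a0 <= t <= b0 -> cyl (rV_line y t).
  by move=> /inc/br h; rewrite /cyl /=; case/andP: r01 => _; exact: le_lt_trans.
have dF c1 t : radius_ge1 c1 -> a0 <= t <= b0 ->
    is_derive t (1 : R) (fun t => plane_series g c1 (rV_line y t))
      (plane_series g (shiftc c1) (rV_line y t)).
  move=> rc1 /incyl cy; have := plane_series_derive g e0 rc1 cy.
  by rewrite cz_e0 mulr1; exact: is_derive_line.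
have dB d1 t : is_derive t (1 : R) (fun t => bump_box a b k d1 (rV_line y t))
    (bump_box a b k (incr0 d1) (rV_line y t)).
  by apply: is_derive_line; exact: bump_prod_derive.
have [F [FE dP]] : exists F : R -> R,
    (forall t, F t = plane_series g c (rV_line y t) * bump_box a b k d (rV_line y t)) /\
    (forall t, a0 <= t <= b0 -> is_derive t (1 : R) F (series_bump_div g c k d (rV_line y t))).
  exists ((fun t => plane_series g c (rV_line y t)) * (fun t => bump_box a b k d (rV_line y t))).
  split=> // t tab; apply: (is_derive_eq (@is_deriveM _ _ _ _ _ _ _ _ (dF c t rc tab) (dB d t))).
  by rewrite /series_bump_div [plane_series _ (shiftc _) _ * _]mulrC.
have der_cont (f : R -> R) t df : is_derive t (1 : R) f df -> {for t, continuous f}.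
  by move=> [h _]; apply/differentiable_continuous/derivable1_diffP.
have cH t : a0 <= t <= b0 -> {for t, continuous (fun t => series_bump_div g c k d (rV_line y t))}.
  move=> tab.
  have c1 := der_cont _ _ _ (dF c t rc tab).
  have c2 := der_cont _ _ _ (dF (shiftc c) t rc' tab).
  have c3 := der_cont _ _ _ (dB d t).
  have c4 := der_cont _ _ _ (dB (incr0 d) t).
  exact: (cvgD (cvgM c1 c4) (cvgM c2 c3)).
have F0 t : t <= a0 \/ b0 <= t -> bump_box a b k d (rV_line y t) = 0 /\
    bump_box a b k (incr0 d) (rV_line y t) = 0.
  move=> tab; have nx : ~ obox a b (rV_line y t).
    move=> /(_ (lshift m 0)); rewrite hc -/a0 -/b0 => /andP[h1 h2].
    by case: tab; rewrite leNgt ?h1 ?h2.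
  by rewrite !bump_box_out.
transitivity (\int[leb]_(t in `[a0, b0]) (series_bump_div g c k d (rV_line y t))%:E)%E.
  rewrite [RHS]integral_mkcond; apply: eq_integral => t _; rewrite patchE.
  case: ifPn => // /negP tab.
  have /F0[h1 h2] : t <= a0 \/ b0 <= t.
    have [|ta] := leP t a0; first by left.
    by right; rewrite leNgt; apply/negP => tb; apply: tab; rewrite inE /= in_itv/= !ltW.
  by rewrite /series_bump_div h1 h2 !mulr0 addr0.
rewrite (@continuous_FTC2 _ _ F _ _ ab0).
- have Fb : F b0 = 0 by rewrite FE (F0 b0 (or_intror (lexx _))).1 mulr0.
  have Fa : F a0 = 0 by rewrite FE (F0 a0 (or_introl (lexx _))).1 mulr0.
  by rewrite Fb Fa -EFinB subrr.
- apply/subspace_continuousP => t; rewrite /= in_itv/= => tab.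
  exact: cvg_within_filter (cH t tab).
- split.
  + move=> t; rewrite in_itv/= => /andP[t1 t2].
    by have [] := dP t; rewrite ?ltW.
  + apply: cvg_at_right_filter; apply: der_cont (dP a0 _); by rewrite lexx ltW.
  + apply: cvg_at_left_filter; apply: der_cont (dP b0 _); by rewrite lexx ltW.
- move=> t; rewrite in_itv/= => /andP[t1 t2]; rewrite derive1E.
  by have [] := dP t; rewrite ?ltW.
Qed.

Lemma integral_series_bump_div g c k d : radius_ge1 c ->
  (\int[lebesgue_rV (2 + m)]_x (series_bump_div g c k d x)%:E = 0)%E.
Proof.
move=> rc; have rc' := radius_ge1_shift rc.
have i1 := integrable_series_bump g k (incr0 d) rc.
have i2 := integrable_series_bump g k d rc'.
have iH : (lebesgue_rV (2 + m)).-integrable setT (EFin \o series_bump_div g c k d).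
  exact: (integrableD measurableT i1 i2).
have mH := measurable_int _ iH.
have mc := @measurable_rV_cons R N.
have iHp : (leb \x lebesgue_rV N)%E.-integrable setT ((EFin \o series_bump_div g c k d) \o @rV_cons R N).
  apply/integrableP; split; first exact: measurableT_comp.
  have /integrableP[_] := iH.
  rewrite (@ge0_integral_pushforward _ _ _ _ _ _ mc (leb \x lebesgue_rV N)%E setT) ?preimage_setT//.
  exact: measurableT_comp.
transitivity (\int[pushforward (leb \x lebesgue_rV N)%E (@rV_cons R N)]_x (series_bump_div g c k d x)%:E)%E.
  by [].
rewrite (@integral_pushforward _ _ _ _ _ _ mc (leb \x lebesgue_rV N)%E setT (EFin \o series_bump_div g c k d))//.
rewrite preimage_setT -integral21_prod_meas1//.
rewrite (eq_integral (cst 0%E)) ?integral0// => y _.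
exact: integral_line_series_bump_div.
Qed.

Lemma Rintegral_series_bump (U : set V) g c k d : radius_ge1 c -> obox a b `<=` U ->
  \int[lebesgue_rV (2 + m)]_(x in U) (plane_series g c x * bump_box a b k (incr0 d) x) =
  - \int[lebesgue_rV (2 + m)]_(x in U) (plane_series g (shiftc c) x * bump_box a b k d x).
Proof.
move=> rc abU; have rc' := radius_ge1_shift rc.
have full c1 d1 : (\int[lebesgue_rV (2 + m)]_(x in U) (plane_series g c1 x * bump_box a b k d1 x)%:E =
    \int[lebesgue_rV (2 + m)]_x (plane_series g c1 x * bump_box a b k d1 x)%:E)%E.
  rewrite integral_mkcond; apply: eq_integral => x _; rewrite patchE.
  case: ifPn => // /negP xU; rewrite bump_box_out ?mulr0// => xab.
  by apply: xU; rewrite inE; exact: abU.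
rewrite /Rintegral !full.
have i1 := integrable_series_bump g k (incr0 d) rc.
have i2 := integrable_series_bump g k d rc'.
have := integral_series_bump_div g k d rc.
under eq_integral do rewrite EFinD.
rewrite integralD// => /eqP.
have f1 := integrable_fin_num measurableT i1.
have f2 := integrable_fin_num measurableT i2.
rewrite -[X in (X + _)%E]fineK// -[X in (_ + X)%E]fineK// -EFinD eqe addr_eq0.
by move=> /eqP.
Qed.

End integration_by_parts.

(** * Functions with vanishing integrals over boxes *)

Section boxes_determine_functions.
Context {R : realType} {n : nat}.
Local Notation RR := (measurableTypeR R).
Local Notation mu := (@lebesgue_rV R n).

(** A pi-system that generates the Borel sets. Its members meet [obox a b] in a box with the same
    upper corner b or in the empty set, so only lower corners vary. *)
Definition rays : set (set 'rV[R]_n) :=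
  [set A | exists c : 'I_n -> \bar R, A = [set x : 'rV[R]_n | forall i, (c i < (x 0 i)%:E)%E]].

Lemma setI_closed_rays : setI_closed rays.
Proof.
move=> _ _ [c ->] [d ->]; exists (fun i => maxe (c i) (d i)).
apply/seteqP; split => x /=.
  by move=> [h1 h2] i; rewrite gt_max h1 h2.
by move=> h; split => i; have := h i; rewrite gt_max => /andP[].
Qed.

Lemma measurable_rays A : rays A -> measurable A.
Proof.
move=> [c ->]; rewrite (_ : mkset _ = \bigcap_(i in [set: 'I_n])
    ((fun x : 'rV[R]_n => x 0 i : RR) @^-1` [set t : RR | (c i < (t : R)%:E)%E])); last first.
  by apply/seteqP; split => x /= h i; [move=> _; exact: h|exact: h].
apply: fin_bigcap_measurable => // i _.
rewrite -[X in measurable X]setTI; apply: measurable_coord => //.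
case: (c i) => [r| |].
- rewrite (_ : mkset _ = `]r, +oo[%classic); first exact: measurable_itv.
  by apply/seteqP; split => t /=; rewrite in_itv/= lte_fin andbT.
- rewrite (_ : mkset _ = set0); first exact: measurable0.
  by apply/seteqP; split => t //=; rewrite ltNge leey.
- rewrite (_ : mkset _ = setT); first exact: measurableT.
  by apply/seteqP; split => t //= _; rewrite ltNyr.
Qed.

Lemma measurable_raysE : @measurable _ 'rV[R]_n = <<s rays >>.
Proof.
apply/seteqP; split; last first.
  apply: smallest_sub; first exact: sigma_algebra_measurable.
  exact: measurable_rays.
apply: smallest_sub; first exact: smallest_sigma_algebra.
move=> A; rewrite -bigcup_seq /= => -[i _ [B mB <-]].
pose f : g_sigma_algebraType rays -> RR := fun x => (x : 'rV[R]_n) 0 i.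
suff mf : measurable_fun setT f by exact: mf.
apply: (measurability _ (RGenOInfty.measurableE R)).
move=> _ [_ [r ->] <-]; rewrite setTI; apply: sub_sigma_algebra.
exists (fun j => if j == i then r%:E else -oo%E).
apply/seteqP; split => x /=; rewrite in_itv/= andbT.
  by move=> h j; case: eqP => [->|_]; rewrite ?lte_fin ?ltNyr.
by move=> /(_ i); rewrite eqxx lte_fin.
Qed.

Definition ray_max (c : \bar R) (a : R) : R := if c is r%:E then Num.max r a else a.

Lemma ray_maxP (c : \bar R) (a b t : R) : (c < b%:E)%E ->
  (c < t%:E)%E && (a < t < b) = (ray_max c a < t < b).
Proof.
case: c => [r| |] //= cb; first by rewrite lte_fin gt_max andbA.
by rewrite ltNyr.
Qed.

Lemma ray_max_itv (c : \bar R) (a b : R) : (c < b%:E)%E -> a < b ->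
  a <= ray_max c a < b.
Proof.
case: c => [r| |] //= cb ab; last by rewrite lexx.
by rewrite le_max lexx orbT gt_max ab andbT -lte_fin.
Qed.

(** The sets S for which h has integral 0 over the part of S in the box form a Dynkin system
    containing [rays], hence include all Borel sets. *)
Lemma obox_ae_eq0 (a b : 'I_n -> R) (h : 'rV[R]_n -> R) :
  mu.-integrable (obox a b) (EFin \o h) ->
  (forall a', (forall i, a i <= a' i < b i) ->
    (\int[mu]_(x in obox a' b) (h x)%:E = 0)%E) ->
  ae_eq mu (obox a b) (EFin \o h) (cst 0%E).
Proof.
move=> ih h0.
have mO := measurable_obox a b.
have [ab|nab] := pselect (forall i, a i < b i); last first.
  have -> : obox a b = set0.
    apply/seteqP; split => x // xab; apply: nab => i.
    by have /andP[] := xab i; exact: lt_trans.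
  exact: aeW.
have hs (E : set 'rV[R]_n) : measurable E -> mu.-integrable (E `&` obox a b) (EFin \o h).
  move=> mE; apply: integrableS ih => //; exact: measurableI.
have key : forall S, <<s rays >> S -> (\int[mu]_(x in S `&` obox a b) (h x)%:E = 0)%E.
  apply: (@dynkin_induction _ _ rays (fun S => (\int[mu]_(x in S `&` obox a b) (h x)%:E = 0)%E)).
  - exact: measurable_raysE.
  - exact: setI_closed_rays.
  - by rewrite setTI; apply: h0 => i; rewrite lexx ab.
  - move=> _ [c ->].
    have [cb|ncb] := pselect (forall i, (c i < (b i)%:E)%E); last first.
      have -> : [set x : 'rV[R]_n | forall i, (c i < (x 0 i)%:E)%E] `&` obox a b = set0.
        apply/seteqP; split => x // -[/= xc xab]; apply: ncb => i.
        by apply: lt_trans (xc i) _; rewrite lte_fin; have /andP[] := xab i.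
      by rewrite integral_set0.
    have -> : [set x : 'rV[R]_n | forall i, (c i < (x 0 i)%:E)%E] `&` obox a b =
        obox (fun i => ray_max (c i) (a i)) b.
      apply/seteqP; split => x /=.
        by move=> [xc xab] i; rewrite -ray_maxP// xc xab.
      by move=> h1; split => i; have := h1 i; rewrite -ray_maxP// => /andP[].
    by apply: h0 => i; exact: ray_max_itv.
  - move=> S mS PS; have hO := h0 a (fun i => introT andP (conj (lexx _) (ab i))).
    have OE : obox a b = (S `&` obox a b) `|` (~` S `&` obox a b).
      by rewrite -setIUl setUv setTI.
    have m1 : measurable (S `&` obox a b) by exact: measurableI.
    have m2 : measurable (~` S `&` obox a b) by apply: measurableI => //; exact: measurableC.
    move: hO; rewrite [in X in X -> _]OE integral_setU//.
    + by rewrite PS add0e.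
    + by rewrite -OE; exact: measurable_int ih.
    + by apply/disj_setPS => x [[Sx _] [nSx _]].
  - move=> F mF tF PF; rewrite setI_bigcupl integral_bigcup//.
    + by rewrite eseries0// => i _ _; exact: PF.
    + by apply: trivIset_setIr.
    + by move=> k; apply: measurableI.
    + by rewrite -setI_bigcupl; apply: hs; exact: bigcupT_measurable.
apply: integral_ae_eq => // E EO mE; rewrite integral0.
by rewrite -[in LHS](setIidl EO); apply: key; rewrite -measurable_raysE.
Qed.

End boxes_determine_functions.

(** * Weak derivatives of the series agree with the classical ones *)

Section weak_partials_of_series.
Context {R : realType} {m : nat}.
Local Notation V := 'rV[R]_(2 + m).
Local Notation mu := (@lebesgue_rV R (2 + m)).
Implicit Types (c : nat -> R) (g : R[i]) (x : V).

Lemma radius_ge1_iter p c : radius_ge1 c -> radius_ge1 (iter p shiftc c).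
Proof. by move=> rc; elim: p => //= p; exact: radius_ge1_shift. Qed.

Variables (U : set V) (g : R[i]) (c : nat -> R) (v : V -> R) (p : nat).
Hypotheses (mU : measurable U) (rc : radius_ge1 c) (sv : square_integrable U v).
Hypothesis wv : weak_partial (nseq p (lshift m 0)) U (plane_series g c) v.

Local Notation f := (plane_series g (iter p shiftc c)).

Section one_box.
Variables (a b : 'I_(2 + m) -> R) (r : R).
Hypothesis ab : forall i, a i < b i.
Hypothesis r01 : 0 <= r < 1.
Hypothesis br : forall x, cbox a b x -> normc (cz x) <= r.
Hypothesis abU : cbox a b `<=` U.

Let oU : obox a b `<=` U.
Proof. by move=> x h; apply: abU => i; have /andP[/ltW -> /ltW ->] := h i. Qed.

Lemma Rintegral_series_bump_iter c1 k d q : radius_ge1 c1 ->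
  \int[mu]_(x in U) (plane_series g c1 x * bump_box a b k (iter q incr0 d) x) =
  (-1) ^+ q * \int[mu]_(x in U) (plane_series g (iter q shiftc c1) x * bump_box a b k d x).
Proof.
elim: q c1 => [|q IH] c1 rc1; first by rewrite mul1r.
rewrite (Rintegral_series_bump ab r01 br)// IH; last exact: radius_ge1_shift.
by rewrite exprS mulN1r mulNr -iterSr.
Qed.

(** The definition of v is tested on a bump; the p derivatives are then moved from the bump to the
    series, and the signs (-1)^p cancel. *)
Lemma weak_partial_bump k :
  \int[mu]_(x in U) (v x * bump_box a b k (fun=> 0%N) x) =
  \int[mu]_(x in U) (f x * bump_box a b k (fun=> 0%N) x).
Proof.
have E : partial (nseq p (lshift m 0)) (bump_box a b k (fun=> 0%N)) =
    bump_box a b k (iter p incr0 (fun=> 0%N)).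
  rewrite partial_bump_prod; apply: bump_prodE => j; rewrite add0n.
  by elim: (p) => //= q IH; rewrite IH addnC eq_sym.
have := wv (test_function_bump_box ab k (fun=> 0%N) abU).
rewrite E size_nseq Rintegral_series_bump_iter//.
by move=> H; apply/esym; apply: (mulfI _ H); rewrite signr_eq0.
Qed.

(** The box has finite measure and |v| <= 1 + v^2. *)
Lemma integrable_square_integrable : mu.-integrable (obox a b) (EFin \o v).
Proof.
have [mv iv] := sv; have mO := measurable_obox a b.
have i1 : mu.-integrable (obox a b) (EFin \o (fun=> 1 : R)).
  apply: measurable_bounded_integrable => //; first exact: lebesgue_obox_fin.
  exact: bounded_cst.
have i2 : mu.-integrable (obox a b) (fun x => (v x ^+ 2)%:E) by exact: integrableS iv.
have i3 := integrableD mO i1 i2.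
apply: le_integrable i3 => //.
  by apply/measurable_EFinP; exact: measurable_funS mv.
move=> x _ /=; rewrite lee_fin [leRHS]ger0_norm ?addr_ge0 ?sqr_ge0//.
rewrite -[v x ^+ 2]real_normK ?num_real//; nra.
Qed.

Lemma integrable_series_box : mu.-integrable (obox a b) (EFin \o f).
Proof.
have mO := measurable_obox a b; have rcp := radius_ge1_iter p rc.
apply: measurable_bounded_integrable => //; first exact: lebesgue_obox_fin.
  apply: measurable_funS (measurable_plane_series g rcp); first exact: measurable_cyl.
  exact: obox_cyl r01 br.
have [M M0 hM] := psr_bound rcp r01.
exists (normc g * M); split; first exact: num_real.
move=> t tB x xab; apply: le_trans (ltW tB); apply: hM; apply: br => i.
by have /andP[/ltW -> /ltW ->] := xab i.
Qed.

(** The bumps take values in [0, 1] and tend to the indicator of the box, so dominated convergence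
    applies with bound |v - f|. *)
Lemma integral_weak_partial_box : (\int[mu]_(x in obox a b) (v x - f x)%:E = 0)%E.
Proof.
have mO := measurable_obox a b.
have rcp := radius_ge1_iter p rc.
have iv := integrable_square_integrable.
have iff := integrable_series_box.
have ih : mu.-integrable (obox a b) (EFin \o (fun x => v x - f x)) by exact: integrableB iv iff.
pose phi k := bump_box a b k (fun=> 0%N).
have mphi k : measurable_fun (obox a b) (phi k).
  by apply: measurable_funTS; exact: measurable_bump_prod.
have phi01 k x : `|phi k x| <= 1.
  by have /andP[h0 h1] := bump_box0_itv a b k x; rewrite ger0_norm.
have iphi (h : V -> R) k : mu.-integrable (obox a b) (EFin \o h) ->
    mu.-integrable (obox a b) (EFin \o (fun x => h x * phi k x)).
  move=> ihh; apply: (le_integrable mO _ _ ihh).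
    apply/measurable_EFinP; apply: measurable_funM => //.
    by apply/measurable_EFinP; exact: measurable_int ihh.
  by move=> x _ /=; rewrite lee_fin normrM -[leRHS]mulr1 ler_wpM2l.
have toO (h : V -> R) k : (\int[mu]_(x in U) (h x * phi k x)%:E =
    \int[mu]_(x in obox a b) (h x * phi k x)%:E)%E.
  rewrite integral_mkcond [RHS]integral_mkcond; apply: eq_integral => x _; rewrite !patchE.
  case: ifPn => xU; case: ifPn => xO //.
    by rewrite /phi bump_box_out ?mulr0// => h1; move/negP: xO; apply; rewrite inE.
  by move: xU; rewrite inE in xO; rewrite mem_set//; exact: oU.
have zero k : (\int[mu]_(x in obox a b) ((v x - f x) * phi k x)%:E = 0)%E.
  under eq_integral do rewrite mulrBl EFinB.
  rewrite integralB//; [|exact: iphi|exact: iphi].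
  have H := weak_partial_bump k; rewrite /Rintegral -/(phi k) !toO in H.
  have fv := integrable_fin_num mO (iphi _ k iv).
  have ff := integrable_fin_num mO (iphi _ k iff).
  have HE : (\int[mu]_(x in obox a b) (v x * phi k x)%:E =
      \int[mu]_(x in obox a b) (f x * phi k x)%:E)%E by rewrite -[LHS]fineK// -[RHS]fineK// H.
  by rewrite HE subee.
have cvgphi : {ae mu, forall x, obox a b x ->
    (fun k => ((v x - f x) * phi k x)%:E) @ \oo --> (v x - f x)%:E}.
  apply: aeW => x xO; apply: cvg_EFin; first exact: nearW.
  have := @cvgMl_tmp _ _ _ _ _ (v x - f x) _ (@cvg_bump_box _ _ _ _ ab x).
  by rewrite indicE mem_set// mulr1; apply.
have domphi : {ae mu, forall x k, obox a b x ->
    (`|((v x - f x) * phi k x)%:E| <= `|(v x - f x)%:E|)%E}.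
  by apply: aeW => x k xO; rewrite !abse_EFin lee_fin normrM -[leRHS]mulr1 ler_wpM2l.
have [_ _ H] := dominated_convergence mO (fun k => measurable_int _ (iphi _ k ih))
   (measurable_int _ ih) cvgphi (integrable_abse ih) domphi.
have H0 : (cst 0%E : nat -> \bar R) @ \oo --> (\int[mu]_(x in obox a b) (v x - f x)%:E)%E.
  by rewrite (_ : cst 0%E = (fun n => \int[mu]_(x in obox a b) ((v x - f x) * phi n x)%:E)%E)//;
    apply/funext => k; rewrite zero.
exact: (cvg_unique _ H0 (cvg_cst _)).
Qed.

End one_box.

Lemma ae_weak_partial_box (a b : 'I_(2 + m) -> R) (r : R) :
  (forall i, a i < b i) -> 0 <= r < 1 -> (forall x, cbox a b x -> normc (cz x) <= r) ->
  cbox a b `<=` U -> ae_eq mu (obox a b) (EFin \o v) (EFin \o f).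
Proof.
move=> ab r01 br abU.
have mO := measurable_obox a b.
have rcp := radius_ge1_iter p rc.
have iv := integrable_square_integrable ab abU.
have iff := integrable_series_box ab r01 br.
have ih : mu.-integrable (obox a b) (EFin \o (fun x => v x - f x)) by exact: integrableB iv iff.
suff : ae_eq mu (obox a b) (EFin \o (fun x => v x - f x)) (cst 0%E).
  apply: filterS => x /= h xO; have [/eqP] := h xO.
  by rewrite subr_eq0 => /eqP ->.
apply: (obox_ae_eq0 ih) => a' aa'.
have sub : cbox a' b `<=` cbox a b.
  move=> x xa' i; have /andP[h1 ->] := xa' i; have /andP[h2 _] := aa' i.
  by rewrite (le_trans h2 h1).
have a'b i : a' i < b i by have /andP[] := aa' i.
apply: (integral_weak_partial_box a'b r01).
- by move=> x /sub; exact: br.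
- exact: subset_trans abU.
Qed.

(** Lower (e = -1) and upper (e = 1) corner of the cube with rational centre q and half side
    1/(k+1). *)
Definition rat_box (q : 'rV[rat]_(2 + m)) (k : nat) (e : R) : 'I_(2 + m) -> R :=
  fun i => ratr (q 0 i) + e / k.+1%:R.

(** Q is covered by countably many rational cubes whose closures lie in Q and in some |z| <= r < 1;
    on each of them the exceptional set is null. *)
Lemma negligible_weak_partial (Q : set V) : open Q -> Q `<=` U -> Q `<=` @cyl R m ->
  mu.-negligible [set x | Q x /\ v x <> f x].
Proof.
move=> oQ QU Qc.
pose good q k := exists2 r, 0 <= r < 1 &
  forall x, cbox (rat_box q k (-1)) (rat_box q k 1) x -> normc (cz x) <= r /\ Q x.
pose N q k := obox (rat_box q k (-1)) (rat_box q k 1) `&` [set x | v x <> f x].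
pose F j := if unpickle j is Some (q, k) then
  if `[< good q k >] then N q k else set0 else set0.
have Fneg j : mu.-negligible (F j).
  rewrite /F; case: unpickle => [[q k]|]; last exact: negligible_set0.
  case: ifPn => [/asboolP[r r01 hr]|_]; last exact: negligible_set0.
  have ab i : rat_box q k (-1) i < rat_box q k 1 i.
    by rewrite /rat_box ltrD2l ltr_pM2r ?invr_gt0//; lra.
  have := @ae_weak_partial_box _ _ r ab r01 (fun x h => (hr x h).1) (fun x h => QU _ (hr x h).2).
  apply: negligibleS => x /= [xO nvf] h; apply: nvf.
  by have [] := h xO.
apply: negligibleS (negligible_bigcup Fneg) => x [Qx vf].
have [r /andP[r0 r1] [xr nr]] := cyl_near (Qc _ Qx).
have : \forall y \near x, normc (cz y) <= r /\ Q y.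
  by near=> y; split; near: y => //; exact: oQ.
move=> /nbhs_ballP[e /= e0 he].
(* The factor 2 is needed because x is only within 1/(k+1) of the rational centre, and the cube
   extends by another 1/(k+1). *)
have [k hk] : exists k : nat, 2 / k.+1%:R < e.
  exists (Num.bound (2 / e)); rewrite ltr_pdivrMr// mulrC -ltr_pdivrMr//.
  apply: lt_trans (archi_boundP _) _; first by rewrite divr_ge0// ltW.
  by rewrite ltr_nat.
have [t t0 tE] : exists2 t : R, 0 < t & k.+1%:R^-1 = t.
  by exists k.+1%:R^-1; rewrite // invr_gt0.
rewrite tE in hk.
have /choice[q hq] : forall i, exists q : rat, x 0 i - t < ratr q < x 0 i + t.
  move=> i; have /rat_in_itvoo[q] : x 0 i - t < x 0 i + t by lra.
  by rewrite in_itv/= => qi; exists q.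
pose Q0 : 'rV[rat]_(2 + m) := \row_i q i.
exists (pickle (Q0, k)) => //; rewrite /F pickleK.
have gd : good Q0 k.
  exists r; first by rewrite ltW.
  move=> y hy; apply: he; rewrite -ball_normE /=.
  rewrite -[`|_|]/(mx_norm _) mx_normrE; apply: bigmax_lt => // -[z i] _ /=.
  rewrite ord1 !mxE; have := hy i; rewrite /rat_box mxE tE => /andP[y1 y2].
  have /andP[q1 q2] := hq i; rewrite ltr_norml; apply/andP; split; lra.
rewrite asboolT//; split => // i; rewrite /rat_box mxE tE.
by have /andP[q1 q2] := hq i; apply/andP; split; lra.
Unshelve. all: by end_near. Qed.

End weak_partials_of_series.

(** * Roots of unity of order 2^p and orthogonality of characters *)

Section dyadic_roots_of_unity.
Context {R : realType}.
Implicit Types (x : R) (p d k l : nat) (z : R[i]).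

Definition expi x : R[i] := Complex (cos x) (sin x).

Lemma expiD x y : expi (x + y) = expi x * expi y.
Proof. by rewrite /expi cosD sinD [in RHS]/GRing.mul /= [sin x * cos y + _]addrC. Qed.

Lemma expiX x k : expi x ^+ k = expi (x *+ k).
Proof.
elim: k => [|k IH]; first by rewrite expr0 mulr0n /expi cos0 sin0.
by rewrite exprS IH mulrS expiD.
Qed.

Definition omg p : R[i] := expi (pi *+ 2 / 2 ^+ p).

Lemma omg_half p : omg p.+1 ^+ (2 ^ p) = -1.
Proof.
rewrite /omg expiX (_ : _ *+ (2 ^ p) = pi).
  by rewrite /expi cospi sinpi; apply/eqP; rewrite eq_complex /= oppr0 !eqxx.
rewrite -[LHS]mulr_natr natrX exprS -mulr_natr.
by field; rewrite expf_neq0.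
Qed.

Lemma omg_pow2 p : omg p ^+ (2 ^ p) = 1.
Proof.
case: p => [|p]; last by rewrite expnS mulnC exprM omg_half sqrrN expr1n.
by rewrite /omg expr0 divr1 expiX expn0 mulr1n /expi cos2pi sin2pi.
Qed.

(** Write d = 2^e d' with d' odd and e < p. Raised to the power 2^(p-1-e), omega^d becomes (-1)^d' =
    -1. *)
Lemma omg_neq1 p d : ~~ (2 ^ p %| d)%N -> omg p ^+ d != 1.
Proof.
have [->|d0] := posnP d; first by rewrite dvdn0.
rewrite pfactor_dvdn// -ltnNge => lp.
set e := logn 2 d in lp.
have [d' od' dE] := @pfactor_coprime 2 d isT d0.
case: p lp => // p; rewrite ltnS => ep; apply/eqP => w1.
have : omg p.+1 ^+ (d * 2 ^ (p - e)) = -1.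
  rewrite dE -mulnA -expnD -/e subnKC// mulnC exprM omg_half.
  by rewrite -signr_odd (_ : odd d' = true) ?expr1//; move: od'; rewrite coprime2n.
rewrite exprM w1 expr1n => /eqP; rewrite -subr_eq0 opprK.
by rewrite -[1 + 1]/(2%:R) pnatr_eq0.
Qed.

Lemma normc_expi x : normc (expi x) = 1.
Proof. by rewrite /normc /expi cos2Dsin2 sqrtr1. Qed.

Lemma sum_omg p d : ~~ (2 ^ p %| d)%N -> \sum_(l < 2 ^ p) (omg p ^+ d) ^+ l = 0.
Proof.
move=> nd; have h := omg_neq1 nd.
have := subrX1 (omg p ^+ d) (2 ^ p); rewrite exprAC omg_pow2 expr1n subrr.
by move=> /esym/eqP; rewrite mulf_eq0 subr_eq0 (negbTE h) => /eqP.
Qed.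

Lemma sin_le_id x : 0 <= x -> `|sin x| <= x.
Proof.
move=> x0.
have cs : {within `[0, x], continuous (@sin R)}.
  by apply: continuous_subspaceT; exact: continuous_sin.
have [c _] := MVT_segment x0 (fun y _ => is_derive_sin y) cs.
rewrite sin0 !subr0 => ->; rewrite normrM (ger0_norm x0) -[leRHS]mul1r.
by rewrite ler_wpM2r// cos_max.
Qed.

(** The modulus equals 2 |sin(x/2)|. *)
Lemma normc_expi_sub1 x : 0 <= x -> normc (expi x - 1) <= x.
Proof.
move=> x0; have x2 : 0 <= x / 2 by rewrite divr_ge0.
have h := sin_le_id x2.
rewrite -[leRHS]ger0_norm// -[leRHS]sqrtr_sqr -[normc _]ger0_norm ?normc_ge0// -sqrtr_sqr.
apply: ler_wsqrtr; rewrite normc_sqr /= oppr0 addr0.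
have -> : x = x / 2 + x / 2 by lra.
rewrite cosD sinD.
have e := cos2Dsin2 (x / 2).
have s2 : sin (x / 2) ^+ 2 <= (x / 2) ^+ 2.
  by rewrite -[leLHS]real_normK ?num_real//; exact: lerX2.
set C := cos (x / 2) in e *; set S := sin (x / 2) in e s2 *.
have -> : (C * C - S * S - 1) ^+ 2 + (S * C + C * S) ^+ 2 = (C ^+ 2 - S ^+ 2 - 1) ^+ 2 + 4 * S ^+ 2 * C ^+ 2.
  by ring.
have -> : C ^+ 2 = 1 - S ^+ 2 by rewrite -e addrK.
have -> : (1 - S ^+ 2 - S ^+ 2 - 1) ^+ 2 + 4 * S ^+ 2 * (1 - S ^+ 2) = 4 * S ^+ 2 by ring.
lra.
Qed.

Lemma omg_angle p : 0 <= (pi *+ 2 / 2 ^+ p : R) <= 8 / 2 ^+ p.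
Proof.
have p2 : 0 <= pi :> R := pi_ge0 R.
have p4 : pi / 2 < 2 :> R := pihalf_lt2 R.
apply/andP; split.
  by apply: divr_ge0; [exact: mulrn_wge0|exact: exprn_ge0].
apply: ler_wpM2r; first by rewrite invr_ge0 exprn_ge0.
by rewrite -mulr_natr; lra.
Qed.

Lemma normc_omg_sub1 p : normc (omg p - 1) <= 8 / 2 ^+ p.
Proof.
by have /andP[h1 h2] := omg_angle p; exact: le_trans (normc_expi_sub1 h1) h2.
Qed.

Lemma Re_real_complex x : (complex.Re (x%:C%C)) = x. Proof. by []. Qed.

Lemma Re_half z : (complex.Re z)%:C%C = (z + z^*%C) / 2%:R.
Proof. exact: ReJ_add. Qed.

Lemma omgJ p : omg p * (omg p)^*%C = 1.
Proof.
by rewrite /omg /expi -sqr_normc normc_def /= cos2Dsin2 sqrtr1 expr1n.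
Qed.

(* The discrete Fourier coefficient of order k of l |-> Re (omega^(l k') z):
   the two terms come from Re w = (w + conj w) / 2. *)
Lemma fourier_term p k k' z :
  \sum_(l < 2 ^ p) ((omg p)^*%C ^+ k) ^+ l * (complex.Re ((omg p ^+ l) ^+ k' * z))%:C%C =
  2^-1 * (z * \sum_(l < 2 ^ p) ((omg p)^*%C ^+ k * omg p ^+ k') ^+ l +
          z^*%C * \sum_(l < 2 ^ p) ((omg p)^*%C ^+ (k + k')) ^+ l).
Proof.
rewrite !mulr_sumr -big_split mulr_sumr; apply: eq_bigr => l _ /=.
rewrite Re_half !rmorphM /= !rmorphXn /= exprMn_comm; last exact: mulrC.
rewrite exprD exprMn_comm; last exact: mulrC.
rewrite [(omg p ^+ l) ^+ k']exprAC [((omg p)^*%C ^+ l) ^+ k']exprAC.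
by field.
Qed.

Lemma sum_conj_omg p d : ~~ (2 ^ p %| d)%N -> \sum_(l < 2 ^ p) ((omg p)^*%C ^+ d) ^+ l = 0.
Proof.
move=> nd; have := congr1 conjc (sum_omg nd); rewrite conjc0 rmorph_sum /= => H.
by rewrite -[RHS]H; apply: eq_bigr => l _; rewrite !rmorphXn.
Qed.

(** Orthogonality of distinct characters; it is stated once for each sign of k' - k because
    subtraction on [nat] is truncated. *)
Lemma sum_conj_omg_omg p k k' : (k <= k')%N -> ~~ (2 ^ p %| (k' - k))%N ->
  \sum_(l < 2 ^ p) ((omg p)^*%C ^+ k * omg p ^+ k') ^+ l = 0.
Proof.
move=> kk nd; rewrite -[RHS](sum_omg nd); apply: eq_bigr => l _; congr (_ ^+ _).
by rewrite -{1}(subnKC kk) exprD mulrA -exprMn_comm ?[_^*%C * _]mulrC ?omgJ ?expr1n ?mul1r//; exact: mulrC.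
Qed.

Lemma sum_conj_omg_omg' p k k' : (k' <= k)%N -> ~~ (2 ^ p %| (k - k'))%N ->
  \sum_(l < 2 ^ p) ((omg p)^*%C ^+ k * omg p ^+ k') ^+ l = 0.
Proof.
move=> kk nd; rewrite -[RHS](sum_conj_omg nd); apply: eq_bigr => l _; congr (_ ^+ _).
by rewrite -{1}(subnK kk) exprD -mulrA -exprMn_comm ?[_^*%C * _]mulrC ?omgJ ?expr1n ?mulr1//; exact: mulrC.
Qed.

Lemma sum_conj_omg_omg_diag p k :
  \sum_(l < 2 ^ p) ((omg p)^*%C ^+ k * omg p ^+ k) ^+ l = (2 ^ p)%:R.
Proof.
have -> : (omg p)^*%C ^+ k * omg p ^+ k = 1.
  by rewrite -exprMn_comm ?[_^*%C * _]mulrC ?omgJ ?expr1n//; exact: mulrC.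
by under eq_bigr => l _ do rewrite expr1n; rewrite sumr_const card_ord.
Qed.

End dyadic_roots_of_unity.

(** * Isolating one frequency of the lacunary series *)

Section lacunary_fourier.
Context {R : realType}.
Implicit Types (alpha : R) (z : R[i]) (i j k q : nat).

Lemma iter_shiftcE (c : nat -> R) q k : iter q shiftc c k = ((k + q) ^_ q)%:R * c (k + q)%N.
Proof.
elim: q k => [|q IH] k; first by rewrite addn0 ffactn0 mul1r.
rewrite iterS /shiftc IH addSnnS mulrA -natrM ffactnSr mulnC.
by rewrite (_ : k + q.+1 - q = k.+1)%N//; lia.
Qed.

(** Coefficients of the q-th derivative; they vanish unless k = 2^i - q for some i >= 1. *)
Definition dcoef alpha q : nat -> R := iter q shiftc (lacunary_coef alpha).

Lemma radius_ge1_dcoef alpha q : 0 <= alpha -> radius_ge1 (dcoef alpha q).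
Proof. by move=> a0; exact: radius_ge1_iter (radius_ge1_lacunary a0). Qed.

Lemma dcoef_eq0 alpha q k : (forall i, (0 < i)%N -> (k + q)%N != (2 ^ i)%N) -> dcoef alpha q k = 0.
Proof. by move=> h; rewrite /dcoef iter_shiftcE lacunary_coef_eq0 ?mulr0. Qed.

Lemma ndvdn_lt d n : (0 < n < d)%N -> ~~ (d %| n)%N.
Proof. by move=> /andP[n0 nd]; apply/negP => /(dvdn_leq n0); rewrite leqNgt nd. Qed.

Lemma ndvdn_pow2_sub i j : (i < j)%N -> ~~ (2 ^ j.+2 %| 2 ^ j - 2 ^ i)%N.
Proof.
move=> ij; apply: ndvdn_lt; rewrite subn_gt0 ltn_exp2l// ij /=.
by apply: leq_ltn_trans (leq_subr _ _) _; rewrite ltn_exp2l.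
Qed.

(** Already 2^(j+1) fails to divide the difference: it divides 2^i but not 2^j. *)
Lemma ndvdn_pow2_sub' i j : (j < i)%N -> ~~ (2 ^ j.+2 %| 2 ^ i - 2 ^ j)%N.
Proof.
move=> ji; apply/negP => d.
have d1 : (2 ^ j.+1 %| 2 ^ i - 2 ^ j)%N by apply: dvdn_trans d; rewrite dvdn_exp2l.
have d2 : (2 ^ j.+1 %| 2 ^ i)%N by rewrite dvdn_exp2l.
move: d1; rewrite dvdn_subr// ?leq_exp2l ?(ltnW ji)//; apply/negP.
by apply: ndvdn_lt; rewrite expn_gt0 /= ltn_exp2l.
Qed.

(** The number is the sum of the frequencies 2^i - q and 2^j - q. For i <= j it lies strictly
    between 0 and 2^(j+2). For i > j it is congruent modulo 2^(j+1) to 2^j - 2q, which lies strictly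
    between 0 and 2^(j+1). *)
Lemma ndvdn_pow2_add i j q : (q <= 2)%N -> (3 <= j)%N -> (0 < i)%N ->
  ~~ (2 ^ j.+2 %| 2 ^ i + 2 ^ j - q.*2)%N.
Proof.
move=> q2 j3 i0.
have j8 : (8 <= 2 ^ j)%N by rewrite (@leq_exp2l 2 3 j).
have i2 : (2 <= 2 ^ i)%N by rewrite (@leq_exp2l 2 1 i).
have q4 : (q.*2 <= 4)%N by rewrite (@leq_double q 2).
have [ij|ji] := leqP i j.
  apply: ndvdn_lt; rewrite !expnS.
  have : (2 ^ i <= 2 ^ j)%N by rewrite leq_exp2l.
  by move: (2 ^ i)%N (2 ^ j)%N (q.*2) i2 j8 q4 => a b c; lia.
apply/negP => d.
have d1 : (2 ^ j.+1 %| 2 ^ i + 2 ^ j - q.*2)%N by apply: dvdn_trans d; rewrite dvdn_exp2l.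
have d2 : (2 ^ j.+1 %| 2 ^ i)%N by rewrite dvdn_exp2l.
have E : (2 ^ i + 2 ^ j - q.*2 = 2 ^ i + (2 ^ j - q.*2))%N.
  by move: (2 ^ i)%N (2 ^ j)%N (q.*2) i2 j8 q4 => a b c; lia.
move: d1; rewrite E dvdn_addr//; apply/negP; apply: ndvdn_lt; rewrite expnS.
by move: (2 ^ j)%N (q.*2) j8 q4 => b c; lia.
Qed.

(** Modulo 2^(j+2), no other frequency 2^i - q coincides with 2^j - q, and no conjugate frequency
    does. The factor 1/2 comes from taking real parts. *)
Lemma fourier_dcoef alpha q j k z : (q <= 2)%N -> (3 <= j)%N ->
  (dcoef alpha q k)%:C%C * (\sum_(l < 2 ^ j.+2) ((omg j.+2)^*%C ^+ (2 ^ j - q)) ^+ l *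
    (complex.Re ((omg j.+2 ^+ l) ^+ k * z))%:C%C) =
  if k == (2 ^ j - q)%N then ((2 ^ j.+2)%:R / 2 * dcoef alpha q k)%:C%C * z else 0.
Proof.
move=> q2 j3.
have j8 : (8 <= 2 ^ j)%N by rewrite (@leq_exp2l 2 3 j).
have q4 : (q.*2 <= 4)%N by rewrite (@leq_double q 2).
have Kq : (2 ^ j - q + q = 2 ^ j)%N by rewrite subnK// (leq_trans q2)// (leq_trans _ j8).
have [[i [i0 kE]]|nk] := pselect (exists i, (0 < i)%N /\ (k + q = 2 ^ i)%N); last first.
  have -> : dcoef alpha q k = 0 by apply: dcoef_eq0 => i i0; apply/eqP => kE; apply: nk; exists i.
  by rewrite mulr0 mul0r; case: ifP => // _; rewrite mul0r.
have kK : (2 ^ j - q + k = 2 ^ i + 2 ^ j - q.*2)%N.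
  by rewrite -kE; move: (2 ^ j)%N Kq => b; lia.
rewrite fourier_term (@sum_conj_omg _ j.+2 (2 ^ j - q + k)); last first.
  by rewrite kK ndvdn_pow2_add.
rewrite mulr0 addr0.
case: eqP => [->|kn].
  rewrite sum_conj_omg_omg_diag !rmorphM /= fmorphV /= !rmorph_nat; ring.
rewrite (_ : \sum_(l < _) _ = 0) ?mulr0//.
have [ij|ji|ij] := ltngtP i j.
- apply: sum_conj_omg_omg'.
    by rewrite -(leq_add2r q) kE Kq leq_exp2l// ltnW.
  by rewrite -(subnDr q) kE Kq; exact: ndvdn_pow2_sub.
- apply: sum_conj_omg_omg.
    by rewrite -(leq_add2r q) kE Kq leq_exp2l// ltnW.
  by rewrite -(subnDr q) kE Kq; exact: ndvdn_pow2_sub'.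
- by exfalso; apply: kn; rewrite -ij -kE addnK.
Qed.

Lemma cvg_sumn N (f : nat -> R^nat) (a : nat -> R) : (forall l, f l n @[n --> \oo] --> a l) ->
  \sum_(l < N) f l n @[n --> \oo] --> \sum_(l < N) a l.
Proof.
move=> fa; elim: N => [|N IH].
  by rewrite big_ord0; under eq_fun do rewrite big_ord0; exact: cvg_cst.
rewrite big_ord_recr; under eq_fun do rewrite big_ord_recr.
exact: (cvgD IH (fa N)).
Qed.

(** The transform of a partial sum no longer changes once the index 2^j - q has been passed, so its
    limit is that constant value. *)
Lemma fourier_psr alpha q j z : 0 <= alpha -> (q <= 2)%N -> (3 <= j)%N -> normc z < 1 ->
  \sum_(l < 2 ^ j.+2) ((omg j.+2)^*%C ^+ (2 ^ j - q)) ^+ l *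
    (psr 1 (dcoef alpha q) (omg j.+2 ^+ l * z))%:C%C =
  ((2 ^ j.+2)%:R / 2 * dcoef alpha q (2 ^ j - q))%:C%C * z ^+ (2 ^ j - q).
Proof.
move=> a0 q2 j3 z1; set c := dcoef alpha q; set w := (_^*%C ^+ _).
set p := j.+2; set K := (2 ^ j - q)%N; set RHS := (X in _ = X).
have rc : radius_ge1 c by exact: radius_ge1_dcoef.
have z01 : 0 <= normc z < 1 by rewrite normc_ge0.
have nz (l : nat) : normc (omg p ^+ l * z) <= normc z.
  by rewrite normcM normcX /omg normc_expi expr1n mul1r.
have cv (l : nat) := @psr_cvg _ 1 c _ _ (radius_ge1_summable rc z01) (nz l).
pose T n := \sum_(l < 2 ^ p) w ^+ l * (series (term 1 c (omg p ^+ l * z)) n)%:C%C.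
have TE n : (K < n)%N -> T n = RHS.
  move=> Kn; rewrite /T.
  transitivity (\sum_(k < n) (c k)%:C%C * (\sum_(l < 2 ^ p) w ^+ l *
    (complex.Re ((omg p ^+ l) ^+ k * z ^+ k))%:C%C)).
    under eq_bigr => l _ do rewrite /series /= big_mkord rmorph_sum /= mulr_sumr.
    rewrite exchange_big /=; apply: eq_bigr => k _; rewrite mulr_sumr; apply: eq_bigr => l _.
    by rewrite /term mul1r exprMn rmorphM /= mulrCA.
  under eq_bigr => k _ do rewrite fourier_dcoef//.
  by rewrite (bigD1 (Ordinal Kn))//= eqxx big1 ?addr0// => k kn; rewrite ifN.
(* Limits are taken in the reals: [ell] stands for the real or the imaginary part. *)
have lin (ell : R[i] -> R) : ell 0 = 0 -> {morph ell : u v / u + v} ->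
    (forall u (t : R), ell (u * t%:C%C) = ell u * t) ->
    ell (\sum_(l < 2 ^ p) w ^+ l * (psr 1 c (omg p ^+ l * z))%:C%C) = ell RHS.
  move=> ell0 ellD ellZ.
  have H1 : ell (T n) @[n --> \oo] --> ell RHS.
    apply: cvg_near_cst; near=> n; rewrite TE//; near: n; exact: nbhs_infty_gt.
  have H2 : ell (T n) @[n --> \oo] -->
      ell (\sum_(l < 2 ^ p) w ^+ l * (psr 1 c (omg p ^+ l * z))%:C%C).
    rewrite /T (big_morph ell ellD ell0); under eq_fun => n do rewrite (big_morph ell ellD ell0).
    apply: (@cvg_sumn (2 ^ p) (fun l n => ell (w ^+ l * (series (term 1 c (omg p ^+ l * z)) n)%:C%C))
      (fun l => ell (w ^+ l * (psr 1 c (omg p ^+ l * z))%:C%C))) => l.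
    rewrite ellZ; under eq_fun do rewrite ellZ.
    by apply: cvgMl_tmp; exact: cv.
  exact: (cvg_unique _ H2 H1).
have ReH : {morph (@complex.Re R) : u v / u + v} by case=> ? ? [].
have ImH : {morph (@complex.Im R) : u v / u + v} by case=> ? ? [].
apply/eqP; rewrite eq_complex; apply/andP; split; apply/eqP; apply: lin => //.
- by case=> u v t; rewrite /= mulr0 subr0.
- by case=> u v t; rewrite /= mulr0 add0r.
Unshelve. all: by end_near. Qed.

Lemma normc_sum N (f : nat -> R[i]) : normc (\sum_(l < N) f l) <= \sum_(l < N) normc (f l).
Proof.
elim: N => [|N IH]; first by rewrite !big_ord0 normc0.
by rewrite !big_ord_recr /=; apply: le_trans (le_normcD _ _) _; rewrite lerD2r.
Qed.

Lemma sqr_sum_le N (f : nat -> R) : (\sum_(l < N) f l) ^+ 2 <= N%:R * \sum_(l < N) f l ^+ 2.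
Proof.
elim: N => [|N IH]; first by rewrite !big_ord0 expr0n mul0r.
rewrite !big_ord_recr /= -natr1; move: IH.
set A := \sum_(i < N) f i; set B := \sum_(i < N) f i ^+ 2; set x := f N => IH.
have B0 : 0 <= B by apply: sumr_ge0 => i _; exact: sqr_ge0.
case: (posnP N) => [N0|N0].
  rewrite N0 mul0r in IH *; have A0 : A = 0.
    by apply/eqP; rewrite -sqrf_eq0 eq_le IH sqr_ge0.
  by rewrite A0; nra.
have Np : 0 < N%:R :> R by rewrite ltr0n.
move: (N%:R) Np IH => n n0 IH.
(* AM-GM: 2 A x <= A^2 / n + n x^2 <= B + n x^2 *)
have h : 2 * A * x <= B + n * x ^+ 2.
  rewrite -(ler_pM2l n0).
  have := sqr_ge0 (A - n * x); nra.
by lra.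
Qed.

Lemma fourier_bound N (w : R[i]) (f : nat -> R) : normc w = 1 ->
  normc (\sum_(l < N) w ^+ l * (f l)%:C%C) ^+ 2 <= N%:R * \sum_(l < N) f l ^+ 2.
Proof.
move=> w1; have E : \sum_(l < N) f l ^+ 2 = \sum_(l < N) `|f l| ^+ 2.
  by apply: eq_bigr => l _; rewrite real_normK ?num_real.
rewrite E; apply: le_trans (sqr_sum_le N (fun l => `|f l|)).
apply: lerX2; first exact: normc_ge0.
apply: le_trans (normc_sum N (fun l => w ^+ l * (f l)%:C%C)) _.
apply: ler_sum => l _; rewrite normcM normcX w1 expr1n mul1r.
by rewrite /normc /= expr0n addr0 sqrtr_sqr.
Qed.

Lemma normc_conj z : normc z^*%C = normc z.
Proof. by case: z => a b; rewrite /normc /= sqrrN. Qed.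

(** Cauchy-Schwarz applied to the Fourier coefficient of [fourier_psr]; 1/4 is the square of its
    factor 1/2. *)
Lemma psr_rotation_sum alpha q j z : 0 <= alpha -> (q <= 2)%N -> (3 <= j)%N -> normc z < 1 ->
  (2 ^ j.+2)%:R / 4 * dcoef alpha q (2 ^ j - q) ^+ 2 * (normc z ^+ 2) ^+ (2 ^ j - q) <=
  \sum_(l < 2 ^ j.+2) psr 1 (dcoef alpha q) (omg j.+2 ^+ l * z) ^+ 2.
Proof.
move=> a0 q2 j3 z1.
have w1 : normc ((omg j.+2)^*%C ^+ (2 ^ j - q) : R[i]) = 1.
  by rewrite normcX normc_conj /omg normc_expi expr1n.
have := fourier_bound (2 ^ j.+2) (fun l => psr 1 (dcoef alpha q) (omg j.+2 ^+ l * z)) w1.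
rewrite fourier_psr// normcM normcX exprMn.
have -> : normc ((2 ^ j.+2)%:R / 2 * dcoef alpha q (2 ^ j - q))%:C%C ^+ 2 =
   ((2 ^ j.+2)%:R / 2 * dcoef alpha q (2 ^ j - q)) ^+ 2 :> R.
  by rewrite normc_sqr /= expr0n addr0.
have N0 : 0 < (2 ^ j.+2)%:R :> R by rewrite ltr0n expn_gt0.
move=> h; rewrite -(ler_pM2l N0); apply: le_trans h.
rewrite exprAC le_eqVlt; apply/orP; left; apply/eqP; by field.
Qed.

Lemma omg_quarter j : omg j.+2 ^+ (2 ^ j) = 'i%C :> R[i].
Proof.
rewrite /omg expiX (_ : _ *+ (2 ^ j) = pi / 2); first by rewrite /expi cos_pihalf sin_pihalf.
rewrite -[LHS]mulr_natr natrX !exprS -mulr_natr.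
by field; rewrite expf_neq0.
Qed.

(** omega^(2^j) = i, and |omega - 1| <= 8/2^(j+2) <= 1/4; so omega^(2^j - q) stays within 1/2 of i,
    while |1 - i| >= 1. *)
Lemma normc_1_sub_omg q j : (q <= 1)%N -> (3 <= j)%N ->
  1 / 2 <= normc (1 - omg j.+2 ^+ (2 ^ j - q) : R[i]).
Proof.
move=> q1 j3.
have j8 : (8 <= 2 ^ j)%N by rewrite (@leq_exp2l 2 3 j).
have h1 : 1 <= normc (1 - 'i%C : R[i]).
  by have := ler_normc_Re (1 - 'i%C : R[i]); rewrite /= subr0 normr1.
have h2 : normc (omg j.+2 ^+ (2 ^ j - q) - 'i%C : R[i]) <= 1 / 2.
  have -> : 'i%C = omg j.+2 ^+ (2 ^ j - q) * omg j.+2 ^+ q :> R[i].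
    by rewrite -exprD subnK ?omg_quarter// (leq_trans q1)// (leq_trans _ j8).
  rewrite -[X in X - _]mulr1 -mulrBr normcM normcX /omg normc_expi expr1n mul1r -/(omg _).
  rewrite -normcN opprB; case: q q1 => [|[|//]] _.
    by rewrite expr0 subrr normc0.
  rewrite expr1; apply: le_trans (normc_omg_sub1 _) _.
  rewrite ler_pdivrMr ?exprn_gt0// -natrX.
  have : (32 <= 2 ^ j.+2)%N by rewrite (@leq_exp2l 2 5).
  by rewrite -(ler_nat R); lra.
have -> : 1 - omg j.+2 ^+ (2 ^ j - q) = (1 - 'i%C) - (omg j.+2 ^+ (2 ^ j - q) - 'i%C) :> R[i] by ring.
set C := omg j.+2 ^+ (2 ^ j - q) - 'i%C in h2 *; set B := 1 - 'i%C in h1 *.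
have h3 : normc (B - C + C : R[i]) <= normc (B - C) + normc C := le_normcD _ _.
by rewrite subrK in h3; lra.
Qed.

(* Summation by parts on the cyclic group of rotations: passing to differences
   of neighbours multiplies the Fourier coefficient by 1 - omega^(2^j - q). *)
Lemma psr_rotation_diff_sum alpha q j z : 0 <= alpha -> (q <= 1)%N -> (3 <= j)%N -> normc z < 1 ->
  (2 ^ j.+2)%:R / 16 * dcoef alpha q (2 ^ j - q) ^+ 2 * (normc z ^+ 2) ^+ (2 ^ j - q) <=
  \sum_(l < 2 ^ j.+2) (psr 1 (dcoef alpha q) (omg j.+2 ^+ l * z) -
     psr 1 (dcoef alpha q) (omg j.+2 ^+ l.+1 * z)) ^+ 2.
Proof.
move=> a0 q1 j3 z1; set ZZ := (normc z ^+ 2) ^+ _; have q2 : (q <= 2)%N by exact: leq_trans q1 _.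
set w : R[i] := (omg j.+2)^*%C ^+ (2 ^ j - q).
pose f (l : nat) := psr 1 (dcoef alpha q) (omg j.+2 ^+ l * z).
have w1 : normc w = 1.
  by rewrite normcX normc_conj /omg normc_expi expr1n.
have wo : w * omg j.+2 ^+ (2 ^ j - q) = 1.
  by rewrite /w -exprMn_comm ?[_^*%C * _]mulrC ?omgJ ?expr1n//; exact: mulrC.
have wN : w ^+ (2 ^ j.+2) = 1.
  rewrite /w exprAC -[(omg _)^*%C ^+ _]rmorphXn /= omg_pow2.
  by rewrite conjc1 expr1n.
have fN : f (2 ^ j.+2)%N = f 0%N by rewrite /f omg_pow2 expr0.
have diffE : \sum_(l < 2 ^ j.+2) w ^+ l * (f l - f l.+1)%:C%C =
    (1 - omg j.+2 ^+ (2 ^ j - q)) * \sum_(l < 2 ^ j.+2) w ^+ l * (f l)%:C%C.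
  (* Shifting l by one permutes the sum, since both factors take the same value at l = 2^(j+2) as at
     l = 0. *)
  have sh : \sum_(l < 2 ^ j.+2) w ^+ l.+1 * (f l.+1)%:C%C = \sum_(l < 2 ^ j.+2) w ^+ l * (f l)%:C%C.
    apply: (@addrI _ (w ^+ 0 * (f 0%N)%:C%C)).
    rewrite -(@big_ord_recl _ _ _ _ (fun l : 'I_(2 ^ j.+2).+1 => w ^+ l * (f l)%:C%C)).
    by rewrite big_ord_recr /= wN fN expr0 addrC.
  rewrite mulrBl mul1r -{2}sh mulr_sumr -sumrB; apply: eq_bigr => l _.
  by rewrite rmorphB mulrBr exprS !mulrA [omg _ ^+ _ * w]mulrC wo mul1r.
have := fourier_bound (2 ^ j.+2) (fun l => f l - f l.+1) w1.
rewrite diffE fourier_psr// !normcM !normcX !exprMn.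
have -> : normc ((2 ^ j.+2)%:R / 2 * dcoef alpha q (2 ^ j - q))%:C%C ^+ 2 =
   ((2 ^ j.+2)%:R / 2 * dcoef alpha q (2 ^ j - q)) ^+ 2 :> R.
  by rewrite normc_sqr /= expr0n addr0.
have N0 : 0 < (2 ^ j.+2)%:R :> R by rewrite ltr0n expn_gt0.
have h2 : 1 / 4 <= normc (1 - omg j.+2 ^+ (2 ^ j - q) : R[i]) ^+ 2.
  apply: le_trans (_ : (1 / 2) ^+ 2 <= _); first by lra.
  by apply: lerX2; [lra|exact: normc_1_sub_omg].
move=> h; rewrite -(ler_pM2l N0); apply: le_trans h.
rewrite [X in _ <= _ * (_ * X)]exprAC -/ZZ.
apply: le_trans (_ : 1 / 4 * (((2 ^ j.+2)%:R / 2 * dcoef alpha q (2 ^ j - q)) ^+ 2 * ZZ) <= _).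
  by rewrite le_eqVlt; apply/orP; left; apply/eqP; by field.
by apply: ler_wpM2r => //; rewrite mulr_ge0 ?sqr_ge0// exprn_ge0// sqr_ge0.
Qed.

End lacunary_fourier.

(** * From pointwise bounds on rotation orbits to integrals *)

Section rotation_average.
Context {R : realType} {m : nat}.
Local Notation V := 'rV[R]_(2 + m).
Local Notation mu := (lebesgue_rV (2 + m)).
Implicit Types (j k l q : nat) (x y : V).

Definition rot p : V -> V := rotate (complex.Re (omg p)) (complex.Im (omg p)).

Lemma omg_sqr p : complex.Re (omg p : R[i]) ^+ 2 + complex.Im (omg p : R[i]) ^+ 2 = 1.
Proof. by rewrite -normc_sqr /omg normc_expi expr1n. Qed.

Lemma cz_iter_rot p l x : cz (iter l (rot p) x) = omg p ^+ l * cz x.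
Proof.
elim: l => [|l IH]; first by rewrite mul1r.
rewrite iterS {1}/rot cz_rotate IH mulrA -exprS; congr (_ * _).
Qed.

Lemma normc_omgX p l (z : R[i]) : normc (omg p ^+ l * z) = normc z.
Proof. by rewrite normcM normcX /omg normc_expi expr1n mul1r. Qed.

Lemma iter_rot_annulus p l e d x : annulus e d (iter l (rot p) x) <-> annulus e d x.
Proof.
by elim: l => [//|l IH]; rewrite iterS /rot annulus_rotate ?omg_sqr.
Qed.

Lemma measurable_iter_rot p l : measurable_fun setT (iter l (rot p)).
Proof.
elim: l => [|l IH]; first exact: measurable_id.
rewrite (_ : iter l.+1 _ = rot p \o iter l (rot p)) //.
exact: measurableT_comp (measurable_rotate _ _) IH.
Qed.

Lemma Re_omg_neqN1 p : (2 <= p)%N -> complex.Re (omg p) != -1 :> R.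
Proof.
move=> p2; apply/eqP => h.
have I0 : complex.Im (omg p : R[i]) = 0.
  by apply/eqP; rewrite -sqrf_eq0; apply/eqP; have := omg_sqr p; rewrite h; lra.
have : omg p ^+ 2 != 1 :> R[i] by apply: omg_neq1; rewrite (@dvdn_Pexp2l 2 p 1)// -ltnNge.
by case: (omg p) h I0 => a b /= -> ->; rewrite expr2 eq_complex /= mulrNN mulr1 !mulr0 mul0r subr0 addr0 !eqxx.
Qed.

Lemma ge0_integral_iter_rot p l (h : V -> \bar R) : (2 <= p)%N ->
  measurable_fun setT h -> (forall x, 0 <= h x)%E ->
  (\int[mu]_x h (iter l (rot p) x) = \int[mu]_x h x)%E.
Proof.
move=> p2 + h0; elim: l => [//|l IH] mh.
rewrite -[RHS]IH//; under eq_integral do rewrite iterSr.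
rewrite /rot (@ge0_integral_rotate _ _ _ _ (fun x => h (iter l (rot p) x)))//.
- exact: omg_sqr.
- exact: Re_omg_neqN1.
- exact: measurableT_comp mh (measurable_iter_rot p l).
Qed.

(** Integrate the bound over A and enlarge A to the whole space; each of the N rotated terms then
    has the same integral as h. The bound p >= 2 excludes the half turn. *)
Lemma rotation_average p N (h : V -> \bar R) (A : set V) (kappa : R) : (2 <= p)%N ->
  measurable_fun setT h -> (forall x, 0 <= h x)%E -> measurable A -> 0 <= kappa ->
  (forall x, A x -> (kappa%:E <= \sum_(l < N) h (iter l (rot p) x))%E) ->
  (kappa%:E * mu A <= N%:R%:E * \int[mu]_x h x)%E.
Proof.
move=> p2 mh h0 mA k0 H.
have mhl (l : nat) : measurable_fun setT (fun x => h (iter l (rot p) x)).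
  exact: measurableT_comp mh (measurable_iter_rot p l).
rewrite -integral_cst//.
apply: (@le_trans _ _ (\int[mu]_(x in A) \sum_(l < N) h (iter l (rot p) x))%E).
  apply: ge0_le_integral => //.
  by apply: measurable_funTS; apply: emeasurable_sum.
apply: (@le_trans _ _ (\int[mu]_x \sum_(l < N) h (iter l (rot p) x))%E).
  apply: ge0_subset_integral => //; first exact: emeasurable_sum.
  by move=> x _; apply: sume_ge0.
rewrite ge0_integral_sum//; under eq_bigr => l _ do rewrite ge0_integral_iter_rot//.
rewrite big_const_ord; elim: (N) => [|n IH] /=; first by rewrite mul0e.
by rewrite -natr1 EFinD ge0_muleDl ?mul1e ?lee_fin// addeC leeD2r.
Qed.

End rotation_average.

(** * The inner integral of the Gagliardo seminorm *)

Section slobodeckij.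
Context {R : realType} {n : nat}.
Local Notation V := 'rV[R]_n.
Local Notation mu := (lebesgue_rV n).
Implicit Types (x y : V) (v : V -> R) (D : set V) (p : R).

Definition kern p v x y : R := (v x - v y) ^+ 2 / enorm (x - y) `^ p.

Definition slob p v D x : \bar R := (\int[mu]_(y in D) (kern p v x y)%:E)%E.

Lemma gagliardoE theta D v : gagliardo theta D v = (\int[mu]_(x in D) slob (n%:R + 2 * theta) v D x)%E.
Proof. by []. Qed.

Lemma kern_ge0 p v x y : 0 <= kern p v x y.
Proof. by rewrite mulr_ge0 ?sqr_ge0// invr_ge0 powR_ge0. Qed.

Lemma slob_ge0 p v D x : (0 <= slob p v D x)%E.
Proof. by apply: integral_ge0 => y _; rewrite lee_fin kern_ge0. Qed.

Lemma measurable_enorm d (T : measurableType d) (f : T -> V) : measurable_fun setT f ->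
  measurable_fun setT (fun t => enorm (f t) : measurableTypeR R).
Proof.
move=> mf; rewrite /enorm.
apply: (@measurableT_comp _ _ _ _ _ _ (@Num.sqrt R)).
  exact: continuous_measurable_fun (@sqrt_continuous R).
apply: measurable_sum => i; apply: measurable_funX.
exact: (measurableT_comp (measurable_coord i) mf).
Qed.

Lemma measurable_rV_sub d (T : measurableType d) (f g : T -> V) : measurable_fun setT f ->
  measurable_fun setT g -> measurable_fun setT (fun t => f t - g t).
Proof.
move=> mf mg; apply: measurable_fun_coordP => i.
under eq_fun do rewrite !mxE.
apply: measurable_funB; exact: (measurableT_comp (measurable_coord i)).
Qed.

Lemma measurable_kern d (T : measurableType d) (f g : T -> V) p v : measurable_fun setT f ->
  measurable_fun setT g -> measurable_fun setT v ->
  measurable_fun setT (fun t => kern p v (f t) (g t) : measurableTypeR R).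
Proof.
move=> mf mg mv; rewrite /kern.
under eq_fun do rewrite -powRN.
apply: measurable_funM.
  by apply: measurable_funX; apply: measurable_funB; exact: (measurableT_comp mv).
apply: (measurableT_comp (measurable_powR _)).
by apply: measurable_enorm; exact: measurable_rV_sub.
Qed.

Lemma slobE p v D x : measurable D -> D x ->
  slob p v D x = (\int[mu]_y (kern p (v \_ D) x y * \1_D y)%:E)%E.
Proof.
move=> mD Dx; rewrite /slob integral_mkcond; apply: eq_integral => y _.
rewrite /kern /patch indicE (mem_set Dx); case: ifPn => yD; last by rewrite mulr0.
by rewrite mulr1.
Qed.

Lemma measurable_slob p v D : measurable D -> measurable_fun D v ->
  measurable_fun D (slob p v D).
Proof.
move=> mD mv.
have mw : measurable_fun setT (v \_ D) by apply/(measurable_restrictT v mD).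
pose h (z : V * V) : \bar R := (kern p (v \_ D) z.1 z.2 * \1_D z.2)%:E.
apply: (eq_measurable_fun (fubini_F mu h)).
  by move=> x; rewrite inE => Dx; rewrite slobE.
apply: measurable_funTS; apply: measurable_fun_fubini_tonelli_F.
  apply/measurable_EFinP; apply: measurable_funM.
    exact: measurable_kern measurable_fst measurable_snd mw.
  exact: (measurableT_comp (measurable_indic mD) measurable_snd).
by move=> z; rewrite lee_fin mulr_ge0 ?kern_ge0.
Qed.

Lemma measurable_kern_r p v D x : measurable D -> measurable_fun D v ->
  measurable_fun D (fun y => (kern p v x y)%:E).
Proof.
move=> mD mv; apply/measurable_EFinP; rewrite /kern.
under eq_fun do rewrite -powRN.
apply: measurable_funM.
  by apply: measurable_funX; apply: measurable_funB => //; exact: measurable_cst.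
apply: measurable_funTS.
apply: (measurableT_comp (measurable_powR _)).
by apply: measurable_enorm; apply: measurable_rV_sub.
Qed.

Lemma enorm_le_coord x (M : R) : 0 <= M -> (forall i, `|x 0 i| <= M) -> enorm x <= n%:R * M.
Proof.
move=> M0 xM; rewrite /enorm -[leRHS]ger0_norm ?mulr_ge0// -sqrtr_sqr ler_wsqrtr//.
apply: le_trans (_ : \sum_(i < n) M ^+ 2 <= _).
  by apply: ler_sum => i _; rewrite -real_normK ?num_real// lerX2.
rewrite sumr_const card_ord exprMn -[leLHS]mulr_natl; apply: ler_wpM2r; first exact: sqr_ge0.
case: (n) => [|k]; first by rewrite expr0n.
by rewrite expr2 ler_peMl// ler1n.
Qed.

Lemma enorm_eq0 x : enorm x = 0 -> x = 0.
Proof.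
move=> /eqP; rewrite sqrtr_eq0 => h; apply/rowP => i; rewrite mxE; apply/eqP.
rewrite -sqrf_eq0 eq_le sqr_ge0 andbT; apply: le_trans h.
by rewrite (bigD1 i)//= lerDl sumr_ge0// => k _; exact: sqr_ge0.
Qed.

Lemma sqr_sub_le_kern p v x y (M : R) : 0 <= p -> enorm (x - y) <= M ->
  (v x - v y) ^+ 2 <= M `^ p * kern p v x y.
Proof.
move=> p0 xM; have e0 : 0 <= enorm (x - y) by exact: sqrtr_ge0.
have [/enorm_eq0/eqP|e1] := eqVneq (enorm (x - y)) 0.
  by rewrite subr_eq0 => /eqP ->; rewrite subrr expr0n mulr_ge0 ?powR_ge0 ?kern_ge0.
have ep : 0 < enorm (x - y) `^ p by rewrite powR_gt0// lt_def e1.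
rewrite /kern mulrCA ler_peMr ?sqr_ge0// ler_pdivlMr// mul1r.
by apply: ge0_ler_powR => //; rewrite nnegrE// (le_trans e0).
Qed.

(** (s - t)^2 <= 2 (s - u)^2 + 2 (t - u)^2 with u = v y, integrated over the points y of B. Since
    these are within M of both x and x', the kernels are at least the squared differences divided by
    M^p. *)
Lemma slob_two_points p v D B x x' (M : R) : 0 <= p -> 0 < M -> measurable D -> measurable_fun D v ->
  measurable B -> B `<=` D ->
  (forall y, B y -> enorm (x - y) <= M /\ enorm (x' - y) <= M) ->
  (((v x - v x') ^+ 2 / (2 * M `^ p))%:E * mu B <= slob p v D x + slob p v D x')%E.
Proof.
move=> p0 M0 mD mv mB BD H.
have Mp : 0 < M `^ p by rewrite powR_gt0.
have mvB : measurable_fun B v by exact: measurable_funS mv.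
rewrite -integral_cst//.
apply: (@le_trans _ _ (\int[mu]_(y in B) ((kern p v x y)%:E + (kern p v x' y)%:E))%E).
  apply: ge0_le_integral => //.
  - by move=> y _; rewrite lee_fin divr_ge0 ?sqr_ge0// mulr_ge0// ltW.
  - by apply: emeasurable_funD; exact: measurable_kern_r.
  - move=> y By; have [h1 h2] := H y By; rewrite -EFinD lee_fin ler_pdivrMr ?mulr_gt0//.
    have := sqr_sub_le_kern v p0 h1; have := sqr_sub_le_kern v p0 h2.
    move: (kern _ _ _ _) (kern _ _ _ _) (M `^ p) (v x) (v x') (v y) => a b c s t u ha hb.
    have : 0 <= (s + t - 2 * u) ^+ 2 by exact: sqr_ge0.
    nra.
rewrite ge0_integralD//; try exact: measurable_kern_r; try by move=> y _; rewrite lee_fin kern_ge0.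
apply: leeD; apply: ge0_subset_integral => //; try exact: measurable_kern_r;
  by move=> y _; rewrite lee_fin kern_ge0.
Qed.

End slobodeckij.

(** * Geometry of annuli, small cubes and rotations at scale 2^-j *)

Section annuli.
Context {R : realType} {m : nat}.
Local Notation n := (2 + m)%N.
Local Notation V := 'rV[R]_n.
Local Notation mu := (lebesgue_rV n).
Implicit Types (j k l q : nat) (x y : V) (alpha delta r : R).

Definition polydisc delta : set V :=
  [set x | normc (cz x) < 1 /\ forall i, `|rsubmx x 0 i| < delta].

Definition nbox x r : set V := [set y | forall i, x 0 i - r < y 0 i < x 0 i + r].

Lemma nboxE x r : nbox x r = [set y | forall i, `]x 0 i - r, x 0 i + r[%classic (y 0 i)].
Proof. by apply/seteqP; split => y h i; have := h i; rewrite /= in_itv. Qed.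

Lemma measurable_nbox x r : measurable (nbox x r).
Proof. exact: measurable_obox. Qed.

Lemma nbox_volume x r : 0 < r -> mu (nbox x r) = ((2 * r) ^+ n)%:E.
Proof.
move=> r0; rewrite nboxE.
rewrite (@lebesgue_rV_box R n (fun i => `]x 0 i - r, x 0 i + r[%classic)); last first.
  by move=> i; exact: measurable_itv.
rewrite (eq_bigr (fun=> (2 * r)%:E)); last first.
  move=> i _; have dd : x 0 i - r < x 0 i + r by lra.
  by rewrite lebesgue_measure_itv/= lte_fin dd -EFinB; congr EFin; lra.
by rewrite prodEFin prodr_const card_ord.
Qed.

Lemma normc_le_ReIm (z : R[i]) : normc z <= `|complex.Re z| + `|complex.Im z|.
Proof.
rewrite leNgt; apply/negP => h.
have := normc_sqr z; rewrite -(real_normK (num_real (complex.Re z))) -(real_normK (num_real (complex.Im z))).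
have := normr_ge0 (complex.Re z); have := normr_ge0 (complex.Im z).
by move: `|_| `|_| (normc z) h => a b c; nra.
Qed.

Lemma cz_sub_le x y r : (forall i, `|x 0 i - y 0 i| <= r) -> normc (cz x - cz y) <= 2 * r.
Proof.
move=> h; apply: le_trans (normc_le_ReIm _) _; rewrite /cz /= !mxE.
by have := h (lshift m 0); have := h (lshift m 1); lra.
Qed.

Lemma annulus_normc_lt (e d : R) x : 0 < e <= 1 -> annulus e d x -> normc (cz x) < 1 - e / 4.
Proof.
move=> /andP[e0 e1] [/andP[_ h] _]; rewrite ltNge; apply/negP => h2.
by have := normc_ge0 (cz x); nra.
Qed.

Lemma annulus_sub_polydisc (e d : R) : 0 < e <= 1 -> annulus e d `<=` polydisc d.
Proof.
move=> e01 x Ax; split; last by have [] := Ax.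
by have := annulus_normc_lt e01 Ax; lra.
Qed.

Lemma nbox_sub_polydisc (e delta : R) x : 0 < e <= 1 -> 0 < delta <= 1 / 8 ->
  annulus e (delta / 2) x -> nbox x (delta / 2 * e) `<=` polydisc delta.
Proof.
move=> e01 /andP[d0 d1] Ax y Bxy; have /andP[e0 e1] := e01.
have xy i : `|y 0 i - x 0 i| <= delta / 2 * e.
  by have /andP[h1 h2] := Bxy i; rewrite ler_norml; apply/andP; split; lra.
have de : delta / 2 * e <= delta / 2 by nra.
split.
  have h1 := annulus_normc_lt e01 Ax; have h2 := cz_sub_le xy.
  have h3 : normc (cz y - cz x + cz x : R[i]) <= normc (cz y - cz x) + normc (cz x) := le_normcD _ _.
  by rewrite subrK in h3; nra.
move=> i; have [_ /(_ i) h1] := Ax.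
have := xy (rshift 2 i); move: h1; rewrite !mxE => h1 h2.
have h3 := ler_normD (y 0 (rshift 2 i) - x 0 (rshift 2 i)) (x 0 (rshift 2 i)).
by rewrite subrK in h3; lra.
Qed.

Lemma rot_dist p x i : normc (cz x) <= 1 -> `|rot p x 0 i - x 0 i| <= 8 / 2 ^+ p.
Proof.
move=> x1.
have h : normc (cz (rot p x) - cz x) <= 8 / 2 ^+ p.
  have -> : cz (rot p x) - cz x = (omg p - 1) * cz x.
    by rewrite mulrBl mul1r; congr (_ - _); exact: (cz_iter_rot p 1).
  rewrite normcM; apply: le_trans (normc_omg_sub1 p); rewrite -[leRHS]mulr1.
  by apply: ler_wpM2l => //; exact: normc_ge0.
case: (split_ordP i) => k ->; last first.
  have := congr1 (fun y : 'rV_m => y 0 k) (rsubmx_rotate (complex.Re (omg p)) (complex.Im (omg p)) x).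
  by rewrite !mxE /rot => ->; rewrite subrr normr0 divr_ge0.
apply: le_trans h; have [->|->] : k = 0 \/ k = 1.
- by case: k => -[|[|//]] k; [left|right]; exact: val_inj.
- by apply: le_trans (ler_normc_Re _); rewrite /cz /= !mxE.
- apply: le_trans (_ : `|complex.Im (cz (rot p x) - cz x)| <= _); first by rewrite /cz /= !mxE.
  rewrite -(@ler_pXn2r _ 2) ?nnegrE ?normc_ge0// normc_sqr real_normK ?num_real//.
  by rewrite lerDr sqr_ge0.
Qed.

Definition rad j : R := (2 ^+ j)^-1.

Lemma rad_gt0 j : 0 < rad j. Proof. by rewrite invr_gt0 exprn_gt0. Qed.

Lemma rad_le j i : (i <= j)%N -> rad j <= rad i.
Proof. by move=> ij; rewrite lef_pV2 ?posrE ?exprn_gt0// ler_weXn2l// ler1n. Qed.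

Lemma rad_le1 j : rad j <= 1.
Proof. by have := rad_le (leq0n j); rewrite {2}/rad expr0 invr1. Qed.

Lemma radS j : rad j.+1 = rad j / 2.
Proof. by rewrite /rad exprS invfM mulrC. Qed.

(** In each coordinate the rotation moves x by at most 8/2^(j+2) = 2 [rad j], and y is within
    [rad j] of x, whence the 3. *)
Lemma nbox_enorm j x y delta : (3 <= j)%N -> 0 < delta <= 1 / 8 -> normc (cz x) <= 1 ->
  nbox x (delta / 2 * rad j) y ->
  enorm (x - y) <= n%:R * (3 * rad j) /\ enorm (rot j.+2 x - y) <= n%:R * (3 * rad j).
Proof.
move=> j3 /andP[d0 d1] x1 Bxy; have e0 := rad_gt0 j.
have xy i : `|x 0 i - y 0 i| <= rad j.
  have de : delta / 2 * rad j <= rad j by nra.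
  by have /andP[h1 h2] := Bxy i; rewrite ler_norml; apply/andP; split; lra.
have subE (a b : V) i : (a - b) 0 i = a 0 i - b 0 i by rewrite !mxE.
have e3 : 0 <= 3 * rad j by lra.
split; apply: enorm_le_coord => // i; rewrite subE.
  by apply: le_trans (xy i) _; lra.
have := ler_normD (rot j.+2 x 0 i - x 0 i) (x 0 i - y 0 i).
rewrite addrA subrK => h; apply: le_trans h _.
have := rot_dist j.+2 i x1; have := xy i.
rewrite -[(2 ^+ j.+2)^-1]/(rad j.+2) !radS; lra.
Qed.

(** (1 - 2^-j)^(2^j) is the square of (1 - 2^-j)^(2^(j-1)), which is at least 1/2 by Bernoulli. So
    on annulus j the power of frequency up to 2^j has not decayed. *)
Lemma annulus_pow_ge j K x d : (1 <= j)%N -> (K <= 2 ^ j)%N -> annulus (rad j) d x ->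
  1 / 4 <= (normc (cz x) ^+ 2) ^+ K.
Proof.
move=> j1 Kj [/andP[h1 h2] _].
have e0 := rad_gt0 j; have e1 := rad_le1 j.
apply: le_trans (_ : (1 - rad j) ^+ K <= _); last first.
  by apply: lerXn2r; rewrite ?nnegrE ?subr_ge0 ?sqr_ge0// ltW.
apply: le_trans (_ : (1 - rad j) ^+ (2 ^ j) <= _); last first.
  by apply: ler_wiXn2l => //; lra.
case: j j1 {Kj h1 h2} e0 e1 => // j _ e0 e1.
rewrite expnSr exprM; apply: le_trans (_ : (1 / 2) ^+ 2 <= _); first by lra.
apply: lerX2; first by lra.
have t01 : 0 <= rad j.+1 <= 1 by rewrite e1 ltW.
have := bernoulli_ge (2 ^ j) t01.
rewrite natrX {1}/rad exprS invfM mulrCA divff ?expf_neq0//; lra.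
Qed.

End annuli.

(** * Lower bounds for the energy in one annulus *)

Section annulus_energy.
Context {R : realType} {m : nat}.
Local Notation n := (2 + m)%N.
Local Notation V := 'rV[R]_n.
Local Notation mu := (lebesgue_rV n).
Variables (alpha delta : R) (q : nat).
Hypotheses (alpha0 : 0 <= alpha) (delta0 : 0 < delta <= 1 / 8).
Implicit Types (j l : nat) (x : V).

Let f : V -> R := plane_series 1 (dcoef alpha q).
Let A j : set V := annulus (rad j) (delta / 2).
Let b j : R := dcoef alpha q (2 ^ j - q).
Let Q : set V := polydisc delta.

Lemma measurable_polydisc : measurable Q.
Proof.
rewrite (_ : Q = @cyl R m `&` (@rsubmx R 1 2 m @^-1` cube delta)); last first.
  by apply/seteqP; split => x [h1 h2]; split.
apply: measurableI; first exact: measurable_cyl.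
rewrite -[X in measurable X]setTI; apply: measurable_fun_coordP => //; last exact: measurable_cube.
move=> i; under eq_fun do rewrite mxE; exact: measurable_coord.
Qed.

Let polydisc_cyl : Q `<=` @cyl R m. Proof. by move=> x []. Qed.

Let mf : measurable_fun Q f.
Proof.
apply: measurable_funS (polydisc_cyl) _; first exact: measurable_cyl.
exact: measurable_plane_series (radius_ge1_dcoef q alpha0).
Qed.

Let rad01 j : 0 < (rad j : R) <= 1.
Proof. by rewrite rad_gt0 rad_le1. Qed.

Let AQ j : A j `<=` Q.
Proof.
move=> x Ax; have [h1 h2] := annulus_sub_polydisc (rad01 j) Ax; split => // i.
by apply: lt_le_trans (h2 i) _; case/andP: delta0 => *; lra.
Qed.

Let mA j : measurable (A j). Proof. exact: measurable_annulus. Qed.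

Let fE j l x : f (iter l (rot j.+2) x) = psr 1 (dcoef alpha q) (omg j.+2 ^+ l * cz x).
Proof. by rewrite /f /plane_series cz_iter_rot. Qed.

Let ereal_divr (N : nat) (k : R) (v I : \bar R) : (0 < N)%N ->
  ((N%:R * k)%:E * v <= N%:R%:E * I)%E -> (k%:E * v <= I)%E.
Proof.
move=> N0 h; have N1 : 0 < N%:R :> R by rewrite ltr0n.
by rewrite -(@lee_pmul2l _ N%:R%:E) ?lte_fin// muleA -EFinM.
Qed.

(** [psr_rotation_sum] holds at every point of the annulus and is averaged over the rotations; 1/16
    is its 1/4 times the 1/4 of [annulus_pow_ge]. *)
Lemma sqr_annulus j : (q <= 2)%N -> (3 <= j)%N ->
  ((b j ^+ 2 / 16)%:E * mu (A j) <= \int[mu]_(x in A j) (f x ^+ 2)%:E)%E.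
Proof.
move=> q2 j3.
have N0 : (0 < 2 ^ j.+2)%N by rewrite expn_gt0.
apply: (ereal_divr N0); rewrite integral_mkcond.
have mh : measurable_fun setT ((fun x => (f x ^+ 2)%:E) \_ (A j)).
  apply/(measurable_restrictT _ (mA j)); apply/measurable_EFinP; apply: measurable_funX.
  exact: measurable_funS measurable_polydisc (@AQ j) mf.
apply: (@rotation_average _ _ j.+2) => //.
- by move=> x; rewrite /patch; case: ifP => // _; rewrite lee_fin sqr_ge0.
- by rewrite mulr_ge0// divr_ge0// sqr_ge0.
move=> x Ax.
have x1 : normc (cz x) < 1 by have [] := AQ Ax.
rewrite (eq_bigr (fun l : 'I_(2 ^ j.+2) => (psr 1 (dcoef alpha q) (omg j.+2 ^+ l * cz x) ^+ 2)%:E)); last first.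
  by move=> l _; rewrite -fE /patch mem_set//; exact/iter_rot_annulus.
rewrite sumEFin lee_fin; apply: le_trans (psr_rotation_sum alpha0 q2 j3 x1).
have := annulus_pow_ge (ltnW (ltnW j3)) (leq_subr q _) Ax.
have : 0 <= b j ^+ 2 by exact: sqr_ge0.
have : 0 < (2 ^ j.+2)%:R :> R by rewrite ltr0n.
rewrite -/(b j); move: (_ ^+ (2 ^ j - q)) (b j ^+ 2) (_%:R) => z B N N1 B0 z1.
have : 0 <= N * B * (z - 1 / 4) by rewrite !mulr_ge0 ?(ltW N1)// subr_ge0.
lra.
Qed.

(** Each rotate of x and its successor are compared through a small cube with [slob_two_points], and
    [psr_rotation_diff_sum] bounds the sum of the squared differences. Every rotate serves in two
    pairs, so 1/16 and 1/4 combine with a further 1/2 into 1/128. *)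
Lemma slob_annulus j p : (q <= 1)%N -> (3 <= j)%N -> 0 <= p ->
  (((delta * rad j) ^+ n / (2 * (n%:R * (3 * rad j)) `^ p) * (b j ^+ 2 / 128))%:E * mu (A j) <=
   \int[mu]_(x in A j) slob p f Q x)%E.
Proof.
move=> q1 j3 p0; set M := n%:R * (3 * rad j); set W := _ / (2 * _).
have M0 : 0 < M by rewrite !mulr_gt0// rad_gt0.
have W0 : 0 <= W.
  have dr : 0 <= delta * rad j by rewrite mulr_ge0// ltW ?rad_gt0//; case/andP: delta0.
  by apply: divr_ge0; [exact: exprn_ge0|rewrite mulr_ge0// powR_ge0].
have N0 : (0 < 2 ^ j.+2 * 2)%N by rewrite muln_gt0 expn_gt0.
apply: (ereal_divr N0); rewrite integral_mkcond.
set g := (slob p f Q) \_ (A j).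
have mg : measurable_fun setT g.
  apply/(measurable_restrictT _ (mA j)); apply: measurable_funS (@AQ j) _.
    exact: measurable_polydisc.
  by apply: measurable_slob => //; exact: measurable_polydisc.
have g0 x : (0 <= g x)%E.
  by rewrite /g /patch; case: ifP => // _; exact: slob_ge0.
pose h x := (g x + g (rot j.+2 x))%E.
have mgr : measurable_fun setT (fun x => g (rot j.+2 x)).
  exact: measurableT_comp mg (measurable_iter_rot j.+2 1).
have -> : ((2 ^ j.+2 * 2)%:R%:E * \int[mu]_x g x = (2 ^ j.+2)%:R%:E * \int[mu]_x h x)%E.
  have -> : (\int[mu]_x h x = \int[mu]_x g x + \int[mu]_x g x)%E.
    transitivity (\int[mu]_x g x + \int[mu]_x g (rot j.+2 x))%E.
      exact: (ge0_integralD mu measurableT (fun x _ => g0 x) mg (fun x _ => g0 (rot j.+2 x)) mgr).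
    have hr := @ge0_integral_iter_rot R m j.+2 1 g isT mg g0.
    exact: (congr1 (fun t => (\int[mu]_x g x + t)%E) hr).
  set I := (\int[mu]_x g x)%E.
  by rewrite natrM EFinM -muleA [(2%:E * I)%E]mule_natl.
apply: (@rotation_average _ _ j.+2) => //.
- exact: (emeasurable_funD mg mgr).
- by move=> x; rewrite adde_ge0.
- have b0 : 0 <= b j ^+ 2 / 128 by rewrite divr_ge0 ?sqr_ge0.
  by apply: mulr_ge0 => //; exact: mulr_ge0.
move=> x Ax; have Axl l : A j (iter l (rot j.+2) x) by exact/iter_rot_annulus.
have x1 l : normc (cz (iter l (rot j.+2) x)) < 1 by have [] := AQ (Axl l).
pose F l := (psr 1 (dcoef alpha q) (omg j.+2 ^+ l * cz x) -
  psr 1 (dcoef alpha q) (omg j.+2 ^+ l.+1 * cz x)) ^+ 2.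
apply: (@le_trans _ _ (\sum_(l < 2 ^ j.+2) (W * F l)%:E)%E).
  rewrite sumEFin lee_fin -mulr_sumr.
  have h1 := psr_rotation_diff_sum alpha0 q1 j3 (x1 0%N).
  rewrite [leLHS](_ : _ = W * ((2 ^ j.+2)%:R / 64 * b j ^+ 2)); last by rewrite natrM; field.
  apply: ler_wpM2l => //; apply: le_trans h1.
  have := annulus_pow_ge (ltnW (ltnW j3)) (leq_subr q _) Ax.
  have : 0 <= b j ^+ 2 by exact: sqr_ge0.
  have : 0 < (2 ^ j.+2)%:R :> R by rewrite ltr0n expn_gt0.
  rewrite -/(b j) /=; move: (_ ^+ (2 ^ j - q)) (b j ^+ 2) (_%:R) => z B N N1 B0 z1.
  have : 0 <= N * B * (z - 1 / 4) by rewrite !mulr_ge0 ?(ltW N1)// subr_ge0.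
  lra.
apply: lee_sum => l _.
rewrite /h /g /patch (mem_set (Axl l)) (mem_set (Axl l.+1)).
have de : 0 < delta / 2 * rad j by rewrite mulr_gt0 ?rad_gt0//; case/andP: delta0 => *; lra.
apply: le_trans (@slob_two_points _ _ p f Q (nbox (iter l (rot j.+2) x) (delta / 2 * rad j))
  (iter l (rot j.+2) x) (rot j.+2 (iter l (rot j.+2) x)) M p0 M0 measurable_polydisc mf
  (measurable_nbox _ _) (nbox_sub_polydisc (rad01 j) delta0 (Axl l)) _); last first.
  by move=> y; exact: nbox_enorm j3 delta0 (ltW (x1 l)).
rewrite nbox_volume// -EFinM lee_fin -iterS !fE /F /W.
rewrite (_ : 2 * (delta / 2 * rad j) = delta * rad j); last by field.
by rewrite [leLHS]mulrC mulrA mulrAC.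
Qed.

End annulus_energy.

(** * Disjoint annuli and divergence *)

Section divergence.
Context {R : realType} {m : nat}.
Local Notation n := (2 + m)%N.
Local Notation V := 'rV[R]_n.
Local Notation mu := (lebesgue_rV n).
Implicit Types (j l q : nat) (x : V).

Lemma annulus_trivIset (d : R) : trivIset setT (fun j => annulus (rad j) d : set V).
Proof.
suff H i j x : (i < j)%N -> annulus (rad i) d x -> annulus (rad j) d x -> False.
  apply/trivIsetP => i j _ _ ij; apply/seteqP; split => // x [Ai Aj].
  by move: ij; rewrite neq_ltn => /orP[/H /(_ Ai Aj)|/H /(_ Aj Ai)].
move=> ij [/andP[_ h1] _] [/andP[h2 _] _].
have : (rad j : R) <= rad i.+1 by exact: rad_le ij.
by rewrite radS; lra.
Qed.

(** Finitely many disjoint annuli, each contributing at least kappa, exceed any given bound M. *)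
Lemma integral_annuli_pinfty (Q : set V) (h : V -> \bar R) (d kappa : R) : measurable Q ->
  measurable_fun Q h -> (forall x, 0 <= h x)%E -> 0 < kappa ->
  (forall j, (3 <= j)%N -> annulus (rad j) d `<=` Q) ->
  (forall j, (3 <= j)%N -> (kappa%:E <= \int[mu]_(x in annulus (rad j) d) h x)%E) ->
  (\int[mu]_(x in Q) h x = +oo)%E.
Proof.
move=> mQ mh h0 k0 AQ H; apply/eqyP => M M0.
set B := (fun j => annulus (rad j) d : set V).
have [K MK] : exists K : nat, M <= K%:R * kappa.
  exists (Num.truncn (M / kappa)).+1.
  by rewrite -ler_pdivrMr//; apply: ltW; apply: truncnS_gt.
apply: (@le_trans _ _ (K%:R * kappa)%:E); first by rewrite lee_fin.
have DQ : \big[setU/set0]_(j <- iota 3 K) B j `<=` Q.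
  rewrite -bigcup_seq => x [j /=]; rewrite mem_iota => /andP[j3 _]; exact: AQ.
have mB j : measurable (B j) by exact: measurable_annulus.
have mD : measurable (\big[setU/set0]_(j <- iota 3 K) B j) by exact: bigsetU_measurable.
have mhD : measurable_fun (\big[setU/set0]_(j <- iota 3 K) B j) h by exact: measurable_funS mQ DQ mh.
apply: le_trans (ge0_subset_integral mu mD mQ mh (fun x _ => h0 x) DQ).
have -> := ge0_integral_bigsetU mu mB (iota_uniq 3 K)
  (sub_trivIset (@subsetT _ _) (@annulus_trivIset d)) mhD (fun x _ => h0 x).
apply: (@le_trans _ _ (\sum_(j <- iota 3 K) kappa%:E)%E).
  by rewrite sumEFin big_const_seq count_predT size_iota iter_addr_0 mulr_natl.
rewrite big_seq [leRHS]big_seq; apply: lee_sum => j; rewrite mem_iota => /andP[j3 _].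
exact: H.
Qed.

End divergence.

(** * Infinite energy of the differentiated lacunary series *)

Section lacunary_energy.
Context {R : realType} {m : nat}.
Local Notation n := (2 + m)%N.
Local Notation V := 'rV[R]_n.
Local Notation mu := (lebesgue_rV n).
Variables (alpha delta theta c0 : R) (q : nat).
Hypotheses (alpha0 : 0 <= alpha) (delta0 : 0 < delta <= 1 / 8) (theta0 : 0 <= theta).
Hypotheses (q2 : (q <= 2)%N) (c00 : 0 < c0).
Hypothesis amp_ge : forall j, (0 < j)%N ->
  c0 * 2 `^ (- (j%:R * (q%:R + theta - 1 / 2))) <= lacunary_amp alpha j.
Implicit Types (j l : nat) (x : V).

Let f : V -> R := plane_series 1 (dcoef alpha q).
Let Q : set V := polydisc delta.

(** For q <= 2 and 2^j >= 8, the falling factorial of 2^j of length q is at least half of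
    (2^j)^q. *)
Lemma dcoef_pow2_ge j : (3 <= j)%N ->
  (2 ^+ j) ^+ q / 2 * lacunary_amp alpha j <= dcoef alpha q (2 ^ j - q).
Proof.
move=> j3; have j8 : (8 <= 2 ^ j)%N by rewrite (@leq_exp2l 2 3 j).
have Kq : (2 ^ j - q + q = 2 ^ j)%N by rewrite subnK// (leq_trans q2)// (leq_trans _ j8).
rewrite /dcoef iter_shiftcE Kq lacunary_coef_pow ?(ltnW (ltnW j3))//.
apply: ler_wpM2r; first exact: lacunary_amp_ge0.
have : 8 <= (2 ^ j)%:R :> R by rewrite ler_nat.
rewrite natrX; case: q q2 => [|[|[|//]]] _.
- by rewrite expr0 ffactn0; lra.
- by rewrite expr1 ffactn1 natrX; move: (_ ^+ j) => E; lra.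
- have -> : (2 ^ j) ^_ 2 = (2 ^ j * (2 ^ j - 1))%N by rewrite ffactnS ffactn1 subn1.
  rewrite natrM natrB ?(leq_trans _ j8)// natrX.
  by move: (_ ^+ j) => E; nra.
Qed.

(** Up to constants the right-hand side is a lower bound for the energy in annulus j, [rad j]
    standing for its volume. The exponent in [amp_ge] is the one for which all powers of 2^j
    cancel. *)
Lemma energy_ge j : (3 <= j)%N ->
  c0 ^+ 2 / 4 <= 2 `^ (j%:R * (2 * theta)) * dcoef alpha q (2 ^ j - q) ^+ 2 * rad j.
Proof.
move=> j3.
have E : c0 ^+ 2 / 4 = 2 `^ (j%:R * (2 * theta)) * ((2 ^+ j) ^+ q / 2 *
    (c0 * 2 `^ (- (j%:R * (q%:R + theta - 1 / 2))))) ^+ 2 * rad j.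
  have -> : rad j = 2 `^ (- j%:R) :> R by rewrite /rad powRN powR_mulrn.
  have -> : (2 ^+ j) ^+ q = 2 `^ (j%:R * q%:R) :> R by rewrite powRrM !powR_mulrn ?exprn_ge0.
  set a := 2 `^ (j%:R * (2 * theta)); set b := 2 `^ (j%:R * q%:R).
  set c := 2 `^ (- (j%:R * _)); set d := 2 `^ (- j%:R).
  have h : a * b * b * c * c * d = 1.
    rewrite /a /b /c /d -!powRD; try by rewrite pnatr_eq0 implybT.
    by rewrite [X in _ `^ X](_ : _ = 0) ?powRr0//; field.
  rewrite [RHS](_ : _ = c0 ^+ 2 / 4 * (a * b * b * c * c * d)); last by field.
  by rewrite h mulr1.
rewrite E; apply: ler_wpM2r; first by rewrite ltW ?rad_gt0.
apply: ler_wpM2l; first exact: powR_ge0.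
have e2 : 0 <= (2 ^+ j) ^+ q / 2 :> R by rewrite divr_ge0// !exprn_ge0.
apply: lerX2.
  by apply: mulr_ge0 => //; apply: mulr_ge0; [exact: ltW|exact: powR_ge0].
apply: le_trans (dcoef_pow2_ge j3); apply: ler_wpM2l => //.
by apply: amp_ge; exact: leq_trans j3.
Qed.

Lemma integral_sqr_pinfty : theta = 0 -> (\int[mu]_(x in Q) (f x ^+ 2)%:E = +oo)%E.
Proof.
move=> th0; have d0 : 0 < delta by case/andP: delta0.
have k0 : 0 < c0 ^+ 2 / 4 * (1 / 16 / 8 * delta ^+ m).
  by rewrite !mulr_gt0 ?exprn_gt0.
apply: (integral_annuli_pinfty (d := delta / 2) _ _ _ k0).
- exact: measurable_polydisc.
- apply/measurable_EFinP; apply: measurable_funX.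
  apply: (@measurable_funS _ _ _ _ (@cyl R m)); first exact: measurable_cyl.
    by move=> x [].
  exact: measurable_plane_series (radius_ge1_dcoef q alpha0).
- by move=> x; rewrite lee_fin sqr_ge0.
- move=> j j3 x Ax; have r01 : 0 < (rad j : R) <= 1 by rewrite rad_gt0 rad_le1.
  by have [h1 h2] := annulus_sub_polydisc r01 Ax; split => // i; apply: lt_le_trans (h2 i) _; lra.
move=> j j3; apply: le_trans (sqr_annulus alpha0 delta0 q2 j3).
have r01 : 0 < (rad j : R) <= 1 / 2.
  by rewrite rad_gt0; have := @rad_le R _ _ (leq_trans (isT : (1 <= 3)%N) j3); rewrite {2}/rad expr1; lra.
have d20 : 0 < delta / 2 by lra.
apply: le_trans (lee_pmul _ _ (lexx _) (annulus_volume r01 d20)); last 2 first.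
  by rewrite lee_fin divr_ge0 ?sqr_ge0.
  by rewrite lee_fin mulr_ge0 ?divr_ge0 ?exprn_ge0 ?(ltW (rad_gt0 j))// mulr_ge0// ltW.
rewrite -EFinM lee_fin (_ : 2 * (delta / 2) = delta); last by field.
have := energy_ge j3; rewrite th0 !mulr0 powRr0 mul1r => h.
rewrite [leRHS](_ : _ = dcoef alpha q (2 ^ j - q) ^+ 2 * rad j * (1 / 16 / 8 * delta ^+ m)); last by field.
by apply: ler_wpM2r => //; rewrite mulr_ge0// exprn_ge0// ltW.
Qed.

(** The cube volume, of order ([rad j])^n, divided by the kernel scale ([rad j])^(n + 2 theta)
    leaves the factor 2^(2 j theta) of [energy_ge]. *)
Lemma integral_slob_pinfty : (q <= 1)%N ->
  (\int[mu]_(x in Q) slob (n%:R + 2 * theta) f Q x = +oo)%E.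
Proof.
move=> q1; have d0 : 0 < delta by case/andP: delta0.
set p := n%:R + 2 * theta; have p0 : 0 <= p by rewrite addr_ge0// mulr_ge0.
set C := delta ^+ n / (2 * (n%:R * 3) `^ p).
have C0 : 0 < C by rewrite divr_gt0 ?exprn_gt0// mulr_gt0// powR_gt0// mulr_gt0// ltr0n.
have k0 : 0 < c0 ^+ 2 / 4 * (C * (1 / 128 / 8) * delta ^+ m).
  have c4 : 0 < c0 ^+ 2 / 4 by rewrite divr_gt0 ?exprn_gt0.
  apply: mulr_gt0 => //; apply: mulr_gt0; last exact: exprn_gt0.
  by apply: mulr_gt0.
apply: (integral_annuli_pinfty (d := delta / 2) _ _ _ k0).
- exact: measurable_polydisc.
- apply: measurable_slob; first exact: measurable_polydisc.
  apply: (@measurable_funS _ _ _ _ (@cyl R m)); first exact: measurable_cyl.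
    by move=> x [].
  exact: measurable_plane_series (radius_ge1_dcoef q alpha0).
- exact: slob_ge0.
- move=> j j3 x Ax; have r01 : 0 < (rad j : R) <= 1 by rewrite rad_gt0 rad_le1.
  by have [h1 h2] := annulus_sub_polydisc r01 Ax; split => // i; apply: lt_le_trans (h2 i) _; lra.
move=> j j3; apply: le_trans (slob_annulus alpha0 delta0 q1 j3 p0).
have r01 : 0 < (rad j : R) <= 1 / 2.
  by rewrite rad_gt0; have := @rad_le R _ _ (leq_trans (isT : (1 <= 3)%N) j3); rewrite {2}/rad expr1; lra.
have d20 : 0 < delta / 2 by lra.
have WE : (delta * rad j) ^+ n / (2 * (n%:R * (3 * rad j)) `^ p) = C * 2 `^ (j%:R * (2 * theta)).
  have rE : rad j = 2 `^ (- j%:R) :> R by rewrite /rad powRN powR_mulrn.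
  have nR0 : 0 <= n%:R * 3 :> R by rewrite mulr_ge0.
  rewrite mulrA (powRM _ nR0 (ltW (rad_gt0 j))) exprMn.
  have -> : rad j ^+ n = rad j `^ p * 2 `^ (j%:R * (2 * theta)).
    rewrite -powR_mulrn ?(ltW (rad_gt0 j))// rE -!powRrM -powRD; last by rewrite pnatr_eq0 implybT.
    by congr (_ `^ _); rewrite /p; ring.
  rewrite /C; have : 0 < rad j `^ p by rewrite powR_gt0 ?rad_gt0.
  have : 0 < (n%:R * 3) `^ p by rewrite powR_gt0// mulr_gt0// ltr0n.
  move: (_ `^ p) (rad j `^ p) (_ `^ (j%:R * _)) (delta ^+ n) => a b c e a0 b0.
  by field; rewrite (gt_eqF a0) (gt_eqF b0).
rewrite WE.
set B := dcoef alpha q (2 ^ j - q) ^+ 2; set T := 2 `^ _.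
have B0 : 0 <= B / 128 by rewrite divr_ge0 ?sqr_ge0.
have CT0 : 0 <= C * T by rewrite mulr_ge0 ?powR_ge0// ltW.
apply: le_trans (lee_pmul _ _ (lexx _) (annulus_volume r01 d20)); last 2 first.
  by rewrite lee_fin mulr_ge0.
  by rewrite lee_fin mulr_ge0 ?divr_ge0 ?exprn_ge0 ?(ltW (rad_gt0 j))// mulr_ge0// ltW.
rewrite -EFinM lee_fin (_ : 2 * (delta / 2) = delta); last by field.
have := energy_ge j3; rewrite -/B -/T => h.
rewrite [leRHS](_ : _ = T * B * rad j * (C * (1 / 128 / 8) * delta ^+ m)); last by field.
apply: ler_wpM2r h; apply: mulr_ge0; last by rewrite exprn_ge0// ltW.
by apply: mulr_ge0 => //; exact: ltW.
Qed.

End lacunary_energy.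

(** * Transfer between Omega and the polydisc *)

Section sobolev_transfer.
Context {R : realType} {m : nat}.
Local Notation n := (2 + m)%N.
Local Notation V := 'rV[R]_n.
Local Notation lambda := (lebesgue_rV n).
Implicit Types (x : V) (Q U : set V) (f v : V -> R).

(** Near x the difference quotients are bounded by |g 1 x| + 1, so mu is continuous on the ray; this
    makes Omega a Borel set. *)
Lemma measurable_smooth_on_ray (mu : R -> R) : smooth_on_ray mu ->
  measurable_fun (`[0, +oo[%classic : set R) mu.
Proof.
move=> [g [g0 gD]]; apply: subspace_continuous_measurable_fun; first exact: measurable_itv.
apply/subspace_continuousP => x; rewrite /= in_itv /= andbT => x0.
have /cvgrPdist_lt /(_ 1 ltr01) := gD 0%N x x0.
rewrite !near_withinE => /nbhs_ballP[d /= d0 H].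
apply/cvgrPdist_lt => e e0; rewrite near_withinE.
set L := `|g 1%N x| + 1; have L0 : 0 < L by rewrite ltr_wpDl.
apply/nbhs_ballP; exists (Num.min d (e / L)); first by rewrite /= lt_min d0 divr_gt0.
move=> y /=; rewrite /ball /= lt_min => /andP[yd ye]; rewrite in_itv /= andbT => y0.
have [->|yx] := eqVneq y x; first by rewrite subrr normr0.
have := H (y - x); rewrite /ball /= sub0r normrN distrC => /(_ yd).
rewrite subr_eq0 => /(_ yx); rewrite addrC subrK => /(_ y0).
rewrite !g0// => h.
have h2 : `|(y - x)^-1 * (mu y - mu x)| < L.
  have := ler_normD (g 1%N x - ((y - x)^-1 * (mu y - mu x))) (- g 1%N x).
  rewrite normrN addrAC subrr sub0r normrN => h3; apply: le_lt_trans h3 _.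
  by rewrite addrC ltrD2l.
rewrite distrC; move: h2; rewrite normrM normfV mulrC ltr_pdivrMr ?normr_gt0 ?subr_eq0// => h2.
by apply: lt_trans h2 _; rewrite mulrC -ltr_pdivlMr// distrC.
Qed.

Lemma measurable_omega (mu : R -> R) : measurable_fun (`[0, +oo[%classic : set R) mu ->
  measurable (@omega R m mu).
Proof.
move=> mmu; rewrite (_ : omega mu = [set x | normc (cz x) ^+ 2 < mu (enorm (rsubmx x) ^+ 2)]); last first.
  by apply/seteqP; split => x /=; rewrite /omega /= normc_sqr.
have mb : measurable_fun setT (fun x : V => normc (cz x) ^+ 2 < mu (enorm (rsubmx x) ^+ 2)); last first.
  rewrite -[X in measurable X]setTI.
  by apply: (mb measurableT [set true]).
apply: measurable_fun_ltr.
  exact: measurable_normc_cz.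
apply: (@measurable_comp _ _ _ _ _ _ (`[0, +oo[%classic : set R) mu setT
  (fun x : V => enorm (rsubmx x) ^+ 2)) => //.
  by move=> _ [x _ <-]; rewrite /= in_itv /= sqr_ge0.
apply: measurable_funX; apply: measurable_enorm.
by apply: measurable_fun_coordP => i; under eq_fun do rewrite mxE; exact: measurable_coord.
Qed.

Lemma open_polydisc (delta : R) : open (@polydisc R m delta).
Proof.
rewrite (_ : polydisc _ = @cyl R m `&` [set x | forall i, `|x 0 (rshift 2 i)| < delta]); last first.
  by apply/seteqP; split => x [h1 h2]; split => // i; have := h2 i; rewrite mxE.
apply: openI; first exact: open_cyl.
rewrite openE => x /= h.
apply: (@filter_forall _ _ (fun i y => `|y 0 (rshift 2 i)| < delta) (nbhs x)) => i.
have ci : `|y 0 (rshift 2 i)| @[y --> x] --> `|x 0 (rshift 2 i)|.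
  by apply: cvg_norm; exact: coord_continuous.
exact: (cvgr_lt _ ci delta (h i)).
Qed.

Lemma polydisc_omega (mu : R -> R) (rho delta : R) : (forall t, 0 <= t <= rho -> mu t = 1) ->
  0 <= delta -> (m%:R * delta) ^+ 2 <= rho -> @polydisc R m delta `<=` omega mu.
Proof.
move=> mu1 d0 dr x [h1 h2]; rewrite /omega /= mu1.
  have := normc_sqr (cz x); rewrite /= => <-.
  by have := normc_ge0 (cz x); nra.
rewrite sqr_ge0 /=; apply: le_trans dr; apply: lerX2; first exact: sqrtr_ge0.
by apply: enorm_le_coord => // i; exact: ltW.
Qed.

Lemma square_integrable_lty Q U f v : measurable U -> measurable Q -> Q `<=` U ->
  measurable_fun Q f -> lambda.-negligible [set x | Q x /\ v x <> f x] ->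
  square_integrable U v -> (\int[lambda]_(x in Q) (f x ^+ 2)%:E < +oo)%E.
Proof.
move=> mU mQ QU mf neg [mv /integrableP[_ iv]].
have mv2 : measurable_fun U (fun x => (v x ^+ 2)%:E).
  by apply/measurable_EFinP; exact: measurable_funX.
have v20 x : (0 <= (v x ^+ 2)%:E)%E by rewrite lee_fin sqr_ge0.
apply: le_lt_trans iv.
apply: (@le_trans _ _ (\int[lambda]_(x in U) (v x ^+ 2)%:E)%E); last first.
  by rewrite le_eqVlt; apply/orP; left; apply/eqP; apply: eq_integral => x _; rewrite gee0_abs.
apply: (@le_trans _ _ (\int[lambda]_(x in Q) (v x ^+ 2)%:E)%E); last first.
  exact: (ge0_subset_integral lambda mQ mU mv2 (fun x _ => v20 x) QU).
rewrite le_eqVlt; apply/orP; left; apply/eqP; apply: ae_eq_integral => //.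
- by apply/measurable_EFinP; exact: measurable_funX.
- exact: (measurable_funS mU QU mv2).
- apply: negligibleS (neg) => x /= /not_implyP[Qx h]; split => // vf; apply: h.
  by rewrite vf.
Qed.

(** The nonnegative integrand allows both variables to be restricted from U to Q; v is then replaced
    by f, which changes it on a null set in each variable. *)
Lemma gagliardo_lty theta Q U f v : measurable U -> measurable Q -> Q `<=` U ->
  measurable_fun Q f -> measurable_fun U v -> lambda.-negligible [set x | Q x /\ v x <> f x] ->
  (gagliardo theta U v < +oo)%E ->
  (\int[lambda]_(x in Q) slob (n%:R + 2 * theta) f Q x < +oo)%E.
Proof.
move=> mU mQ QU mf mv neg; rewrite gagliardoE; set p := _ + _; move=> iv.
have mvQ : measurable_fun Q v by exact: measurable_funS mU QU mv.
apply: le_lt_trans iv.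
apply: (@le_trans _ _ (\int[lambda]_(x in Q) slob p v U x)%E); last first.
  exact: (ge0_subset_integral lambda mQ mU (measurable_slob p mU mv) (fun x _ => slob_ge0 p v U x) QU).
apply: (@le_trans _ _ (\int[lambda]_(x in Q) slob p v Q x)%E); last first.
  apply: ge0_le_integral => //.
  - by move=> x _; exact: slob_ge0.
  - exact: measurable_slob.
  - exact: measurable_funS mU QU (measurable_slob p mU mv).
  - move=> x Qx; apply: (ge0_subset_integral lambda mQ mU _ _ QU).
      exact: measurable_kern_r.
    by move=> y _; rewrite lee_fin kern_ge0.
rewrite le_eqVlt; apply/orP; left; apply/eqP; apply: ae_eq_integral => //.
- exact: measurable_slob.
- exact: measurable_slob.
apply: negligibleS (neg) => x /= /not_implyP[Qx h]; split => // vf; apply: h.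
apply: ae_eq_integral => //; try exact: measurable_kern_r.
apply: negligibleS neg => y /= /not_implyP[Qy h]; split => // vfy; apply: h.
by rewrite /kern vf vfy.
Qed.

End sobolev_transfer.

(** * Failure of Sobolev regularity *)

Section not_sobolev.
Context {R : realType} {m : nat}.
Local Notation n := (2 + m)%N.
Local Notation V := 'rV[R]_n.
Local Notation lambda := (lebesgue_rV n).
Implicit Types (alpha s t : R).

(** The orders t = sigma + 1/2 to be excluded. *)
Definition singular_exponent alpha t : Prop :=
  (alpha = 0 /\ 1 / 2 < t) \/ (0 < alpha /\ alpha + 1 / 2 <= t).

Lemma singular_amp_ge alpha t : singular_exponent alpha t -> exists2 c0 : R, 0 < c0 &
  forall j, (0 < j)%N -> c0 * 2 `^ (- (j%:R * (t - 1 / 2))) <= lacunary_amp alpha j.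
Proof.
case=> [[-> t2]|[a0 at2]].
  have tau0 : 0 < t - 1 / 2 by rewrite subr_gt0.
  have [c0 c00 H] := lacunary_amp_lower (lexx (0 : R)) tau0.
  by exists c0 => // j j0; have := H j j0; rewrite add0r.
exists 1 => // j j0; rewrite mul1r /lacunary_amp gt_eqF//.
rewrite ler_powR ?ler1n// lerN2; apply: ler_wpM2l => //; lra.
Qed.

(** Cases on the integer part of s. If it is 0, u itself has infinite Slobodeckij energy of order s.
    If it is 1, the first x_1-derivative has infinite energy of order s - 1, or infinite L^2 norm
    when s = 1. Otherwise the second x_1-derivative is not in L^2, order 2 being singular because
    alpha + 1/2 < 2. *)
Lemma lacunary_sum_not_sobolev (mu : R -> R) (rho alpha s : R) : smooth_on_ray mu ->
  0 < rho -> (forall t, 0 <= t -> mu t <= 1) -> (forall t, 0 <= t <= rho -> mu t = 1) ->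
  0 <= alpha < 1 -> singular_exponent alpha s ->
  ~ sobolev_space s (@omega R m mu) (lacunary_sum alpha).
Proof.
move=> smu rho0 mu_le1 mu_eq1 /andP[a0 a1] sing; rewrite lacunary_sumE.
have s0 : 1 / 2 < s by case: sing => [[]|[? ?]]//; lra.
pose r0 : R := Num.min 1 rho.
have r00 : 0 < r0 by rewrite lt_min ltr01.
have [r01 r0rho] : r0 <= 1 /\ r0 <= rho by rewrite !ge_min !lexx orbT.
(* Then delta = k/8 satisfies both delta <= 1/8 and (m delta)^2 <= rho, as needed for the annuli and
   for the inclusion of the polydisc in Omega. *)
pose k := r0 / m.+1%:R.
have k0 : 0 < k by rewrite divr_gt0.
have kE : m%:R * k + k = r0 by rewrite -[X in _ + X]mul1r -mulrDl natr1 mulrC divfK// pnatr_eq0.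
have mk0 : 0 <= m%:R * k by rewrite mulr_ge0// ltW.
pose delta := k / 8.
have delta0 : 0 < delta <= 1 / 8 by rewrite /delta; apply/andP; split; lra.
set Q := @polydisc R m delta; set U := omega mu.
have QU : Q `<=` U.
  apply: (polydisc_omega mu_eq1); first by case/andP: delta0 => /ltW.
  by rewrite /delta mulrA; move: (m%:R * k) kE mk0 => a *; nra.
have mU : measurable U by apply: measurable_omega; exact: measurable_smooth_on_ray.
have mQ : measurable Q by exact: measurable_polydisc.
have Qcyl : Q `<=` @cyl R m by move=> x [].
have rc := radius_ge1_lacunary a0.
have mf q : measurable_fun Q (plane_series 1 (dcoef alpha q) : V -> R).
  apply: (@measurable_funS _ _ _ _ (@cyl R m)) => //; first exact: measurable_cyl.
  exact: measurable_plane_series (radius_ge1_dcoef q a0).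
have ae_eq p v : square_integrable U v ->
    weak_partial (nseq p (lshift m 0)) U (plane_series 1 (lacunary_coef alpha)) v ->
    lambda.-negligible [set x | Q x /\ v x <> plane_series 1 (dcoef alpha p) x].
  by move=> sv wv; have := negligible_weak_partial mU rc sv wv (@open_polydisc R m delta) QU Qcyl.
have not_sqr q : (q <= 2)%N -> singular_exponent alpha q%:R ->
    (exists v, square_integrable U v /\
      weak_partial (nseq q (lshift m 0)) U (plane_series 1 (lacunary_coef alpha)) v) -> False.
  move=> q2 /singular_amp_ge[c0 c00 H] [v [sv wv]].
  have := square_integrable_lty mU mQ QU (mf q) (ae_eq q v sv wv) sv.
  rewrite (@integral_sqr_pinfty _ _ alpha delta 0 c0)// => j j0.
  by rewrite addr0; exact: H.
have not_slob q theta : (q <= 1)%N -> 0 <= theta -> singular_exponent alpha (q%:R + theta) ->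
    (exists v, [/\ square_integrable U v,
      weak_partial (nseq q (lshift m 0)) U (plane_series 1 (lacunary_coef alpha)) v &
      (gagliardo theta U v < +oo)%E]) -> False.
  move=> q1 th0 /singular_amp_ge[c0 c00 H] [v [sv wv gv]].
  have [mv _] := sv.
  have := gagliardo_lty mU mQ QU (mf q) mv (ae_eq q v sv wv) gv.
  by rewrite (@integral_slob_pinfty _ _ alpha delta theta c0)// (leq_trans q1).
rewrite /sobolev_space => -[_ H].
have s00 : 0 <= s by lra.
have /andP[t1 t2] := truncn_itv s00.
move: (Num.truncn s) t1 t2 H => [|[|p]] t1 t2 H.
- apply: (not_slob 0%N s) => //; rewrite ?add0r//.
  have [v [sv wv gv]] := H [::] isT; exists v; split => //.
  by move: gv; rewrite subr0; apply => //; lra.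
- have [v [sv wv gv]] := H [:: lshift m 0] isT.
  have [th0|th0] := ltP 0 (s - 1%:R).
    apply: (not_slob 1%N (s - 1%:R)) => //; first exact: ltW.
      by rewrite addrC subrK.
    by exists v; split => //; exact: gv.
  have s1 : s = 1%:R by apply/eqP; rewrite eq_le t1 andbT -subr_le0.
  by apply: (not_sqr 1%N) => //; [rewrite -s1|exists v].
- have [v [sv wv _]] := H [:: lshift m 0; lshift m 0] isT.
  apply: (not_sqr 2%N) => //; last by exists v.
  by case: sing => [[-> _]|[b0 _]]; [left|right]; split => //; lra.
Qed.

End not_sobolev.

Unset Implicit Arguments.

Theorem theorem14 (R : realType) (n : nat) (hn : (3 <= n)%N)
  (rho : R) (hrho : 0 < rho) (mu : R -> R)
  (mu_smooth : smooth_on_ray mu)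
  (mu_le1 : forall t : R, 0 <= t -> mu t <= 1)
  (mu_eq1 : forall t : R, 0 <= t <= rho -> mu t = 1)
  (mu_pos : forall t : R, 0 < t < 2 * rho -> 0 < mu t)
  (mu_neg : forall t : R, 2 * rho < t -> mu t < 0)
  (mu_der : (mu^`())%classic (2 * rho) < 0)
  (alpha : R) (halpha : 0 <= alpha < 1) :
  let Omega : set 'rV[R]_(2 + (n - 2)%N) := omega mu in
  let u : 'rV[R]_(2 + (n - 2)%N) -> R := lacunary_sum alpha in
  [/\ forall x, closure Omega x -> cvgn (series (lacunary_term alpha x)),
      harmonic_on Omega u,
      holder_space alpha (closure Omega) u,
      forall eps : R, 0 < eps -> ~ holder_space (alpha + eps) (closure Omega) u &
      forall sigma : R,
        (alpha = 0 -> 0 < sigma -> ~ sobolev_space (sigma + 2^-1) Omega u) /\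
        (0 < alpha -> alpha <= sigma ->
           ~ sobolev_space (sigma + 2^-1) Omega u)].
Proof.
move=> Omega u; have /andP[a0 a1] := halpha.
have two_inv : 2^-1 = 1 / 2 :> R by rewrite div1r.
split.
- by move=> x /(closure_omega mu_le1) x1; rewrite lacunary_termE; exact: lacunary_cvg.
- rewrite /u lacunary_sumE; apply: (harmonic_on_subset (omega_cyl mu_le1)).
  exact: plane_series_harmonic (radius_ge1_lacunary a0).
- exact: lacunary_sum_holder.
(* mu = 1 at 0 puts the segment [0, 1[ of the first axis inside Omega. *)
- by move=> eps; apply: lacunary_sum_not_holder => //; rewrite mu_eq1// lexx ltW.
- move=> sigma; rewrite two_inv; split=> [al0 sigma0|al0 al_sigma];
    apply: (lacunary_sum_not_sobolev mu_smooth hrho mu_le1 mu_eq1 halpha).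
  + by left; split => //; rewrite ltrDr.
  + by right; rewrite lerD2r.
Qed.
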